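(* Let $t\geq 1$ be an integer, set $g=2t+2$, and let $\mathbf{x}=(x_1,\dots,x_t)$ be indeterminates. Then, as an identity of formal power series in $T$ whose coefficients are Laurent polynomials in $x_1,\dots,x_t$, $$\sum_{\omega\in\mathcal{DD}_{(2t+2)}} (-1)^{d_{\omega}+\lvert H_+(\omega)\rvert}\,T^{\lvert\omega\rvert/2}\,\mathrm{sp}_{\mu(\omega)}(\mathbf{x})=(T;T)_\infty^t\, K_T(t,\mathbf{x})\prod_{i=1}^t \left(Tx_i^2,Tx_i^{-2};T\right)_\infty,$$ where, for each $\omega$, $\mathbf{v}=(v_1,\dots,v_t)$ is the $V_{g,t}$-coding of $\omega$ and $\mu(\omega)$ is the partition with $\mu_i=v_i+i-2t-2$ for $1\leq i\leq t$.
   Context: A partition $\lambda=(\lambda_1\geq\lambda_2\geq\dots)$ (with $\lambda_i=0$ for $i>\ell(\lambda)$) has Ferrers diagram consisting of boxes $(i,j)$ with $1\leq j\leq\lambda_i$; $\lambda'$ is the conjugate partition; $|\lambda|=\sum\lambda_i$. The hook length of a box $s=(i,j)$ is $h_s=\lambda_i-j+\lambda'_j-i+1$. The Durfee size is $d_\lambda=\max\{s:\lambda_s\geq s\}$. For a box $s=(i,j)$, $\varepsilon_s=-1$ if $i>j$ (strictly below the main diagonal) and $\varepsilon_s=1$ otherwise. A partition is a $k$-core if none of its hook lengths is divisible by $k$. $\mathcal{DD}$ (doubled distinct partitions) is the set of partitions $\lambda$ with $\lambda_i=\lambda'_i+1$ for all $1\leq i\leq d_\lambda$; $\mathcal{DD}_{(k)}$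 is the set of elements of $\mathcal{DD}$ that are $k$-cores. For $\omega$ and $g=2t+2$, $H_+(\omega)=\{s\in\omega: h_s<g,\ \varepsilon_s=1\}$. $V_{g,t}$-coding: for a partition $\lambda$ and each residue $r\in\{0,\dots,g-1\}$, let $\beta_r=g+\max\{\lambda_j-j: j\geq 1,\ \lambda_j-j\equiv r \pmod g\}$ (here $j$ ranges over all positive integers, with $\lambda_j=0$ for $j>\ell(\lambda)$). These $g$ integers are distinct; list them in decreasing order $\beta_{\sigma(1)}>\dots>\beta_{\sigma(g)}$. The $V_{g,t}$-coding of $\lambda$ is $(v_1,\dots,v_t)=(\beta_{\sigma(1)},\dots,\beta_{\sigma(t)})$. Symplectic Schur function: for a partition $\mu$ with at most $t$ parts, $\mathrm{sp}_\mu(\mathbf{x})=\det_{1\leq i,j\leq t}\big(x_j^{\mu_i+t-i+1}-x_j^{-(\mu_i+t-i+1)}\big)/\det_{1\leq i,j\leq t}\big(x_j^{t-i+1}-x_j^{-(t-i+1)}\big)$. $(a;T)_\infty=\prod_{j\geq0}(1-aT^j)$, $(a_1,\dots,a_n;T)_\infty=\prod_k (a_k;T)_\infty$, and $K_T(t,\mathbf{x})=\prod_{1\leq i<j\leq t}\left(Tx_ix_j,Tx_i^{-1}x_j^{-1},Tx_ix_j^{-1},Tx_jx_i^{-1};T\right)_\infty$. *)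

(* Defs.v *)
From HB Require Import structures.
From mathcomp Require Import all_boot all_order all_algebra.
From mathcomp Require Import fraction.
From mathcomp Require Import mpoly.
Set Implicit Arguments. Unset Strict Implicit. Unset Printing Implicit Defensive.
Import Order.TTheory GRing.Theory Num.Theory.

Definition is_partition (la : seq nat) : bool :=
  sorted geq la && all (fun p => 0 < p) la.

Definition part (la : seq nat) (i : nat) : nat := nth 0 la i.-1.
Definition conjp (la : seq nat) (j : nat) : nat := count (fun p => j <= p) la.
Definition psize (la : seq nat) : nat := sumn la.

Definition boxes (la : seq nat) : seq (nat * nat) :=
  [seq (i, j) | i <- iota 1 (size la), j <- iota 1 (part la i)].

Definition hook (la : seq nat) (s : nat * nat) : nat :=
  part la s.1 - s.2 + conjp la s.2 - s.1 + 1.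

Definition durfee (la : seq nat) : nat :=
  \max_(1 <= s < (size la).+1 | s <= part la s) s.

Definition is_DD (la : seq nat) : bool :=
  [forall s : 'I_(durfee la), part la s.+1 == (conjp la s.+1).+1].

Definition is_core (k : nat) (la : seq nat) : bool :=
  all (fun s => ~~ (k %| hook la s)) (boxes la).

(* epsilon_s = 1 iff i <= j ; H_+ for g *)
Definition Hplus_card (g : nat) (la : seq nat) : nat :=
  count (fun s => (hook la s < g) && (s.1 <= s.2)) (boxes la).

(* beta_r = g + max { lambda_j - j : j >= 1, lambda_j - j = r mod g }.
   For j > size la + g the value lambda_j - j = -j is smaller than the value
   at j - g (same residue), so the max is attained with 1 <= j <= size la + g. *)
Definition beta (g : nat) (la : seq nat) (r : nat) : int :=
  g%:Z + \big[Order.max/(- (size la + g)%:Z)%R]_(1 <= j < (size la + g).+1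
          | intdiv.modz ((part la j)%:Z - j%:Z - r%:Z)%R g%:Z == 0%R)
          ((part la j)%:Z - j%:Z)%R.

Definition betas (g : nat) (la : seq nat) : seq int :=
  [seq beta g la r | r <- iota 0 g].

Definition Vcoding (g t : nat) (la : seq nat) : seq int :=
  take t (sort (fun a b : int => (b <= a)%R) (betas g la)).

Definition mu_of (t : nat) (la : seq nat) (i : 'I_t) : int :=
  ((nth 0 (Vcoding (2 * t + 2) t la) i) + (i.+1)%:Z - (2 * t + 2)%:Z)%R.

Local Open Scope ring_scope.
Definition Frac (t : nat) := {fraction {mpoly int[t]}}.
Definition xvar (t : nat) (i : 'I_t) : Frac t := tofrac ('X_i : {mpoly int[t]}).

Definition sp (t : nat) (mu : 'I_t -> int) : Frac t :=
  \det (\matrix_(i < t, j < t)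
          (xvar j ^ (mu i + (t - i)%N%:Z) - xvar j ^ (- (mu i + (t - i)%N%:Z))))
  / \det (\matrix_(i < t, j < t)
          (xvar j ^ ((t - i)%N%:Z) - xvar j ^ (- (t - i)%N%:Z))).

(* Partitions with |la| <= m are encoded (bijectively, for nonincreasing
   encodings) by ffuns 'I_m -> 'I_m.+1 listing parts padded with zeros *)
Definition ffun_part (m : nat) (f : {ffun 'I_m -> 'I_m.+1}) : seq nat :=
  [seq k <- [seq (val (f i)) | i <- enum 'I_m] | (0 < k)%N].
Definition enc_ok (m : nat) (f : {ffun 'I_m -> 'I_m.+1}) : bool :=
  sorted geq [seq (val (f i)) | i <- enum 'I_m].

(* coefficient of T^n of the left-hand side: omega ranges over DD_(2t+2)
   with |omega|/2 = n, i.e. |omega| in {2n, 2n+1} *)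
Definition LHS_coef (t n : nat) : Frac t :=
  \sum_(f : {ffun 'I_(2 * n + 1)%N -> 'I_(2 * n + 1)%N.+1} |
          enc_ok f && ((psize (ffun_part f)) %/ 2 == n)%N
          && is_DD (ffun_part f) && is_core (2 * t + 2)%N (ffun_part f))
    (-1) ^+ (durfee (ffun_part f) + Hplus_card (2 * t + 2)%N (ffun_part f))
    * sp (@mu_of t (ffun_part f)).

(* (y T; T)_infty truncated to the factors 1 - y T^k, 1 <= k <= N *)
Definition qfac (t : nat) (N : nat) (y : Frac t) : {poly Frac t} :=
  \prod_(k < N) (1 - y *: ('X^(k.+1) : {poly Frac t})).

Definition RHS_trunc (t N : nat) : {poly Frac t} :=
  qfac N 1 ^+ t
  * (\prod_(i < t) \prod_(j < t | (i < j)%N)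
       (qfac N (xvar i * xvar j) * qfac N (xvar i * xvar j)^-1
        * qfac N (xvar i / xvar j) * qfac N (xvar j / xvar i)))
  * \prod_(i < t) (qfac N (xvar i ^+ 2) * qfac N (xvar i ^+ 2)^-1).

(* Main.v *)
(* Both sides are compared with Macdonald's identity of affine type C_t. With
   g = 2t + 2, put theta_k(z) = sum over m in Z of
   T^((t+1) m^2 + k m) (z^(gm+k) - z^(-(gm+k))); the claim is that
   Delta(x) RHS(x) = det (theta_(t-i+1)(x_j)), where Delta is the Weyl denominator.

   In each variable z = x_i, the product Delta(x) RHS(x) is odd under z -> 1/z and
   quasi-periodic under z -> T z. The resulting recurrence on its Laurent
   coefficients shows that it is a combination of theta_1, ..., theta_t with
   coefficients independent of z. Such a combination is determined by its values at
   w, ..., w^t, where w is a primitive g-th root of unity, so it is enough to compare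
   the two sides when every x_i is one of these powers. There theta_k(w^j) factors as
   (w^(jk) - w^(-jk)) times a series that the Jacobi triple product evaluates, and
   the product side follows from prod_c (1 - w^c u) = 1 - u^g.

   Expanding the determinant, the coefficient of T^n is a sum over
   (m_1, ..., m_t) in Z^t with sum of (t+1) m_k^2 + k m_k equal to n. These vectors
   parametrize the g-cores in DD of size 2n: on the g-runner abacus of such a core,
   the runners are antisymmetric in pairs, two of them are fixed, and m_k is the
   height of runner k. The numbers v_i - t - 1 are the |g m_k + k| in decreasing
   order, so the two determinants agree up to the sign of the sorting permutation
   and the signs of the g m_k + k. A parity count over pairs of runners identifies
   this sign with (-1)^(d + |H_+|). *)
Require Import Defs.
From HB Require Import structures.
From mathcomp Require Import all_boot all_order all_fingroup all_algebra.
From mathcomp Require Import fraction mpoly.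
From mathcomp Require Import generic_quotient algC cyclotomic.
From mathcomp Require Import zify ring.
Import GRing.Theory.
Set Implicit Arguments. Unset Strict Implicit. Unset Printing Implicit Defensive.
Local Open Scope ring_scope.

(** * Power series modulo a power of T *)

(** Infinite products are cut to finitely many factors and Laurent polynomials in z are multiplied
    by a power of z, so every object is a polynomial. The cut leaves explicit end factors in an
    exact functional equation under z -> T z, and these are trivial modulo T^N. The number g = 2t +
    2 is the degree of that equation in one variable z: the factors in z^2 contribute 4 and each of
    the t - 1 other variables contributes 2. Oddness pairs the residues k and g - k and kills the
    coefficients at 0 and t + 1, which leaves t free coefficients. Evaluation at w, ..., w^t
    recovers them because the matrix with entries w^(jk) - w^(-jk) is the matrix of a Weyl
    denominator that does not vanish there. The fraction field of Z[x] contains no such w, so the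
    identity is proved over any field of characteristic 0 that has one, applied to fractions over
    [algC], and pulled back along an embedding. *)

Section Congruence.
Variable K : fieldType.
Implicit Types (p q r : {poly K}) (M : nat).

(* Power series in T are modelled by polynomials, compared modulo [T ^+ M]. *)
Definition eqm M p q := forall k, (k < M)%N -> p`_k = q`_k.

Lemma eqm_refl M p : eqm M p p. Proof. by []. Qed.

Lemma eqm_sym M p q : eqm M p q -> eqm M q p.
Proof. by move=> h k hk; rewrite h. Qed.

Lemma eqm_trans M q p r : eqm M p q -> eqm M q r -> eqm M p r.
Proof. by move=> h1 h2 k hk; rewrite h1 // h2. Qed.

Lemma eqm_leq M' M p q : (M' <= M)%N -> eqm M p q -> eqm M' p q.
Proof. by move=> hM h k hk; apply/h/(leq_trans hk). Qed.

Lemma eqmD M p q p' q' : eqm M p p' -> eqm M q q' -> eqm M (p + q) (p' + q').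
Proof. by move=> h1 h2 k hk; rewrite !coefD h1 // h2. Qed.

Lemma eqmN M p p' : eqm M p p' -> eqm M (- p) (- p').
Proof. by move=> h k hk; rewrite !coefN h. Qed.

Lemma eqmB M p q p' q' : eqm M p p' -> eqm M q q' -> eqm M (p - q) (p' - q').
Proof. by move=> h1 h2; apply/eqmD/eqmN. Qed.

Lemma eqmM M p q p' q' : eqm M p p' -> eqm M q q' -> eqm M (p * q) (p' * q').
Proof.
move=> h1 h2 k hk; rewrite !coefM; apply: eq_bigr => -[j hj] _ /=.
by rewrite h1 ?h2 //; lia.
Qed.

Lemma eqmMl M r p p' : eqm M p p' -> eqm M (r * p) (r * p').
Proof. exact: eqmM. Qed.

Lemma eqmMr M r p p' : eqm M p p' -> eqm M (p * r) (p' * r).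
Proof. by move=> h; apply: eqmM. Qed.

Lemma eqm_sum M (I : Type) (s : seq I) (P : pred I) (F G : I -> {poly K}) :
  (forall i, P i -> eqm M (F i) (G i)) ->
  eqm M (\sum_(i <- s | P i) F i) (\sum_(i <- s | P i) G i).
Proof.
by move=> h; apply: (big_ind2 (eqm M)) => // *; apply: eqmD.
Qed.

Lemma eqm_prod M (I : Type) (s : seq I) (P : pred I) (F G : I -> {poly K}) :
  (forall i, P i -> eqm M (F i) (G i)) ->
  eqm M (\prod_(i <- s | P i) F i) (\prod_(i <- s | P i) G i).
Proof.
by move=> h; apply: (big_ind2 (eqm M)) => // *; apply: eqmM.
Qed.

Lemma eqmX M n p p' : eqm M p p' -> eqm M (p ^+ n) (p' ^+ n).
Proof.
move=> h; elim: n => [|n IH]; first by rewrite !expr0.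
by rewrite !exprS; apply: eqmM.
Qed.

Lemma eqm_Xn0 M m p : (M <= m)%N -> eqm M ('X^m * p) 0.
Proof.
move=> hM k hk; rewrite coefXnM coef0.
by rewrite (leq_trans hk hM).
Qed.

(** A nonzero constant term makes [u] invertible as a power series; the coefficients are cancelled
    by induction on the index, without loss of precision. *)
Lemma eqm_cancel M (u p q : {poly K}) : u`_0 != 0 -> eqm M (u * p) (u * q) -> eqm M p q.
Proof.
move=> u0 h k; elim/ltn_ind: k => k IH hk.
have := h k hk; rewrite !coefM !big_ord_recl /= !subn0.
rewrite (eq_bigr (fun i : 'I_k => u`_(lift ord0 i) * q`_(k - lift ord0 i))).
  by move/addIr/(mulfI u0).
move=> [i hi] _; rewrite IH //= /bump /=; lia.
Qed.

Lemma eqm_cancel0 M (u p : {poly K}) : u`_0 != 0 -> eqm M (u * p) 0 -> eqm M p 0.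
Proof. by move=> u0 h; apply: (eqm_cancel u0); rewrite mulr0. Qed.

End Congruence.
Arguments eqm_trans [K M] q [p r].

Lemma coef0_prod (K : fieldType) (I : Type) (s : seq I) (P : pred I) (F : I -> {poly K}) :
  (\prod_(i <- s | P i) F i)`_0 = \prod_(i <- s | P i) (F i)`_0.
Proof.
by rewrite -horner_coef0 horner_prod; under eq_bigr do rewrite horner_coef0.
Qed.

(** * The Weyl denominator *)

Section WeylDenominator.
Variable K : fieldType.

Definition altdet (t : nat) (x : 'I_t -> K) (e : 'I_t -> int) : K :=
  \det (\matrix_(i < t, j < t) (x j ^ e i - x j ^ (- e i))).

Definition weyl_den (t : nat) (x : 'I_t -> K) : K :=
  altdet x (fun i => (t - i)%N%:Z).

(** Chebyshev polynomials of the second kind in y = x + 1/x, with shifted index: [cheb k] represents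
    (x^k - x^-k) / (x - x^-1) and has degree k - 1 for k > 0. *)
Fixpoint cheb (k : nat) : {poly K} :=
  if k is k1.+1 then
    if k1 is k2.+1 then 'X * cheb k1 - cheb k2 else 1
  else 0.

Lemma chebSS k : cheb k.+2 = 'X * cheb k.+1 - cheb k. Proof. by []. Qed.

Lemma cheb_size k : (size (cheb k) <= k)%N.
Proof.
have [] : (size (cheb k) <= k)%N /\ (size (cheb k.+1) <= k.+1)%N; last by [].
elim: k => [|k [IH1 IH2]]; first by rewrite size_poly0 size_poly1.
split=> //; rewrite chebSS (leq_trans (size_polyD _ _)) // geq_max size_polyN.
rewrite (leq_trans (size_polyMleq _ _)) ?size_polyX //=.
by rewrite (leq_trans IH1) // -addn2 leq_addr.
Qed.

Lemma cheb_lead k : (cheb k.+1)`_k = 1.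
Proof.
elim: k => [|k IH]; first by rewrite coef1.
by rewrite chebSS coefB coefXM /= IH [(cheb k)`_ _]nth_default ?subr0 ?(leq_trans (cheb_size k)).
Qed.

Lemma cheb_horner (x : K) k : x != 0 ->
  x ^+ k - x ^- k = (x - x^-1) * (cheb k).[x + x^-1].
Proof.
move=> x0.
have [] : x ^+ k - x ^- k = (x - x^-1) * (cheb k).[x + x^-1] /\
  x ^+ k.+1 - x ^- k.+1 = (x - x^-1) * (cheb k.+1).[x + x^-1]; last by [].
elim: k => [|k [IH1 IH2]].
  by rewrite !hornerE !expr0 !expr1 invr1 subrr.
split=> //; rewrite chebSS !hornerE mulrBr -IH1 mulrCA -IH2.
by rewrite !exprS; field; rewrite ?expf_neq0 ?x0 //.
Qed.

(** Column j contains the factor x_j - 1/x_j; what remains is a unitriangular matrix of coefficients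
    of [cheb] times a Vandermonde matrix in x + 1/x. The constant collects two signs: the reversal
    of the rows and the orientation of the differences. *)
Lemma weyl_den_prod (t : nat) : exists2 s : K, s != 0 & forall x : 'I_t -> K,
  (forall i, x i != 0) ->
  weyl_den x = s * (\prod_i (x i - (x i)^-1)) *
    \prod_(i < t) \prod_(j < t | (i < j)%N)
      (x i + (x i)^-1 - (x j + (x j)^-1)).
Proof.
pose s := \prod_(i < t) \prod_(j < t | (i < j)%N) (-1 : K).
pose rp := perm (@rev_ord_inj t).
exists ((-1) ^+ rp * s).
  rewrite mulf_neq0 ?signr_eq0 //; apply/prodf_neq0 => i _.
  by apply/prodf_neq0 => j _; rewrite oppr_eq0 oner_eq0.
move=> x x0; pose y i := x i + (x i)^-1.
pose A := \matrix_(i < t, l < t) (cheb (t - i))`_(rev_ord l).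
pose V := Vandermonde t (\row_(j < t) y j).
have -> : weyl_den x =
    \det (A *m (row_perm rp V *m diag_mx (\row_j (x j - (x j)^-1)))).
  congr (\det _); apply/matrixP => i j; rewrite mxE.
  rewrite mulmxA mul_mx_diag !mxE -exprnN exprnP -exprnP cheb_horner //.
  rewrite mulrC; congr (_ * _).
  rewrite (@horner_coef_wide _ t) ?(leq_trans (cheb_size _)) ?leq_subr //.
  rewrite (reindex_inj rev_ord_inj) /=; apply: eq_bigr => l _.
  by rewrite !mxE permE.
rewrite !det_mulmx det_diag row_permE det_mulmx det_perm det_Vandermonde.
rewrite -det_tr det_trig; last first.
  apply/is_trig_mxP => i j ij; rewrite !mxE nth_default //.
  by rewrite (leq_trans (cheb_size _)) //=; lia.
rewrite big1 ?mul1r => [|i _]; last first.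
  rewrite !mxE /= -[RHS](cheb_lead (t - i.+1)).
  by rewrite -subSn // subSS.
under [\prod_(i < t) (\row_j _) _ _]eq_bigr do rewrite mxE.
rewrite -!mulrA; congr (_ * _).
rewrite [LHS]mulrC [RHS]mulrCA; congr (_ * _).
rewrite /s -big_split; apply: eq_bigr => i _ /=.
rewrite -big_split; apply: eq_bigr => j _ /=.
by rewrite !mxE /y; ring.
Qed.

Lemma weyl_den_neq0 t (x : 'I_t -> K) : (forall i, x i != 0) -> injective x ->
  (forall i j, x i * x j != 1) -> weyl_den x != 0.
Proof.
move=> x0 xinj xx1; have [s s0 ->] // := weyl_den_prod t.
apply: mulf_neq0; first apply: mulf_neq0 s0 _.
  apply/prodf_neq0 => i _; have -> : x i - (x i)^-1 = (x i * x i - 1) / x i.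
    by field.
  by rewrite mulf_neq0 ?invr_eq0 // subr_eq0.
apply/prodf_neq0 => i _; apply/prodf_neq0 => j ij.
have -> : x i + (x i)^-1 - (x j + (x j)^-1) = (x i - x j) * (x i * x j - 1) / (x i * x j).
  by field; rewrite !x0.
rewrite !mulf_neq0 ?invr_eq0 ?mulf_neq0 ?subr_eq0 //.
by apply/eqP => /xinj e; rewrite e ltnn in ij.
Qed.

End WeylDenominator.

(** * Theta functions and their expansions *)

Section Residues.
Variables (R : Type) (idx : R) (op : Monoid.com_law idx).

Lemma big_ord_mul (g Q : nat) (F : nat -> R) :
  \big[op/idx]_(n < g * Q) F n =
    \big[op/idx]_(q < Q) \big[op/idx]_(c < g) F (g * q + c)%N.
Proof.
elim: Q => [|Q IH]; first by rewrite muln0 !big_ord0.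
by rewrite mulnSr big_split_ord /= IH big_ord_recr.
Qed.

(** The map c -> g - c on residues modulo g fixes 0 and t + 1 and pairs the others. This splitting
    serves for theta coefficients, for products over g-th roots of unity and for the runners of the
    abacus. *)
Lemma big_residues (t : nat) (F : nat -> R) :
  \big[op/idx]_(c < 2 * t + 2) F c =
    op (op (F 0%N) (F t.+1))
       (\big[op/idx]_(k < t) op (F k.+1) (F (2 * t + 2 - k.+1)%N)).
Proof.
have -> : (2 * t + 2 = t.+1 + t.+1)%N by lia.
rewrite big_split_ord /= !big_ord_recl /= addn0.
rewrite big_split /= Monoid.mulmACA; congr (op _ _).
rewrite [\big[op/idx]_(k < t) F (t.+1 + t.+1 - k.+1)%N](reindex_inj rev_ord_inj) /=.
by congr (op _ _); apply: eq_bigr => i _; congr (F _); rewrite /bump /=; have := ltn_ord i; lia.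
Qed.

End Residues.
Arguments big_ord_mul {R idx op}.
Arguments big_residues {R idx op}.

Section Theta.
Variable K : fieldType.
Local Notation A := {poly K}.

Definition qpoch (N : nat) (y : K) : A := \prod_(k < N) (1 - y *: 'X^(k.+1)).

(* An element of [{poly A}] is a polynomial in z; [qshift] substitutes [T z] for z. *)
Definition qshift (p : {poly A}) : {poly A} := p \Po ('X : A) *: 'X.

Lemma coef_qshift p k : (qshift p)`_k = 'X^k * p`_k.
Proof.
rewrite /qshift comp_polyE coef_sum.
under eq_bigr => i _ do rewrite exprZn coefZ coefZ coefXn.
have [hk|hk] := ltnP k (size p).
  rewrite (bigD1 (Ordinal hk)) //= eqxx mulr1 big1 ?addr0 1?mulrC // => i.
  by rewrite -val_eqE eq_sym => /negPf /= ->; rewrite !mulr0.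
rewrite nth_default // mulr0 big1 // => -[i hi] _ /=.
by rewrite gtn_eqF ?mulr0 // (leq_trans hi).
Qed.

Lemma qshiftM p q : qshift (p * q) = qshift p * qshift q.
Proof. exact: comp_polyM. Qed.

Lemma qshift_prod (I : Type) (s : seq I) (P : pred I) (F : I -> {poly A}) :
  qshift (\prod_(i <- s | P i) F i) = \prod_(i <- s | P i) qshift (F i).
Proof. exact: rmorph_prod. Qed.

Definition eqB M (p q : {poly A}) := forall k, eqm M p`_k q`_k.

Lemma eqBM M p q p' q' : eqB M p p' -> eqB M q q' -> eqB M (p * q) (p' * q').
Proof.
by move=> h1 h2 k; rewrite !coefM; apply: eqm_sum => j _; apply: eqmM.
Qed.

(** Division by T^L would lose precision modulo T^M, so it is done on the exact equation: since [E]
    has degree at most d, the coefficient of z^(k+d) involves only indices at least k >= L, and [H]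
    absorbs the power T^L. Only then are [E] and [E'] replaced by z^d and 1. *)
Lemma qshift_rec (M L d : nat) (G E E' : {poly A}) :
  E * qshift G = 'X^L *: (E' * G) -> (size E <= d.+1)%N ->
  eqB M E 'X^d -> eqB M E' 1 ->
  forall k, (L <= k)%N -> eqm M G`_(k + d) ('X^(k - L) * G`_k).
Proof.
move=> eqEG szE hE hE' k hk.
pose H := \poly_(i < size G) ('X^(i - L) * G`_i).
have cH i : H`_i = 'X^(i - L) * G`_i.
  by rewrite coef_poly; case: ltnP => // hi; rewrite nth_default ?mulr0.
have eqH : (E * H)`_(k + d) = (E' * G)`_(k + d).
  apply: (@mulfI _ ('X^L : A)); first by rewrite expf_neq0 ?polyX_eq0.
  rewrite -[RHS]coefZ -eqEG !coefM mulr_sumr; apply: eq_bigr => -[j hj] _ /=.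
  rewrite coef_qshift cH; have [hjd|hjd] := ltnP d j.
    by rewrite nth_default ?(leq_trans szE) // !mul0r mulr0.
  by rewrite mulrCA; congr (_ * _); rewrite mulrA -exprD; congr ('X^_ * _); lia.
have h1 : eqm M (E' * G)`_(k + d) G`_(k + d).
  by have := eqBM hE' (fun k => @eqm_refl _ M G`_k) (k + d)%N; rewrite mul1r.
apply: eqm_trans (eqm_sym h1) _; rewrite -eqH.
have h2 : eqB M (E * H) ('X^d * H) by apply: eqBM.
by apply: eqm_trans (h2 _) _; rewrite coefXnM ltnNge leq_addl /= addnK cH.
Qed.

Local Notation T := ('X : A).

(* [theta1 N c] is z^N times a truncation of (cz; T) (T / (cz); T), and [theta2 N] is
   z^(2N) times a truncation of (z^2; T) (T / z^2; T), so that both are polynomials. *)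
Definition theta1 N (c : K) : {poly A} :=
  \prod_(k < N.+1) (1 - (c *: T ^+ k) *: 'X) *
  \prod_(k < N) ('X - (c^-1 *: T ^+ k.+1)%:P).

Definition theta2 N : {poly A} :=
  \prod_(k < N.+1) (1 - T ^+ k *: 'X^2) * \prod_(k < N) ('X^2 - (T ^+ k.+1)%:P).

Lemma qshiftB p q : qshift (p - q) = qshift p - qshift q.
Proof. exact: comp_polyB. Qed.
Lemma qshift1 : qshift 1 = 1.
Proof. exact: comp_polyC. Qed.
Lemma qshiftC c : qshift c%:P = c%:P.
Proof. exact: comp_polyC. Qed.
Lemma qshiftZ (c : A) p : qshift (c *: p) = c *: qshift p.
Proof. exact: comp_polyZ. Qed.
Lemma qshiftX : qshift 'X = T *: 'X.
Proof. exact: comp_polyX. Qed.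
Lemma qshiftX2 : qshift 'X^2 = T ^+ 2 *: 'X^2.
Proof. by rewrite [LHS]rmorphXn /= comp_polyX exprZn. Qed.

(** The substitution moves each product by one factor, so both telescope up to their end factors;
    the two initial ones, [F 0] and [H 0], agree up to the constant - c^-1. *)
Lemma theta1_shift N c : c != 0 ->
  ('X - (c^-1 *: T ^+ N)%:P) * qshift (theta1 N c) =
  (- c^-1 *: T ^+ N) *: ((1 - (c *: T ^+ N.+1) *: 'X) * theta1 N c).
Proof.
move=> c0; rewrite qshiftM !qshift_prod.
under eq_bigr => k _ do rewrite qshiftB qshift1 qshiftZ qshiftX scalerA -scalerAl -exprSr.
have -> : \prod_(k < N) qshift ('X - (c^-1 *: T ^+ k.+1)%:P) =
    \prod_(k < N) (T%:P * ('X - (c^-1 *: T ^+ k)%:P)).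
  apply: eq_bigr => k _; rewrite qshiftB qshiftX qshiftC.
  by rewrite -!mul_polyC exprS; ring.
rewrite big_split /= prodr_const card_ord.
pose F k : {poly A} := 'X - (c^-1 *: T ^+ k)%:P.
pose H k : {poly A} := 1 - (c *: T ^+ k) *: 'X.
have e1 : \prod_(k < N) F k * F N = F 0%N * \prod_(k < N) F k.+1.
  by rewrite -[RHS](big_ord_recl N F) big_ord_recr.
have e2 : H 0%N * \prod_(k < N.+1) H k.+1 = \prod_(k < N.+1) H k * H N.+1.
  by rewrite -[LHS](big_ord_recl N.+1 H) big_ord_recr.
have e3 : F 0%N = (- c^-1)%:P%:P * H 0%N.
  rewrite /F /H -!mul_polyC !expr0 !mulr1 mulrBr mulr1 mulrA -!polyCM mulNr mulVf //.
  by rewrite !polyCN; ring.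
rewrite /theta1 -[RHS]mul_polyC -/(F N) -/(H N.+1).
transitivity ((T ^+ N)%:P * (\prod_(k < N.+1) H k.+1) * (\prod_(k < N) F k * F N)).
  by rewrite -[\prod_(k < N.+1) (1 - _)]/(\prod_(k < N.+1) H k.+1) -[\prod_(k < N) ('X - _)]/(\prod_(k < N) F k) !polyC_exp; ring.
rewrite e1 e3.
transitivity ((T ^+ N)%:P * (- c^-1)%:P%:P * (H 0%N * \prod_(k < N.+1) H k.+1) * \prod_(k < N) F k.+1); first by ring.
by rewrite e2 -mul_polyC polyCM -/(\prod_(k < N.+1) H k) -/(\prod_(k < N) F k.+1); ring.
Qed.

(** Here z^2 becomes T^2 z^2 and the products move by two factors. The first factor of the second
    product would reach exponent -1, so it is rewritten as a multiple of [H 1]; taking it out is why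
    the truncation is [N.+1]. *)
Lemma theta2_shift N :
  ('X^2 - (T ^+ N)%:P) * ('X^2 - (T ^+ N.+1)%:P) * qshift (theta2 N.+1) =
  T ^+ (2 * N.+1).-1 *: ((1 - T ^+ N.+2 *: 'X^2) * (1 - T ^+ N.+3 *: 'X^2) * theta2 N.+1).
Proof.
have -> : ((2 * N.+1).-1 = (2 * N).+1)%N by lia.
rewrite qshiftM !qshift_prod.
under eq_bigr => k _ do rewrite qshiftB qshift1 qshiftZ qshiftX2 scalerA -exprD addn2.
rewrite [X in _ * (_ * X) = _]big_ord_recl.
rewrite qshiftB qshiftX2 qshiftC.
have -> : T ^+ 2 *: 'X^2 - (T ^+ (@ord0 N).+1)%:P = - (T%:P * (1 - T ^+ 1 *: 'X^2)) :> {poly A}.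
  by rewrite -!mul_polyC /=; ring.
have -> : \prod_(k < N) qshift ('X^2 - (T ^+ (lift ord0 k).+1)%:P) =
    \prod_(k < N) ((T ^+ 2)%:P * ('X^2 - (T ^+ k)%:P)).
  apply: eq_bigr => k _; rewrite qshiftB qshiftX2 qshiftC.
  by rewrite -!mul_polyC /= /bump /= !add1n !exprS; ring.
rewrite big_split /= prodr_const card_ord.
pose F k : {poly A} := 'X^2 - (T ^+ k)%:P.
pose H k : {poly A} := 1 - T ^+ k *: 'X^2.
have e1 : \prod_(k < N) F k * F N * F N.+1 = F 0%N * \prod_(k < N.+1) F k.+1.
  by rewrite -[RHS](big_ord_recl N.+1 F) !big_ord_recr.
have e2 : H 0%N * (H 1%N * \prod_(k < N.+2) H k.+2) = \prod_(k < N.+2) H k * H N.+2 * H N.+3.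
  by rewrite -[_ * \prod_(k < _) _](big_ord_recl N.+2 (fun k => H k.+1))
     -[LHS](big_ord_recl N.+3 H) !big_ord_recr.
have e3 : F 0%N = - H 0%N by rewrite /F /H !expr0 scale1r; ring.
rewrite /theta2 -[RHS]mul_polyC -/(F N) -/(F N.+1) -/(H 1%N) -/(H N.+2) -/(H N.+3).
transitivity (- (T ^+ (2 * N).+1)%:P * (H 1%N * \prod_(k < N.+2) H k.+2) * (\prod_(k < N) F k * F N * F N.+1)).
  have eT : T%:P ^+ (2 * N).+1 = T%:P * (T%:P ^+ 2) ^+ N :> {poly A} by rewrite -exprM exprS.
  by rewrite !polyC_exp eT; ring.
rewrite e1 e3.
transitivity ((T ^+ (2 * N).+1)%:P * (H 0%N * (H 1%N * \prod_(k < N.+2) H k.+2)) * \prod_(k < N.+1) F k.+1); first by ring.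
by rewrite e2; ring.
Qed.
End Theta.

Section ThetaProduct.
Variable K : fieldType.
Local Notation A := {poly K}.
Local Notation T := ('X : A).

(** With [ys] the other variables, [theta_val] is the part of Delta RHS that depends on the variable
    z, and [theta_prod] is, up to sign, the same function multiplied by a power of z that makes it a
    polynomial. *)
Definition theta_prod N (ys : seq K) : {poly A} :=
  theta2 K N * \prod_(y <- ys) (theta1 N y * theta1 N y^-1).

Definition theta_val N (ys : seq K) (z : K) : A :=
  (z - z^-1)%:P * (qpoch N (z ^+ 2) * qpoch N (z ^+ 2)^-1) *
  \prod_(y <- ys) ((z + z^-1 - (y + y^-1))%:P *
    (qpoch N (z * y) * qpoch N (z * y)^-1 * qpoch N (z / y) * qpoch N (y / z))).

Lemma theta1_horner N (c z : K) : c != 0 -> z != 0 ->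
  (theta1 N c).[z%:P] =
  (z ^+ N * (1 - c * z))%:P * (qpoch N (c * z) * qpoch N (c * z)^-1).
Proof.
move=> c0 z0; rewrite /theta1 hornerM !horner_prod big_ord_recl /=.
have -> : \prod_(i < N) (1 - (c *: T ^+ bump 0 i) *: 'X).[z%:P] = qpoch N (c * z).
  apply: eq_bigr => k _; rewrite !hornerE /bump /= add1n -!mul_polyC polyCM.
  by ring.
have -> : \prod_(i < N) ('X - (c^-1 *: T ^+ i.+1)%:P).[z%:P] =
    (z ^+ N)%:P * qpoch N (c * z)^-1.
  have -> : (z ^+ N)%:P = \prod_(k < N) z%:P :> A by rewrite prodr_const card_ord polyC_exp.
  rewrite -big_split /=.
  apply: eq_bigr => k _; rewrite !hornerE mulrBr mulr1 -!mul_polyC mulrA -polyCM.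
  by rewrite invfM mulrCA divff // mulr1.
have -> : (1 - (c *: T ^+ 0) *: 'X).[z%:P] = (1 - c * z)%:P.
  by rewrite !hornerE expr0 -mul_polyC mulr1 rmorphB /= polyCM.
by rewrite polyCM; ring.
Qed.

Lemma theta2_horner N (z : K) : z != 0 ->
  (theta2 K N).[z%:P] =
  (z ^+ (2 * N) * (1 - z ^+ 2))%:P * (qpoch N (z ^+ 2) * qpoch N (z ^+ 2)^-1).
Proof.
move=> z0; rewrite /theta2 hornerM !horner_prod big_ord_recl /=.
have -> : \prod_(i < N) (1 - T ^+ bump 0 i *: 'X^2).[z%:P] = qpoch N (z ^+ 2).
  apply: eq_bigr => k _; rewrite !hornerE /bump /= add1n -!mul_polyC !polyC_exp.
  by ring.
have -> : \prod_(i < N) ('X^2 - (T ^+ i.+1)%:P).[z%:P] =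
    (z ^+ (2 * N))%:P * qpoch N (z ^+ 2)^-1.
  have -> : (z ^+ (2 * N))%:P = \prod_(k < N) (z ^+ 2)%:P :> A.
    by rewrite prodr_const card_ord polyC_exp exprM -polyC_exp.
  rewrite -big_split /=.
  apply: eq_bigr => k _; rewrite !hornerE mulrBr mulr1 -polyC_exp -!mul_polyC mulrA -polyCM.
  by rewrite divff ?expf_neq0 // mul1r.
have -> : (1 - T ^+ 0 *: 'X^2).[z%:P] = (1 - z ^+ 2)%:P.
  by rewrite expr0 scale1r !hornerE -polyC_exp rmorphB.
by rewrite polyCM; ring.
Qed.

Lemma theta_prod_horner N ys (z : K) : all (fun y => y != 0) ys -> z != 0 ->
  (theta_prod N ys).[z%:P] =
  - (z ^+ ((2 * N + 1) * (size ys).+1))%:P * theta_val N ys z.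
Proof.
move=> hys z0; rewrite /theta_prod hornerM theta2_horner // horner_prod /theta_val.
rewrite mulnS exprD !polyCM.
have -> : \prod_(y <- ys) (theta1 N y * theta1 N y^-1).[z%:P] =
  (z ^+ ((2 * N + 1) * size ys))%:P * \prod_(y <- ys) ((z + z^-1 - (y + y^-1))%:P *
    (qpoch N (z * y) * qpoch N (z * y)^-1 * qpoch N (z / y) * qpoch N (y / z))).
  elim: ys hys => [|y ys IH] /=; first by rewrite !big_nil muln0 expr0 mulr1.
  move=> /andP[y0 hys]; rewrite !big_cons IH // mulnS exprD polyCM hornerM.
  rewrite !theta1_horner ?invr_eq0 //.
  have -> : y^-1 * z = z / y by rewrite mulrC.
  rewrite [(z / y)^-1]invf_div [y * z]mulrC.
  (* The factors k = 0 of the two [theta1], which do not occur in [qpoch], combine into the Weyl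
     factor of the pair z, y. *)
  have E : (z ^+ (2 * N + 1))%:P * (z + z^-1 - (y + y^-1))%:P =
     (z ^+ N * (1 - z * y))%:P * (z ^+ N * (1 - z / y))%:P :> A.
    rewrite -!polyCM; congr (_%:P); rewrite addn1 exprS mul2n -addnn exprD.
    by field; rewrite y0 z0.
  set R := qpoch N (z * y) * _ * _ * _; set P := \prod_(_ <- _) _; set Z := (z ^+ (_ * _))%:P.
  transitivity ((z ^+ (2 * N + 1))%:P * (z + z^-1 - (y + y^-1))%:P * (R * Z * P)); last by ring.
  by rewrite E /R; ring.
have E : (z ^+ (2 * N + 1))%:P * (z - z^-1)%:P =
   - ((z ^+ (2 * N)) * (1 - z ^+ 2))%:P :> A.
  rewrite -!polyCM -polyCN; congr (_%:P); rewrite addn1 exprS.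
  by field.
set R := qpoch N _ * qpoch N _; set P := \prod_(_ <- _) _; set Z := (z ^+ (_ * size _))%:P.
transitivity (- ((z ^+ (2 * N + 1))%:P * (z - z^-1)%:P * (R * Z * P))); last by ring.
by rewrite E; ring.
Qed.
End ThetaProduct.

Section Degrees.
Variable A : idomainType.
Implicit Types p q : {poly A}.

Lemma size_mul_leqS p q a b :
  (size p <= a.+1)%N -> (size q <= b.+1)%N -> (size (p * q)%R <= (a + b).+1)%N.
Proof. by move=> hp hq; rewrite (leq_trans (size_polyMleq _ _)) //; lia. Qed.

Lemma size_prod_leqS (I : Type) (s : seq I) (F : I -> {poly A}) a :
  (forall i, size (F i) <= a.+1)%N -> (size (\prod_(i <- s) F i)%R <= (a * size s).+1)%N.
Proof.
move=> hF; elim: s => [|i s IH]; first by rewrite big_nil size_poly1.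
by rewrite big_cons mulnS; apply: size_mul_leqS.
Qed.

Lemma size_prod_ord_leqS n (F : 'I_n -> {poly A}) a :
  (forall i, size (F i) <= a.+1)%N -> (size (\prod_(i < n) F i)%R <= (a * n).+1)%N.
Proof.
by move=> hF; have := size_prod_leqS (enum 'I_n) hF; rewrite big_enum size_enum_ord.
Qed.

Lemma size_sub_leqS p q a :
  (size p <= a.+1)%N -> (size q <= a.+1)%N -> (size (p - q)%R <= a.+1)%N.
Proof.
by move=> hp hq; rewrite (leq_trans (size_polyD _ _)) // geq_max size_polyN hp.
Qed.

Lemma size_polyC_leqS (c : A) a : (size c%:P <= a.+1)%N.
Proof. exact: leq_trans (size_polyC_leq1 c) _. Qed.

End Degrees.

Lemma natr_inj (R : idomainType) : [pchar R] =i pred0 -> injective (fun n => n%:R : R).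
Proof.
move=> /pcharf0P ch i j /= hij; wlog ij : i j hij / (i <= j)%N.
  by move=> h; case: (leqP i j) => [/h->//|/ltnW/h->].
move/eqP: hij; rewrite eq_sym -subr_eq0 -natrB // ch subn_eq0 => ji.
by apply/eqP; rewrite eqn_leq ij.
Qed.

Section ThetaExpansion.
Variable K : fieldType.
Local Notation A := {poly K}.
Local Notation T := ('X : A).

Lemma theta_val_odd N (ys : seq K) z : theta_val N ys z^-1 = - theta_val N ys z.
Proof.
rewrite /theta_val invrK -[z^-1 - z]opprB polyCN exprVn invrK.
rewrite [qpoch N (z ^+ 2)^-1 * _]mulrC !mulNr; congr (- (_ * _)).
apply: eq_bigr => y _; rewrite [z^-1 + z]addrC; congr (_ * _).
rewrite invfM invrK [z^-1 * y]mulrC [z / y]mulrC [z^-1 / y]mulrC -invfM [y * z]mulrC.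
by ring.
Qed.

Lemma theta_prod_size N (ys : seq K) :
  (size (theta_prod N ys) <= (2 * ((2 * N + 1) * (size ys).+1)).+1)%N.
Proof.
have s1 (c : K) : (size (theta1 N c) <= (2 * N + 1).+1)%N.
  have -> : (2 * N + 1 = 1 * N.+1 + 1 * N)%N by lia.
  apply: size_mul_leqS; apply: size_prod_ord_leqS => i.
    apply: size_sub_leqS; first exact: size_polyC_leqS.
    by rewrite (leq_trans (size_scale_leq _ _)) // size_polyX.
  by apply: size_sub_leqS; rewrite ?size_polyX ?size_polyC_leqS.
have s2 : (size (theta2 K N) <= (2 * (2 * N + 1)).+1)%N.
  have -> : (2 * (2 * N + 1) = 2 * N.+1 + 2 * N)%N by lia.
  apply: size_mul_leqS; apply: size_prod_ord_leqS => i.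
    apply: size_sub_leqS; first exact: size_polyC_leqS.
    by rewrite (leq_trans (size_scale_leq _ _)) // size_polyXn.
  by apply: size_sub_leqS; rewrite ?size_polyXn ?size_polyC_leqS.
rewrite mulnS mulnDr [(2 * (_ * size ys))%N]mulnA.
apply: size_mul_leqS => //; apply: size_prod_leqS => y.
by rewrite mul2n -addnn; apply: size_mul_leqS.
Qed.

Lemma eqB_subZ M (p q : {poly A}) a : eqm M a 0 -> eqB M (p - a *: q) p.
Proof.
move=> ha k; rewrite coefB coefZ -[X in eqm _ _ X]subr0.
apply: eqmB; first exact: eqm_refl.
by rewrite -[X in eqm _ _ X](mul0r q`_k); apply: eqmMr.
Qed.

Lemma eqB_subC M (p : {poly A}) a : eqm M a 0 -> eqB M (p - a%:P) p.
Proof. by move=> ha; rewrite -alg_polyC; apply: eqB_subZ. Qed.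

Lemma eqBM1 M (p q : {poly A}) : eqB M p 1 -> eqB M q 1 -> eqB M (p * q) 1.
Proof. by move=> hp hq; have := eqBM hp hq; rewrite mulr1. Qed.

Lemma eqm_ZXn0 M m (c : K) : (M <= m)%N -> eqm M (c *: T ^+ m) 0.
Proof. by move=> h; rewrite -mul_polyC mulrC; apply: eqm_Xn0. Qed.

Lemma eqm_Xn0' M m : (M <= m)%N -> eqm M (T ^+ m) 0.
Proof. by move=> h; rewrite -[T ^+ m]mulr1; apply: eqm_Xn0. Qed.

(** [E] and [E'] gather the end factors of [theta1_shift] and [theta2_shift]. The signs and
    constants - y^-1 and - y of the factors for y and 1/y cancel. The degree is 4 from [theta2] plus
    2 for each y, which is g when [ys] has t - 1 elements. *)
Lemma theta_prod_rec N (ys : seq K) : all (fun y => y != 0) ys ->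
  let L := (2 * N.+1 * (size ys).+1).-1 in
  forall k, (L <= k)%N ->
  eqm N (theta_prod N.+1 ys)`_(k + (2 * (size ys).+1 + 2))
        (T ^+ (k - L) * (theta_prod N.+1 ys)`_k).
Proof.
move=> hys L.
pose E : {poly A} := ('X^2 - (T ^+ N)%:P) * ('X^2 - (T ^+ N.+1)%:P) *
  \prod_(y <- ys) (('X - (y^-1 *: T ^+ N.+1)%:P) * ('X - (y^-1^-1 *: T ^+ N.+1)%:P)).
pose E' : {poly A} := (1 - T ^+ N.+2 *: 'X^2) * (1 - T ^+ N.+3 *: 'X^2) *
  \prod_(y <- ys) ((1 - (y *: T ^+ N.+2) *: 'X) * (1 - (y^-1 *: T ^+ N.+2) *: 'X)).
apply: (@qshift_rec _ _ _ _ _ E E').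
- rewrite /theta_prod qshiftM qshift_prod [LHS]mulrACA theta2_shift -scalerAl -big_split /=.
  have -> : \prod_(y <- ys) (('X - (y^-1 *: T ^+ N.+1)%:P) * ('X - (y^-1^-1 *: T ^+ N.+1)%:P) *
        qshift (theta1 N.+1 y * theta1 N.+1 y^-1)) =
     T ^+ (2 * N.+1 * size ys) *: \prod_(y <- ys) ((1 - (y *: T ^+ N.+2) *: 'X) * (1 - (y^-1 *: T ^+ N.+2) *: 'X) * (theta1 N.+1 y * theta1 N.+1 y^-1)).
    set m := (2 * N.+1)%N; have hm : m = (N.+1 + N.+1)%N by rewrite /m mul2n addnn.
    clearbody m; elim: ys hys {L E E'} => [|y ys IH] /=.
      by rewrite !big_nil muln0 expr0 scale1r.
    move=> /andP[y0 hys]; rewrite !big_cons IH // qshiftM mulrACA !theta1_shift ?invr_eq0 //.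
    have -> : T ^+ (m * (size ys).+1) = T ^+ N.+1 * T ^+ N.+1 * T ^+ (m * size ys).
      by rewrite mulnS {1}hm !exprD.
    rewrite -!scalerAl -!scalerAr -!scalerAl !scalerA invrK.
    congr (_ *: _); last by ring.
    have e : (- y^-1)%:P * (- y)%:P = 1 :> A by rewrite -polyCM mulrNN mulVf.
    move: (T ^+ N.+1) (T ^+ (m * size ys)) => a b; rewrite -!mul_polyC.
    transitivity ((- y^-1)%:P * (- y)%:P * (a * a * b)); first by ring.
    by rewrite e mul1r.
  rewrite -scalerAr scalerA -exprD; congr (T ^+ _ *: _); first by rewrite /L mulnS; lia.
  by rewrite /E' big_split /= mulrACA.
- rewrite /E (_ : 2 * (size ys).+1 + 2 = 2 + 2 + 2 * size ys)%N; last by lia.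
  apply: size_mul_leqS.
    by apply: size_mul_leqS; apply: size_sub_leqS; rewrite ?size_polyXn ?size_polyC_leqS.
  apply: size_prod_leqS => y; rewrite -[2%N]/(1 + 1)%N.
  by apply: size_mul_leqS; apply: size_sub_leqS; rewrite ?size_polyX ?size_polyC_leqS.
- have -> : (2 * (size ys).+1 + 2 = 2 + 2 + 2 * size ys)%N by lia.
  rewrite exprD [T in eqB _ _ (T * _)]exprD; apply: eqBM; last first.
    rewrite {E E' L}; elim: ys {hys} => [|y ys IH]; first by rewrite big_nil muln0.
    rewrite big_cons mulnS exprD; apply: eqBM => //.
    by rewrite expr2; apply: eqBM; apply/eqB_subC/eqm_ZXn0.
  by apply: eqBM; apply/eqB_subC/eqm_Xn0'.
- apply: eqBM1; last first.
    rewrite {E E' L}; elim: ys {hys} => [|y ys IH]; first by rewrite big_nil.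
    rewrite big_cons; apply: eqBM1 => //.
    by apply: eqBM1; apply/eqB_subZ/eqm_ZXn0; lia.
  by apply: eqBM1; apply/eqB_subZ/eqm_Xn0'; lia.
Qed.

Hypothesis charK : [pchar K] =i pred0.

(** The functional equation is known through values only, so the antisymmetry of the coefficients is
    obtained from the 2D + 1 points 1, ..., 2D + 1, distinct in characteristic 0. *)
Lemma coef_antisym D (G : {poly A}) (W : K -> A) :
  (size G <= (2 * D).+1)%N ->
  (forall z, z != 0 -> G.[z%:P] = (z ^+ D)%:P * W z) ->
  (forall z, W z^-1 = - W z) ->
  forall k, (k <= 2 * D)%N -> G`_(2 * D - k) = - G`_k.
Proof.
move=> szG evG oddW k hk.
pose H := \poly_(k < (2 * D).+1) (G`_(2 * D - k) + G`_k).
suff H0 : H = 0.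
  have := congr1 (fun p : {poly A} => p`_k) H0.
  by rewrite coef_poly ltnS hk coef0 => /eqP; rewrite addr_eq0 => /eqP.
apply: (@roots_geq_poly_eq0 _ _ [seq (i.+1%:R)%:P | i <- iota 0 (2 * D).+1]); last first.
- by rewrite size_map size_iota size_poly.
- rewrite map_inj_uniq ?iota_uniq // => i j /polyC_inj hij.
  by have [] := natr_inj charK hij.
apply/allP => _ /mapP[i _ ->]; set z : K := i.+1%:R.
have z0 : z != 0 by rewrite /z ((pcharf0P _).1 charK).
rewrite /root /H horner_poly.
have e1 : \sum_(i < (2 * D).+1) G`_i * z%:P ^+ i = (z ^+ D)%:P * W z.
  by rewrite -evG // (horner_coef_wide _ szG).
have e2 : \sum_(i < (2 * D).+1) G`_(2 * D - i) * z%:P ^+ i = - ((z ^+ D)%:P * W z).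
  have := evG z^-1; rewrite invr_eq0 => /(_ z0); rewrite (horner_coef_wide _ szG) oddW => e.
  transitivity (z%:P ^+ (2 * D) * ((z^-1 ^+ D)%:P * - W z)); last first.
    rewrite mul2n -addnn exprD -!polyC_exp mulrN mulrN mulrA -!polyCM -mulrA -exprMn mulfV //.
    by rewrite expr1n mulr1.
  rewrite -e mulr_sumr (reindex_inj rev_ord_inj) /=; apply: eq_bigr => -[j hj] _ /=.
  rewrite subSS subKn // mulrCA; congr (_ * _); rewrite -!polyC_exp -polyCM; congr (_%:P).
  by rewrite exprVn -exprB ?unitfE // ?leq_subr.
under eq_bigr do rewrite mulrDl.
by rewrite big_split /= e1 e2 addNr.
Qed.

End ThetaExpansion.

(* The pairs [(true, q)] and [(false, q)] with [q < Q] stand for the integers q and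
   -1 - q: together they enumerate -Q <= m < Q. *)
Definition boxv (Q : nat) (p : bool * 'I_Q) : int :=
  if p.1 then Posz p.2 else Negz p.2.
Definition bexp (t k : nat) (m : int) : int := (2 * t + 2)%N%:Z * m + k%:Z.
(* The value is nonnegative for [k <= t], so that [absz] changes nothing. *)
Definition eexp (t k : nat) (m : int) : nat :=
  absz ((t.+1)%:Z * m ^+ 2 + k%:Z * m).

Section Psi.
Variable K : fieldType.
Local Notation A := {poly K}.
Local Notation T := ('X : A).

(* The theta function theta_k, summed over -Q <= m < Q. *)
Definition psi (t Q k : nat) (z : K) : A :=
  \sum_(p : bool * 'I_Q)
    (z ^ bexp t k (boxv p) - z ^ (- bexp t k (boxv p))) *: T ^+ eexp t k (boxv p).

Definition zdiff (z : K) (n : nat) : A := (z ^+ n - z ^- n)%:P.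

(** The integer -1 - q gives the negative exponent k - g(q + 1); making it positive changes the sign
    and moves it to the residue g - k. *)
Lemma psi_split t Q k z : (k <= t)%N ->
  psi t Q k z = \sum_(q < Q)
   (T ^+ (t.+1 * q ^ 2 + k * q) * zdiff z ((2 * t + 2) * q + k) -
    T ^+ (t.+1 * q.+1 ^ 2 - k * q.+1) * zdiff z ((2 * t + 2) * q.+1 - k)).
Proof.
move=> hk; rewrite /psi -(pair_bigA _ (fun b (q : 'I_Q) =>
    (z ^ bexp t k (boxv (b, q)) - z ^ (- bexp t k (boxv (b, q)))) *:
      T ^+ eexp t k (boxv (b, q)))) /= big_bool -big_split.
apply: eq_bigr => q _; rewrite -[boxv (true, q)]/(Posz q) -[boxv (false, q)]/(Negz q).
congr (_ + _).
  rewrite -mul_polyC mulrC; congr (T ^+ _ * _).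
  by rewrite /zdiff /bexp -PoszM -PoszD exprnN.
rewrite -mul_polyC mulrC -mulrN NegzE; congr (T ^+ _ * _).
  rewrite /eexp sqrrN expr2 mulrN -!PoszM subzn ?absz_nat ?mulnn //; nia.
rewrite /zdiff /bexp -polyCN opprB !mulrN -!PoszM [_ + k%:Z]addrC -[k%:Z - _]opprB.
by rewrite subzn ?opprK ?exprnN //; nia.
Qed.

End Psi.

Section Expansion.
Variable K : fieldType.
Local Notation A := {poly K}.
Local Notation T := ('X : A).
Hypothesis charK : [pchar K] =i pred0.

Lemma two_neq0 : (2%:R : A) != 0.
Proof. by rewrite -polyC_natr polyC_eq0 ((pcharf0P _).1 charK). Qed.

Lemma double_eqm0 M (p : A) : eqm M (p + p) 0 -> eqm M p 0.
Proof.
move=> h; apply: (@eqm_cancel0 _ _ 2%:R).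
  by rewrite -polyC_natr coefC /= ((pcharf0P _).1 charK).
by rewrite mulr_natl mulr2n.
Qed.

(* The recurrence and the antisymmetry determine all coefficients from
   those of index [1 <= k <= t]. *)
Lemma coef_orbit t M (a : nat -> A) :
  eqm M (a 0%N) 0 -> eqm M (a t.+1) 0 ->
  (forall k, (0 < k <= t)%N ->
     eqm M (a (2 * t + 2 - k)%N) (- (T ^+ (t.+1 - k) * a k))) ->
  (forall n, eqm M (a (n + (2 * t + 2))%N) (T ^+ (n + t.+1) * a n)) ->
  forall Q z, eqm M (\sum_(n < (2 * t + 2) * Q) a n * zdiff z n)
    (\sum_(k < t) a k.+1 * psi t Q k.+1 z).
Proof.
move=> a0 ah arefl arec Q z; set g := (2 * t + 2)%N.
(* The exponent is the sum of g i + c + t + 1 over i < q: iterating the recurrence produces the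
   quadratic exponents of the theta functions. *)
have agq c q : eqm M (a (g * q + c)%N) (T ^+ (t.+1 * q ^ 2 + c * q) * a c).
  elim: q => [|q IH]; first by rewrite !muln0 mul1r; apply: eqm_refl.
  rewrite mulnSr -addnA [(g + c)%N]addnC addnA; apply: eqm_trans (arec _) _.
  apply: eqm_trans (eqmMl _ IH) _; rewrite mulrA -exprD.
  by rewrite (_ : _ + _ = t.+1 * q.+1 ^ 2 + c * q.+1)%N; [apply: eqm_refl | rewrite /g; nia].
have agq0 c q : eqm M (a c) 0 -> eqm M (a (g * q + c)%N) 0.
  move=> h; apply: eqm_trans (agq _ _) _.
  by have := eqmMl (T ^+ (t.+1 * q ^ 2 + c * q)) h; rewrite mulr0.
rewrite (big_ord_mul g Q (fun n => a n * zdiff z n)).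
have -> : \sum_(k < t) a k.+1 * psi t Q k.+1 z = \sum_(q < Q) \sum_(k < t) a k.+1 *
    (T ^+ (t.+1 * q ^ 2 + k.+1 * q) * zdiff z (g * q + k.+1) -
     T ^+ (t.+1 * q.+1 ^ 2 - k.+1 * q.+1) * zdiff z (g * q.+1 - k.+1)).
  rewrite exchange_big /=; apply: eq_bigr => k _.
  by rewrite psi_split ?ltn_ord // mulr_sumr.
apply: eqm_sum => q _.
rewrite (big_residues t (fun c => a (g * q + c)%N * zdiff z (g * q + c))).
rewrite -[X in eqm _ _ X]add0r; apply: eqmD.
  rewrite -[X in eqm _ _ X]addr0; apply: eqmD.
    by rewrite -[X in eqm _ _ X](mul0r (zdiff z (g * q + 0))); apply/eqmMr/agq0.
  by rewrite -[X in eqm _ _ X](mul0r (zdiff z (g * q + t.+1))); apply/eqmMr/agq0.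
apply: eqm_sum => -[k hk] _ /=; rewrite mulrBr; apply: eqmD.
  by rewrite mulrA [a k.+1 * _]mulrC; apply: eqmMr.
rewrite -mulNr mulrA.
have -> : (g * q + (g - k.+1) = g * q.+1 - k.+1)%N by rewrite /g; nia.
apply: eqmMr.
have -> : (g * q.+1 - k.+1 = g * q + (g - k.+1))%N by rewrite /g; nia.
apply: eqm_trans (agq _ _) _.
have h : (0 < k.+1 <= t)%N by lia.
apply: eqm_trans (eqmMl _ (arefl _ h)) _.
rewrite mulrN mulrA -exprD mulNr [a k.+1 * _]mulrC.
rewrite (_ : _ + _ = t.+1 * q.+1 ^ 2 - k.+1 * q.+1)%N; first exact: eqm_refl.
rewrite /g; nia.
Qed.
End Expansion.

Section ThetaExpand.
Variable K : fieldType.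
Local Notation A := {poly K}.
Local Notation T := ('X : A).
Hypothesis charK : [pchar K] =i pred0.

Lemma sum_antisym (D : nat) (b : nat -> A) (z : K) : z != 0 ->
  (forall k, (k <= 2 * D)%N -> b (2 * D - k)%N = - b k) ->
  \sum_(i < (2 * D).+1) b i * z%:P ^+ i =
  (z ^+ D)%:P * \sum_(n < D.+1) b (D + n)%N * zdiff z n.
Proof.
move=> z0 hb; rewrite (_ : (2 * D).+1 = D + D.+1)%N; last by lia.
rewrite big_split_ord /= (reindex_inj rev_ord_inj) /= mulr_sumr !big_ord_recl /=.
have bD : b D = 0.
  have := hb D; rewrite (_ : 2 * D - D = D)%N; last by lia.
  move/(_ _)/eqP; rewrite -addr_eq0 -mulr2n -mulr_natl mulf_eq0 (negPf (two_neq0 charK)) /=.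
  by move=> h; apply/eqP/h; lia.
rewrite addn0 bD !mul0r mulr0 !add0r -big_split /=; apply: eq_bigr => -[n hn] _ /=.
rewrite /bump /= add1n.
have -> : b (D - n.+1)%N = - b (D + n.+1)%N.
  by rewrite -hb; [congr b; lia | lia].
rewrite mulNr addrC -mulrBr mulrCA; congr (_ * _).
rewrite -!polyC_exp -polyCB -polyCM; congr (_%:P).
by rewrite mulrBr exprD exprB ?unitfE.
Qed.

(** The coefficients are recentred at the middle index D, where oddness reads a(-n) = - a(n).
    Combined with the recurrence this gives the reflection n -> g - n, and since 2 is invertible the
    fixed indices 0 and t + 1 carry coefficient 0. *)
Lemma theta_expand N (ys : seq K) (t := (size ys).+1) : all (fun y => y != 0) ys ->
  exists B : nat -> A, forall z, z != 0 ->
    eqm N (theta_val N.+1 ys z) (\sum_(k < t) B k.+1 * psi t N.+2 k.+1 z).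
Proof.
move=> hys; pose D := ((2 * N.+1 + 1) * t)%N; pose G := theta_prod N.+1 ys.
pose W z := - theta_val N.+1 ys z; pose a n := G`_(D + n).
have szG : (size G <= (2 * D).+1)%N by apply: theta_prod_size.
have evG z : z != 0 -> G.[z%:P] = (z ^+ D)%:P * W z.
  by move=> z0; rewrite theta_prod_horner // mulNr mulrN.
have oddW z : W z^-1 = - W z by rewrite /W theta_val_odd.
have odd := coef_antisym charK szG evG oddW.
have rec := theta_prod_rec hys; rewrite -/G -/t in rec.
have arec n : eqm N (a (n + (2 * t + 2))%N) (T ^+ (n + t.+1) * a n).
  have h := @rec N (D + n)%N; rewrite -addnA in h.
  apply: eqm_trans (h _) _; first by rewrite /D; nia.
  rewrite (_ : D + n - _ = n + t.+1)%N; first exact: eqm_refl.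
  by rewrite /D; nia.
have arefl k : (k <= t.+1)%N ->
    eqm N (a (2 * t + 2 - k)%N) (- (T ^+ (t.+1 - k) * a k)).
  move=> hk; have hD : (t < D)%N by rewrite /D; nia.
  have h := @rec N (D - k)%N.
  rewrite /a (_ : D + (2 * t + 2 - k) = D - k + (2 * t + 2))%N; last by lia.
  apply: eqm_trans (h _) _; first by rewrite /D in hD *; nia.
  rewrite (_ : D - k - _ = t.+1 - k)%N; last by rewrite /D in hD *; nia.
  rewrite (_ : G`_(D - k) = - G`_(D + k)); first by rewrite mulrN; apply: eqm_refl.
  by rewrite -odd; [congr (G`_ _); lia | lia].
have a0 : eqm N (a 0%N) 0.
  have := odd D; rewrite (_ : 2 * D - D = D)%N; last by lia.
  move=> h; apply: (double_eqm0 charK); rewrite /a addn0 {1}h ?addNr; last by lia.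
  exact: eqm_refl.
have ah : eqm N (a t.+1) 0.
  apply: (double_eqm0 charK); have := arefl t.+1 (leqnn _).
  rewrite (_ : 2 * t + 2 - t.+1 = t.+1)%N; last by lia.
  rewrite subnn expr0 mul1r => h.
  by rewrite -[X in eqm _ _ X](subrr (a t.+1)); apply: eqmD => //; apply: eqm_refl.
exists (fun k => - a k) => z z0.
have eW : W z = \sum_(n < (2 * t + 2) * N.+2) a n * zdiff z n.
  have zD0 : (z ^+ D)%:P != 0 by rewrite polyC_eq0 expf_neq0.
  apply: (mulfI zD0); rewrite -evG // (horner_coef_wide _ szG).
  rewrite (sum_antisym z0 odd); congr (_ * _).
  (* This bound makes [N.+2] periods of length g cover all the coefficients. *)
  have le : (D.+1 <= (2 * t + 2) * N.+2)%N by rewrite /D; nia.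
  rewrite -(subnKC le) big_split_ord /= [X in _ = _ + X]big1 ?addr0 // => n _.
  by rewrite /a nth_default ?mul0r // (leq_trans szG) //; lia.
rewrite -[theta_val _ _ _]opprK -/(W z) eW.
under [X in eqm _ _ X]eq_bigr => k _ do rewrite mulNr.
rewrite sumrN; apply/eqmN/coef_orbit => // k /andP[_ hk].
by apply: arefl; lia.
Qed.

End ThetaExpand.

(** * The Jacobi triple product *)

Section GaussianBinomial.
Variables (R : comNzRingType) (q : R).

(** The Gaussian binomial coefficient, defined by its Pascal rule so that no division is involved;
    [gbin_qfact] below is its quotient formula, with [qfact n] = (q; q)_n. *)
Fixpoint gbin (n j : nat) : R :=
  match n, j with
  | _, 0 => 1
  | 0, _.+1 => 0
  | n'.+1, j'.+1 => gbin n' j'.+1 + q ^+ (n' - j') * gbin n' j'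
  end.

Lemma gbinS n j : gbin n.+1 j.+1 = gbin n j.+1 + q ^+ (n - j) * gbin n j.
Proof. by []. Qed.

Lemma gbin0 n : gbin n 0 = 1. Proof. by case: n. Qed.

Lemma gbin_small n j : (n < j)%N -> gbin n j = 0.
Proof.
elim: n j => [|n IH] [|j] //= hj; rewrite !IH ?mulr0 ?addr0 //; exact: ltnW.
Qed.

Arguments gbin : simpl never.

Definition qfact (n : nat) : R := \prod_(k < n) (1 - q ^+ k.+1).

Lemma qfactS n : qfact n.+1 = qfact n * (1 - q ^+ n.+1).
Proof. exact: big_ord_recr. Qed.

Lemma gbin_qfact n j : (j <= n)%N -> gbin n j * (qfact j * qfact (n - j)) = qfact n.
Proof.
elim: n j => [|n IH] [|j] hj //; rewrite ?gbin0 ?subn0 ?mul1r //.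
- by rewrite /qfact !big_ord0 !mulr1.
- by rewrite /qfact big_ord0 mul1r.
rewrite gbinS subSS; have [jn|nj] := ltnP j n; last first.
  have -> : j = n by lia.
  rewrite gbin_small // subnn expr0 mul1r add0r.
  have := IH n (leqnn n); rewrite subnn qfactS => e.
  by rewrite -{2}e; ring.
have e1 := IH j.+1 jn; have e2 := IH j (ltnW jn).
have e3 : (n - j = (n - j.+1).+1)%N by lia.
rewrite mulrDl.
transitivity (gbin n j.+1 * (qfact j.+1 * qfact (n - j.+1)) * (1 - q ^+ (n - j)) +
   q ^+ (n - j) * (gbin n j * (qfact j * qfact (n - j))) * (1 - q ^+ j.+1)).
  congr (_ + _); last by rewrite qfactS; ring.
  by rewrite {1}e3 (qfactS (n - j.+1)) -e3; ring.
rewrite e1 e2 qfactS (_ : n.+1 = n - j + j.+1)%N; last by lia.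
by rewrite exprD; ring.
Qed.

(** The homogeneous form in x and y allows y to be a positive power of T where the usual form would
    need negative powers. *)
Lemma qbinomial (x y : R) n :
  \prod_(k < n) (y + x * q ^+ k) =
  \sum_(j < n.+1) gbin n j * q ^+ 'C(j, 2) * x ^+ j * y ^+ (n - j).
Proof.
elim: n => [|n IH].
  by rewrite big_ord0 big_ord1 gbin0 bin0n !mulr1.
rewrite big_ord_recr /= IH [RHS]big_ord_recl -[nat_of_ord ord0]/0%N gbin0 bin0n !expr0 !mul1r subn0.
under [in RHS]eq_bigr => j _ do rewrite /= /bump /= add1n gbinS.
rewrite mulrDr !mulr_suml.
have -> : \sum_(i < n.+1) gbin n i * q ^+ 'C(i, 2) * x ^+ i * y ^+ (n - i) * y =
   y ^+ n.+1 + \sum_(i < n.+1) gbin n i.+1 * q ^+ 'C(i.+1, 2) * x ^+ i.+1 * y ^+ (n - i).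
  rewrite big_ord_recl [in RHS]big_ord_recr -[nat_of_ord ord0]/0%N -[nat_of_ord ord_max]/n (gbin_small (ltnSn n)) !mul0r /= addr0.
  rewrite gbin0 bin0n !expr0 !mul1r subn0 -exprSr; congr (_ + _).
  apply: eq_bigr => -[i hi] _ /=; rewrite ?/bump /= ?add1n -mulrA -exprSr.
  by rewrite (_ : (n - i.+1).+1 = n - i)%N //; lia.
rewrite -addrA -big_split; congr (_ + _); apply: eq_bigr => -[i hi] _ /=.
rewrite subSS binS bin1 !exprD exprS.
have -> : q ^+ n = q ^+ (n - i) * q ^+ i by rewrite -exprD subnK.
by ring.
Qed.
End GaussianBinomial.

Section Exponents.
Local Open Scope nat_scope.

Lemma jacobi_triple_exponent (h i k R : nat) : i <= h -> k < R ->
  h + i + 2 * h * (R - k.+1) + (2 * h * k + (h - i)) = 2 * h * R.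
Proof.
move=> hi hk; have [r ->] : exists r, R = k.+1 + r by exists (R - k.+1); lia.
rewrite addKn -(subnKC hi) addKn; ring.
Qed.

(** With R = j + k, [c] and [c'] stand for the binomial coefficients of R and j over 2, given by
    division-free equations; the truncated subtraction is removed by adding [i * k] to both sides.
    In the next lemma [c'] belongs to R + k. *)
Lemma jacobi_triple_exponent_neg (h i j k c c' : nat) :
  i * k <= h * (k * k) -> 2 * c + (j + k) = (j + k) * (j + k) -> 2 * c' + j = j * j ->
  2 * h * c' + (h + i) * j + 2 * h * (j + k) * (j + 2 * k) =
    2 * h * (j + k) * (j + k) + (h + i) * (j + k) + 2 * h * c + (h * (k * k) - i * k).
Proof.
move=> hk e1 e2.
apply: (@addIn (i * k)); rewrite -[RHS]addnA subnK //.
apply: (@addIn (h * (j + (j + k)))).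
transitivity (h * (2 * c' + j) + h * (j + k) + i * (j+k) + h * j + 2 * h * (j + k) * (j + 2 * k)).
  ring.
transitivity (h * (2 * c + (j + k)) + 2 * h * (j + k) * (j + k) + (h + i) * (j + k) + h * j + h * (k * k)).
  by rewrite e1 e2; ring.
ring.
Qed.

Lemma jacobi_triple_exponent_pos (h i j k c c' : nat) :
  2 * c + (j + k) = (j + k) * (j + k) ->
  2 * c' + (j + k + k) = (j + k + k) * (j + k + k) ->
  2 * h * c' + (h + i) * (j + k + k) + 2 * h * (j + k) * j =
    2 * h * (j + k) * (j + k) + (h + i) * (j + k) + 2 * h * c + (h * (k * k) + i * k).
Proof.
move=> e1 e2.
transitivity (h * (2 * c' + (j + k + k)) + i * (j + k + k) + 2 * h * (j + k) * j).
  ring.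
transitivity (h * (2 * c + (j + k)) + 2 * h * (j + k) * (j + k) + i * (j + k) + h * (k * k) + i * k).
  by rewrite e1 e2; ring.
ring.
Qed.

End Exponents.

Section JacobiTriple.
Variable K : fieldType.
Local Notation A := {poly K}.
Local Notation T := ('X : A).

(** What is left of [psi] at a g-th root of unity, where z^(gm+k) is independent of m. *)
Definition psi_coef (t Q k : nat) : A :=
  \sum_(p : bool * 'I_Q) T ^+ eexp t k (boxv p).

Lemma eexp_pos t k q : eexp t k (Posz q) = (t.+1 * q ^ 2 + k * q)%N.
Proof. by rewrite /eexp expr2 -!PoszM -PoszD absz_nat mulnn. Qed.

Lemma eexp_neg t k q : (k <= t)%N ->
  eexp t k (Negz q) = (t.+1 * q.+1 ^ 2 - k * q.+1)%N.
Proof.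
move=> hk; rewrite /eexp NegzE sqrrN expr2 mulrN -!PoszM subzn ?absz_nat ?mulnn //; nia.
Qed.

Lemma bin2_double j : (2 * 'C(j, 2) + j = j * j)%N.
Proof. by elim: j => [|j IH] //; rewrite binS bin1; nia. Qed.

(** The q-binomial theorem for 2R factors with q = T^g, x = T^(t+1+i) and y = T^(gR), summed from
    the middle index R. The first R factors give the exponents with t + 1 - i, the last R those with
    t + 1 + i. *)
Lemma jacobi_triple_finite t i R : (i <= t)%N ->
  \prod_(k < R) ((1 + T ^+ ((2 * t + 2) * k + (t.+1 - i))) *
                 (1 + T ^+ ((2 * t + 2) * k + (t.+1 + i)))) =
  \sum_(q < R) (gbin (T ^+ (2 * t + 2)) (2 * R) (R - q.+1) * T ^+ eexp t i (Negz q)) +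
  \sum_(q < R.+1) (gbin (T ^+ (2 * t + 2)) (2 * R) (R + q) * T ^+ eexp t i (Posz q)).
Proof.
move=> hi; set g := (2 * t + 2)%N; pose h := t.+1.
have gh : g = (2 * h)%N by rewrite /g /h; lia.
(* The total power of T taken out of the 2R factors to bring each to the form 1 + T^e. *)
pose m := (g * R * R + (h + i) * R + g * 'C(R, 2))%N.
apply: (@mulfI _ (T ^+ m)); first by rewrite expf_neq0 ?polyX_eq0.
have bR := bin2_double R.
transitivity (\prod_(k < 2 * R) (T ^+ (g * R) + T ^+ (h + i) * (T ^+ g) ^+ k)).
  rewrite (_ : 2 * R = R + R)%N; last by lia.
  rewrite big_split_ord /= [in RHS](reindex_inj rev_ord_inj) /= big_split /=.
  have -> : \prod_(j < R) (T ^+ (g * R) + T ^+ (h + i) * T ^+ g ^+ (R - j.+1)) =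
     T ^+ ((h + i) * R + g * 'C(R, 2)) * \prod_(k < R) (1 + T ^+ (g * k + (t.+1 - i))).
    have -> : ((h + i) * R + g * 'C(R, 2) = \sum_(k < R) (h + i + g * k))%N.
      rewrite big_split /= sum_nat_const card_ord mulnC -big_distrr /=; congr (_ + g * _)%N.
      by rewrite -bin2_sum big_mkord.
    rewrite -prodrXr [X in X * _](reindex_inj rev_ord_inj) /= -big_split /=.
    apply: eq_bigr => -[k hk] _ /=; rewrite mulrDr mulr1 addrC; congr (_ + _).
      by rewrite -exprM -!exprD; congr (T ^+ _).
    by rewrite -!exprD; congr (T ^+ _); rewrite -/h gh jacobi_triple_exponent // ltnW.
  have -> : \prod_(k < R) (T ^+ (g * R) + T ^+ (h + i) * T ^+ g ^+ (R + k)) =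
     T ^+ (g * R * R) * \prod_(k < R) (1 + T ^+ (g * k + (t.+1 + i))).
    have -> : T ^+ (g * R * R) = \prod_(k < R) T ^+ (g * R) by rewrite prodr_const card_ord -exprM.
    rewrite -big_split /=.
    apply: eq_bigr => -[k hk] _ /=; rewrite mulrDr mulr1; congr (_ + _).
    by rewrite -exprM -!exprD; congr (T ^+ _); rewrite -/h mulnDr; lia.
  by rewrite /m -addnA exprD; ring.
rewrite qbinomial mulrDr !mulr_sumr (_ : (2 * R).+1 = R + R.+1)%N; last by lia.
rewrite big_split_ord /= (reindex_inj rev_ord_inj) /=.
have be j : gbin (T ^+ g) (2 * R) j * T ^+ g ^+ 'C(j, 2) * T ^+ (h + i) ^+ j * T ^+ (g * R) ^+ (2 * R - j)
   = gbin (T ^+ g) (2 * R) j * T ^+ (g * 'C(j, 2) + (h + i) * j + g * R * (2 * R - j)).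
  by rewrite -!mulrA -!exprM -!exprD addnA.
congr (_ + _); apply: eq_bigr => -[k hk] _ /=; rewrite be mulrCA -exprD;
  congr (_ * T ^+ _).
  have := bin2_double (R - k.+1); rewrite eexp_neg // gh /m gh -/h => bj.
  have [j jE] : exists j, R = (j + k.+1)%N by exists (R - k.+1)%N; lia.
  move: bR bj; rewrite jE addnK => bR bj.
  have -> : (2 * (j + k.+1) - j = j + 2 * k.+1)%N by lia.
  by rewrite -mulnn; apply: jacobi_triple_exponent_neg => //; apply: leq_mul; rewrite ?leq_pmulr // ltnW.
have := bin2_double (R + k); rewrite eexp_pos // gh /m gh -/h => bj.
have [j jE] : exists j, R = (j + k)%N by exists (R - k)%N; lia.
rewrite (_ : 2 * R - (R + k) = j)%N; last by lia.
by move: bR bj; rewrite jE -mulnn => bR bj; apply: jacobi_triple_exponent_pos.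
Qed.

End JacobiTriple.

Section JacobiTripleLimit.
Variable K : fieldType.
Local Notation A := {poly K}.
Local Notation T := ('X : A).

Lemma eqm_1subXn M m (c : K) : (M <= m)%N -> eqm M (1 - c *: T ^+ m) 1.
Proof.
move=> h; rewrite -[X in eqm _ _ X]subr0.
by apply: eqmB; [apply: eqm_refl | apply: eqm_ZXn0].
Qed.

Lemma eqm_mulXn M m (p q : A) : eqm M p q -> eqm (m + M) (T ^+ m * p) (T ^+ m * q).
Proof.
move=> h k hk; rewrite !coefXnM; case: ltnP => // hmk; apply: h; lia.
Qed.

Lemma qfact_coef0 g n : (0 < g)%N -> (qfact (T ^+ g) n)`_0 = 1.
Proof.
move=> g0; rewrite /qfact coef0_prod big1 // => i _.
rewrite coefB coef1 -exprM coefXn (_ : (0 == g * i.+1)%N = false) ?subr0 //.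
by case: g g0.
Qed.

Lemma qfact_eqm g a b : (a <= b)%N ->
  eqm (g * a.+1) (qfact (T ^+ g) b) (qfact (T ^+ g) a).
Proof.
move=> /subnKC <-; elim: (b - a)%N => [|d IH]; first by rewrite addn0; apply: eqm_refl.
rewrite addnS qfactS -[X in eqm _ _ X]mulr1; apply: eqmM => //.
by rewrite -exprM -[T ^+ _]scale1r; apply: eqm_1subXn; rewrite leq_mul2l; lia.
Qed.

(** The coefficient is (q)_2R / ((q)_(R-k) (q)_(R+k)), and all (q)_n with n >= R - k agree modulo
    T^(g(R-k+1)). The precision is poor for k close to R. *)
Lemma gbin_eqm g R k j : (0 < g)%N -> (k <= R)%N ->
  (j = R - k)%N \/ (j = R + k)%N ->
  eqm (g * (R - k).+1) (qfact (T ^+ g) R * gbin (T ^+ g) (2 * R) j) 1.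
Proof.
move=> g0 kR hj; pose lo := (R - k)%N; pose hi := (R + k)%N.
have h : gbin (T ^+ g) (2 * R) j * (qfact (T ^+ g) lo * qfact (T ^+ g) hi) =
    qfact (T ^+ g) (2 * R).
  have jR : (j <= 2 * R)%N by lia.
  rewrite -(gbin_qfact _ jR); congr (_ * _); case: hj => ->.
    by rewrite (_ : 2 * R - _ = hi)%N //; rewrite /hi; lia.
  by rewrite (_ : 2 * R - _ = lo)%N 1?mulrC //; rewrite /lo; lia.
apply: (@eqm_cancel _ _ (qfact (T ^+ g) hi)); first by rewrite qfact_coef0 ?oner_neq0.
rewrite mulr1; apply: (@eqm_trans _ _ (qfact (T ^+ g) (2 * R))); last first.
  apply: (@eqm_leq K _ (g * hi.+1)); first by rewrite leq_mul2l /hi; lia.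
  by apply: qfact_eqm; rewrite /hi; lia.
rewrite -h mulrCA mulrC [qfact _ lo * _]mulrC !mulrA ![_ * qfact _ hi]mulrC.
by apply/eqmMl/qfact_eqm; lia.
Qed.

Lemma leq_eexp_pos t i q : (q <= eexp t i (Posz q))%N.
Proof. by rewrite eexp_pos; case: q => // q; rewrite -mulnn; nia. Qed.

Lemma leq_eexp_neg t i q : (i <= t)%N -> (q < eexp t i (Negz q))%N.
Proof.
move=> hi; rewrite eexp_neg // ltn_subRL -mulnn.
have : (i * q.+1 <= t * (q.+1 * q.+1))%N by apply: leq_mul; rewrite ?leq_pmulr.
have : (q < q.+1 * q.+1)%N by rewrite leq_pmulr.
by rewrite mulSn; lia.
Qed.

Lemma jacobi_triple M t i (Q := M.+2) : (i <= t)%N ->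
  eqm M (qfact (T ^+ (2 * t + 2)) Q *
    \prod_(k < Q) ((1 + T ^+ ((2 * t + 2) * k + (t.+1 - i))) *
                   (1 + T ^+ ((2 * t + 2) * k + (t.+1 + i)))))
    (psi_coef K t Q i).
Proof.
move=> hi; have QE : Q = M.+2 by []. clearbody Q.
rewrite jacobi_triple_finite //; set g := (2 * t + 2)%N.
have g0 : (0 < g)%N by rewrite /g; lia.
(* The missing precision of [gbin_eqm] for k close to Q is supplied by the factor T^e, since e >= k
   in each use. The term q = Q of the finite sum, absent from [psi_coef], is itself divisible by
   T^M. *)
have key k j e : (k <= Q)%N -> (j = Q - k)%N \/ (j = Q + k)%N ->
    (M <= e + g * (Q - k).+1)%N ->
    eqm M (qfact (T ^+ g) Q * (gbin (T ^+ g) (2 * Q) j * T ^+ e)) (T ^+ e).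
  move=> hk hj he; apply: (eqm_leq he).
  rewrite mulrA mulrC -[X in eqm _ _ X]mulr1.
  by apply/eqm_mulXn/gbin_eqm.
rewrite mulrDr !mulr_sumr /psi_coef -(pair_bigA _ (fun b (q : 'I_Q) => T ^+ eexp t i (boxv (b, q)))) /=.
rewrite big_bool addrC /=; apply: eqmD.
  rewrite -[X in eqm _ _ X]addr0 big_ord_recr; apply: eqmD.
    apply: eqm_sum => -[q hq] _ /=; apply: (key q); [lia | by right |].
    have := leq_eexp_pos t i q; have := leq_pmull (Q - q).+1 g0.
    by lia.
  have e0 : eqm M (T ^+ eexp t i (Posz Q)) 0.
    by apply: eqm_Xn0'; have := leq_eexp_pos t i Q; lia.
  apply: eqm_trans (key Q _ _ _ _ _) e0; [lia | by right|].
  by have := leq_eexp_pos t i Q; lia.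
apply: eqm_sum => -[q hq] _ /=; apply: (key q.+1); [lia | by left |].
have := leq_eexp_neg q hi; have := leq_pmull (Q - q.+1).+1 g0.
by lia.
Qed.

End JacobiTripleLimit.

(** * Evaluation at roots of unity *)

Lemma prod_ord_pred (R : pzRingType) n (F : nat -> R) : (0 < n)%N ->
  \prod_(k < n) F k = F 0%N * \prod_(k < n.-1) F k.+1.
Proof. by case: n => // n _; rewrite big_ord_recl. Qed.

Section RootsOfUnity.
Variable K : fieldType.
Local Notation A := {poly K}.
Local Notation T := ('X : A).
Hypothesis charK : [pchar K] =i pred0.

Lemma qpoch_eqm M N N' (y : K) : (M <= N.+1)%N -> (N <= N')%N ->
  eqm M (qpoch N' y) (qpoch N y).
Proof.
move=> hM /subnKC <-; elim: (N' - N)%N => [|d IH]; first by rewrite addn0; apply: eqm_refl.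
rewrite addnS /qpoch big_ord_recr -[X in eqm _ _ X]mulr1; apply: eqmM => //=.
by apply: eqm_1subXn; lia.
Qed.

Lemma qfact_eqm1 M g N N' : (0 < g)%N -> (M <= N)%N -> (M <= N')%N ->
  eqm M (qfact (T ^+ g) N') (qfact (T ^+ g) N).
Proof.
move=> g0; wlog le : N N' / (N <= N')%N.
  by move=> h h1 h2; case: (leqP N N') => [|/ltnW] le; [|apply: eqm_sym]; apply: h.
move=> hN _; apply: (@eqm_leq K _ (g * N.+1)); last exact: qfact_eqm.
by rewrite (leq_trans hN) // (leq_trans (leqnSn _)) // leq_pmull.
Qed.

(** By the triple product the left side contains 1 + T^n for the n not divisible by t + 1. The extra
    factor [qfact (T ^+ (2 * t + 2))] splits by (1 - u)(1 + u) = 1 - u^2 and supplies the multiples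
    of t + 1, which completes [qpoch N (-1)]. *)
Lemma psi_coef_prod M t N : (M <= N)%N ->
  eqm M (\prod_(i < t) psi_coef K t M.+2 i.+1 * qfact (T ^+ (2 * t + 2)) N)
    (qfact (T ^+ (2 * t + 2)) N ^+ t * qpoch N (-1) * qfact (T ^+ t.+1) N).
Proof.
move=> hN; set g := (2 * t + 2)%N; pose Q := M.+2.
have g0 : (0 < g)%N by rewrite /g; lia.
pose X : A := \prod_(i < t) \prod_(k < Q) ((1 + T ^+ (g * k + (t.+1 - i.+1))) *
  (1 + T ^+ (g * k + (t.+1 + i.+1)))).
pose P n : A := \prod_(k < n) (1 + T ^+ (t.+1 * k.+1)).
(* The factor for n = 0 is 1 + 1; it is included on both sides so that n runs over complete residue
   systems, and cancelled in characteristic 0. *)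
have two0 : (1 + 1 : A) != 0 := two_neq0 charK.
have eX : P (2 * Q).-1 * X = qpoch (g * Q).-1 (-1).
  apply: (mulfI two0).
  have -> : (1 + 1) * qpoch (g * Q).-1 (-1) = \prod_(n < g * Q) (1 + T ^+ n).
    rewrite (prod_ord_pred (fun n => 1 + T ^+ n)) ?muln_gt0 ?g0 // expr0; congr (_ * _).
    by apply: eq_bigr => k _; rewrite scaleN1r opprK.
  rewrite (big_ord_mul g Q (fun n => 1 + T ^+ n)).
  under [RHS]eq_bigr => q _ do rewrite (big_residues t (fun c => 1 + T ^+ (g * q + c))).
  rewrite big_split /= mulrA; congr (_ * _).
    transitivity (\prod_(n < 2 * Q) (1 + T ^+ (t.+1 * n))).
      by rewrite (prod_ord_pred (fun n => 1 + T ^+ (t.+1 * n))) // muln0 expr0.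
    rewrite (big_ord_mul 2 Q (fun n => 1 + T ^+ (t.+1 * n))); apply: eq_bigr => q _.
    rewrite !big_ord_recl big_ord0 /= mulr1.
    by congr ((1 + T ^+ _) * (1 + T ^+ _)); rewrite ?/bump /= /g; lia.
  rewrite /X exchange_big /=; apply: eq_bigr => k _.
  rewrite (reindex_inj rev_ord_inj) /=; apply: eq_bigr => -[i hi] _ /=.
  by congr ((1 + T ^+ _) * (1 + T ^+ _)); rewrite /g; lia.
have eP n : P n * qfact (T ^+ t.+1) n = qfact (T ^+ g) n.
  rewrite /P /qfact -big_split; apply: eq_bigr => k _ /=.
  rewrite -!exprM (_ : g * k.+1 = t.+1 * k.+1 + t.+1 * k.+1)%N; last by rewrite /g; lia.
  by rewrite exprD; ring.
apply: (@eqm_trans _ _ (qfact (T ^+ g) Q ^+ t * X * qfact (T ^+ g) (2 * Q).-1)).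
  apply: eqmM; last by apply: qfact_eqm1 => //; rewrite /Q; lia.
  have -> : qfact (T ^+ g) Q ^+ t = \prod_(i < t) qfact (T ^+ g) Q.
    by rewrite prodr_const card_ord.
  rewrite /X -big_split; apply: eqm_prod => i _.
  by apply/eqm_sym/jacobi_triple.
rewrite -(eP (2 * Q).-1) mulrA -[_ * X * _]mulrA [X * _]mulrC eX.
apply: eqmM; last by apply: qfact_eqm1; rewrite /Q; lia.
apply: eqmM; first by apply/eqmX/qfact_eqm1; rewrite /Q; lia.
apply: (@eqm_trans _ _ (qpoch M (-1))).
  apply: qpoch_eqm => //; rewrite /g /Q; nia.
by apply/eqm_sym/qpoch_eqm.
Qed.

Lemma prod_root_sub m (z : K) (u : A) : m.-primitive_root z ->
  \prod_(c < m) (1 - (z ^+ c) *: u) = 1 - u ^+ m.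
Proof.
move=> hz; have m0 := prim_order_gt0 hz.
have z0 : z != 0.
  apply/eqP => z0; have := prim_expr_order hz.
  by rewrite z0 expr0n gtn_eqF // => /eqP; rewrite eq_sym oner_eq0.
have hz' : m.-primitive_root z^-1.
  have -> : z^-1 = z ^+ m.-1.
    by apply: (mulfI z0); rewrite mulfV // -exprS prednK // (prim_expr_order hz).
  by rewrite prim_root_exp_coprime // coprime_sym coprimenP.
have key (y : K) (v : A) : m.-primitive_root y -> \prod_(c < m) (v - (y ^+ c)%:P) = v ^+ m - 1.
  move=> hy; have := congr1 (fun p => (map_poly polyC p).[v]) (factor_Xn_sub_1 hy).
  rewrite rmorph_prod big_mkord horner_prod rmorphB rmorph1 /= map_polyXn !hornerE.
  by move=> <-; apply: eq_bigr => c _; rewrite rmorphB /= map_polyX map_polyC !hornerE.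
(* This factorization calls for X^m - 1 at two places: at 0 with the root z, and at u with the root
   1/z. *)
have e c : 1 - z ^+ c *: u = (0 - (z ^+ c)%:P) * (u - (z^-1 ^+ c)%:P).
  rewrite sub0r mulrBr !mulNr opprK -polyCM -exprMn mulfV // expr1n mul_polyC.
  by rewrite addrC.
under eq_bigr => c _ do rewrite e.
rewrite big_split /= !key // expr0n gtn_eqF //=; ring.
Qed.

Lemma qpoch_roots N m (z a : K) : m.-primitive_root z ->
  \prod_(c < m) qpoch N (a * z ^+ c) = \prod_(k < N) (1 - a ^+ m *: T ^+ (m * k.+1)).
Proof.
move=> hz; rewrite exchange_big /=; apply: eq_bigr => k _.
under eq_bigr => c _ do rewrite mulrC -scalerA.
by rewrite prod_root_sub // exprZn -exprM mulnC.
Qed.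

End RootsOfUnity.

Lemma big_all_pairs (R : Type) (idx : R) (op : Monoid.com_law idx) n (P : 'I_n -> 'I_n -> R) :
  \big[op/idx]_(i < n) \big[op/idx]_(j < n) P i j =
  op (\big[op/idx]_(i < n) \big[op/idx]_(j < n | (i < j)%N) op (P i j) (P j i))
     (\big[op/idx]_(i < n) P i i).
Proof.
have -> : \big[op/idx]_(i < n) \big[op/idx]_(j < n | (i < j)%N) op (P i j) (P j i) =
   op (\big[op/idx]_(i < n) \big[op/idx]_(j < n | (i < j)%N) P i j)
      (\big[op/idx]_(i < n) \big[op/idx]_(j < n | (j < i)%N) P i j).
  under eq_bigr do rewrite big_split.
  by rewrite big_split /=; congr (op _ _); rewrite (exchange_big_dep predT).
rewrite -!big_split /=; apply: eq_bigr => i _.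
rewrite (bigID (fun j : 'I_n => (i < j)%N)) -Monoid.mulmA /=; congr (op _ _).
rewrite (bigID (fun j : 'I_n => (j < i)%N)) /=; congr (op _ _).
  by apply: eq_bigl => j; case: ltngtP.
rewrite (big_pred1 i) // => j /=; rewrite -val_eqE /=.
by case: (ltngtP i j).
Qed.

Section RootValues.
Variable K : fieldType.
Local Notation A := {poly K}.
Local Notation T := ('X : A).
Hypothesis charK : [pchar K] =i pred0.

Definition rhs_pair N (x y : K) : A :=
  qpoch N (x * y) * qpoch N (x * y)^-1 * qpoch N (x / y) * qpoch N (y / x).

Definition rhs_prod (t N : nat) (x : 'I_t -> K) : A :=
  qpoch N 1 ^+ t
  * (\prod_(i < t) \prod_(j < t | (i < j)%N) rhs_pair N (x i) (x j))
  * \prod_(i < t) (qpoch N (x i ^+ 2) * qpoch N (x i ^+ 2)^-1).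

Lemma rhs_pairC N x y : rhs_pair N x y = rhs_pair N y x.
Proof. by rewrite /rhs_pair [y * x]mulrC; ring. Qed.

(** The diagonal pairs i = j supply the second copy of [qpoch N 1 ^+ t], squared, and one copy of
    the factors in x_i^2. *)
Lemma rhs_prod_sqr t N (x : 'I_t -> K) : (forall i, x i != 0) ->
  rhs_prod N x ^+ 2 =
  (\prod_(i < t) \prod_(j < t) rhs_pair N (x i) (x j)) *
  \prod_(i < t) (qpoch N (x i ^+ 2) * qpoch N (x i ^+ 2)^-1).
Proof.
move=> x0; rewrite big_all_pairs /= /rhs_prod.
have -> : \prod_(i < t) \prod_(j < t | (i < j)%N)
    (rhs_pair N (x i) (x j) * rhs_pair N (x j) (x i)) =
    (\prod_(i < t) \prod_(j < t | (i < j)%N) rhs_pair N (x i) (x j)) ^+ 2.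
  rewrite -prodrXl; apply: eq_bigr => i _; rewrite -prodrXl; apply: eq_bigr => j _.
  by rewrite [rhs_pair _ (x j) _]rhs_pairC expr2.
have -> : \prod_(i < t) rhs_pair N (x i) (x i) = (qpoch N 1 ^+ t) ^+ 2 *
   \prod_(i < t) (qpoch N (x i ^+ 2) * qpoch N (x i ^+ 2)^-1).
  have -> : (qpoch N 1 ^+ t) ^+ 2 = \prod_(i < t) qpoch N 1 ^+ 2 :> A.
    by rewrite prodr_const card_ord exprAC.
  rewrite -big_split; apply: eq_bigr => i _ /=.
  by rewrite /rhs_pair divff // -expr2; ring.
by rewrite /=; ring.
Qed.

Variables (t : nat) (w : K).
Hypothesis hw : (2 * t + 2).-primitive_root w.

Lemma root_half : w ^+ t.+1 = -1.
Proof.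
apply/eqP; have : (w ^+ t.+1) ^+ 2 == 1.
  by rewrite -exprM (_ : t.+1 * 2 = 2 * t + 2)%N ?(prim_expr_order hw) //; lia.
rewrite sqrf_eq1 => /orP[|//]; rewrite -(prim_order_dvd hw) => /dvdn_leq h.
by have := h isT; lia.
Qed.

Lemma root_neq0 : w != 0.
Proof.
apply/eqP => z0; have := prim_expr_order hw.
by rewrite z0 expr0n gtn_eqF ?addn2 // => /eqP; rewrite eq_sym oner_eq0.
Qed.

Lemma root_opp k : (k <= 2 * t + 2)%N -> w ^+ (2 * t + 2 - k) = w ^- k.
Proof.
by move=> hk; rewrite exprB ?unitfE ?root_neq0 // (prim_expr_order hw) mul1r.
Qed.

(* Squaring turns the product over i < j into one over all pairs, to which
   [qpoch_roots] applies; constant coefficients then select the square root. *)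
Lemma rhs_prod_roots N (k : 'I_t -> 'I_t) : injective k ->
  rhs_prod N (fun i => w ^+ (k i).+1) * qfact (T ^+ (2 * t + 2)) N =
  qfact (T ^+ (2 * t + 2)) N ^+ t * qpoch N (-1) * qfact (T ^+ t.+1) N.
Proof.
move=> kinj; set g := (2 * t + 2)%N; pose x i := w ^+ (k i).+1.
have x0 i : x i != 0 by rewrite expf_neq0 // root_neq0.
set R := rhs_prod N _; set Phi := qfact (T ^+ g) N; set Phi2 := qfact (T ^+ t.+1) N.
pose q := @qpoch K N.
pose F a := \prod_(j < t) (q (a * x j) * q (a / x j)).
have wg : w ^+ g = 1 := prim_expr_order hw.
(* Among the arguments a w^c, the residues c = 0 and t + 1 give a and - a; the pairs k, g - k give
   the arguments a x_j and a / x_j of [F a]. *)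
have eF a : a ^+ g = 1 -> q a * q (- a) * F a = Phi.
  move=> ag; transitivity (\prod_(c < g) q (a * w ^+ c)); last first.
    by rewrite qpoch_roots // ag; apply: eq_bigr => c _; rewrite scale1r exprM.
  rewrite (big_residues t (fun c => q (a * w ^+ c))) expr0 mulr1 root_half mulrN1.
  congr (_ * _); rewrite [RHS](reindex_inj kinj) /=; apply: eq_bigr => j _.
  by rewrite root_opp //; have := ltn_ord (k j); rewrite /g; lia.
pose Y : A := \prod_(i < t) (q (x i ^+ 2) * q (x i ^+ 2)^-1).
(* The squares w^(2c) run twice through the roots of unity of order t + 1. *)
have eY : q 1 ^+ 2 * Y = Phi2 ^+ 2.
  transitivity (\prod_(c < g) q (w ^+ (2 * c))).
    rewrite (big_residues t (fun c => q (w ^+ (2 * c)))) muln0 expr0.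
    rewrite (_ : 2 * t.+1 = g)%N ?wg; last by rewrite /g; lia.
    congr (_ * _); rewrite [RHS](reindex_inj kinj) /=; apply: eq_bigr => j _.
    rewrite mulnC exprM mulnC exprM root_opp ?exprVn //.
    by have := ltn_ord (k j); rewrite /g; lia.
  rewrite (_ : g = t.+1 + t.+1)%N; last by rewrite /g; lia.
  have hw2 : t.+1.-primitive_root (w ^+ 2).
    have := @exp_prim_root _ _ _ hw 2; have -> : (2 * t + 2 = t.+1 * 2)%N by lia.
    by rewrite gcdnMl mulnK.
  have e : \prod_(c < t.+1) q (w ^+ (2 * c)) = Phi2.
    transitivity (\prod_(c < t.+1) q (1 * (w ^+ 2) ^+ c)).
      by apply: eq_bigr => c _; rewrite mul1r exprM.
    rewrite qpoch_roots // expr1n; apply: eq_bigr => c _; by rewrite scale1r exprM.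
  rewrite big_split_ord /= e expr2; congr (_ * _); rewrite -e.
  apply: eq_bigr => c _; rewrite mulnDr exprD (_ : 2 * t.+1 = g)%N ?wg ?mul1r //.
  by rewrite /g; lia.
(* For each i, [F 1] and [F (-1)] contribute q at the four points x_i, 1/x_i and their opposites,
   exactly what [eF] requires at a = x_i and a = 1/x_i. *)
have eFF : (\prod_(i < t) \prod_(j < t) rhs_pair N (x i) (x j)) * (F 1 * F (-1)) = (Phi ^+ t) ^+ 2.
  have -> : \prod_(i < t) \prod_(j < t) rhs_pair N (x i) (x j) = \prod_(i < t) (F (x i) * F (x i)^-1).
    apply: eq_bigr => i _; rewrite -big_split; apply: eq_bigr => j _ /=.
    rewrite /rhs_pair /q invfM [_^-1 * x j]mulrC; ring.
  rewrite /F -!big_split /=.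
  have -> : (Phi ^+ t) ^+ 2 = \prod_(i < t) (Phi * Phi).
    by rewrite prodr_const card_ord exprAC expr2.
  apply: eq_bigr => i _; rewrite -/(F (x i)) -/(F (x i)^-1) !mul1r !mulN1r.
  have xg : x i ^+ g = 1 by rewrite exprAC wg expr1n.
  rewrite -{1}(eF _ xg) -(eF (x i)^-1); last by rewrite exprVn xg invr1.
  by ring.
have sq : (R * Phi) ^+ 2 = (Phi ^+ t * q (-1) * Phi2) ^+ 2.
  rewrite exprMn /R rhs_prod_sqr // -/Y !exprMn -eY -eFF.
  have e1 : q 1 * q (-1) * F 1 = Phi by apply: eF; rewrite expr1n.
  have e2 : q (-1) * q 1 * F (-1) = Phi.
    by rewrite -{2}[1]opprK; apply: eF; rewrite -root_half exprAC wg expr1n.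
  rewrite expr2 -{1}e1 -e2; ring.
apply/eqP; move/eqP: sq; rewrite eqf_sqr => /orP[//|/eqP h].
have q0 y : (q y)`_0 = 1.
  rewrite /q /qpoch coef0_prod big1 // => c _.
  by rewrite coefB coef1 coefZ coefXn mulr0 subr0.
have p0 m (p : A) : p`_0 = 1 -> (p ^+ m)`_0 = 1.
  by move=> hp; rewrite -horner_coef0 horner_exp horner_coef0 hp expr1n.
have R0 : R`_0 = 1.
  rewrite /R /rhs_prod !coef0M (p0 _ _ (q0 1)) mul1r !coef0_prod !big1 ?mulr1 // => i _.
    by rewrite coef0M /= !q0 mulr1.
  by rewrite coef0_prod big1 // => j _; rewrite /rhs_pair !coef0M !q0 !mulr1.
have : (R * Phi)`_0 = (- (Phi ^+ t * q (-1) * Phi2))`_0 by rewrite h.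
have Phi0 : Phi`_0 = 1 by rewrite qfact_coef0 // /g addn2.
have Phi20 : Phi2`_0 = 1 by rewrite qfact_coef0.
rewrite (coef0M R) R0 Phi0 coefN (coef0M _ Phi2) (coef0M _ (q (-1))) Phi20 q0 (p0 _ _ Phi0) !mulr1 => /eqP.
by rewrite -subr_eq0 opprK ((pcharf0P _).1 charK 2).
Qed.

End RootValues.

(** * The Macdonald identity *)

Section Macdonald.
Variable K : fieldType.
Local Notation A := {poly K}.
Local Notation T := ('X : A).
Hypothesis charK : [pchar K] =i pred0.
Variables (t : nat) (w : K).
Hypothesis hw : (2 * t + 2).-primitive_root w.

Definition theta_det (Q : nat) (x : 'I_t -> K) : A :=
  \det (\matrix_(i < t, j < t) psi t Q (t - i) (x j)).

Definition upd (x : 'I_t -> K) i0 z j : K := if j == i0 then z else x j.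

Lemma altdet_ext n (x y : 'I_n -> K) e : x =1 y -> altdet x e = altdet y e.
Proof. by move=> xy; congr (\det _); apply/matrixP => i j; rewrite !mxE xy. Qed.

Lemma theta_det_ext Q x y : x =1 y -> theta_det Q x = theta_det Q y.
Proof. by move=> xy; congr (\det _); apply/matrixP => i j; rewrite !mxE xy. Qed.

Lemma rhs_prod_ext N (x y : 'I_t -> K) : x =1 y -> rhs_prod N x = rhs_prod N y.
Proof.
move=> xy; congr (_ * _ * _); apply: eq_bigr => i _; last by rewrite xy.
by apply: eq_bigr => j _; rewrite !xy.
Qed.

Lemma det_col_eq0 (R : comNzRingType) n (M : 'M[R]_n) j1 j2 :
  j1 != j2 -> (forall i, M i j1 = M i j2) -> \det M = 0.
Proof.
move=> j12 h; rewrite -det_tr; apply: (determinant_alternate j12) => i.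
by rewrite !mxE.
Qed.

Lemma psi_root Q k (z : K) : z ^+ (2 * t + 2) = 1 -> z != 0 ->
  psi t Q k z = psi_coef K t Q k * (z ^ k%:Z - z ^ (- k%:Z))%:P.
Proof.
move=> zg z0; rewrite /psi /psi_coef mulr_suml; apply: eq_bigr => p _.
rewrite -mul_polyC mulrC; congr (_ * _%:P).
have e (m : int) : z ^ ((2 * t + 2)%N%:Z * m) = 1 by rewrite -exprz_exp -exprnP zg exp1rz.
by rewrite /bexp opprD -mulrN !expfzDr // !e !mul1r.
Qed.

Lemma theta_det_roots Q (x : 'I_t -> K) : (forall j, x j ^+ (2 * t + 2) = 1) ->
  (forall j, x j != 0) ->
  theta_det Q x = (\prod_(i < t) psi_coef K t Q i.+1) * (weyl_den x)%:P.
Proof.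
move=> xg x0; rewrite [X in X * _](reindex_inj rev_ord_inj) /=.
have -> : \prod_(j < t) psi_coef K t Q (t - j.+1).+1 = \det (diag_mx (\row_(j < t) psi_coef K t Q (t - j))).
  by rewrite det_diag; apply: eq_bigr => j _; rewrite mxE subnSK.
have -> : (weyl_den x)%:P = \det (map_mx polyC (\matrix_(i < t, j < t) (x j ^ ((t - i)%N%:Z) - x j ^ (- ((t - i)%N%:Z))))).
  by rewrite det_map_mx.
rewrite -det_mulmx; congr (\det _); apply/matrixP => i j.
by rewrite mul_diag_mx !mxE psi_root.
Qed.

Lemma weyl_den_roots_neq0 : weyl_den (fun j : 'I_t => w ^+ j.+1) != 0.
Proof.
have w0 := root_neq0 hw.
have wdvd n : (0 < n < 2 * t + 2)%N -> w ^+ n != 1.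
  move=> /andP[n0 hn]; rewrite -(prim_order_dvd hw); apply/negP => /(dvdn_leq n0); lia.
apply: weyl_den_neq0 => [i|i j /eqP|i j]; first by rewrite expf_neq0.
- wlog ij : i j / (i <= j)%N.
    by move=> h; case: (leqP i j) => [/h//|/ltnW/h h' /eqP e]; apply/esym/h'; rewrite e.
  rewrite (_ : j.+1 = i.+1 + (j - i))%N; last by lia.
  rewrite exprD -{1}[w ^+ i.+1]mulr1 (inj_eq (mulfI _)) ?expf_neq0 // eq_sym => e.
  apply/val_inj => /=; apply/eqP; rewrite eqn_leq ij /= leqNgt; apply/negP => ji.
  have h : (0 < j - i < 2 * t + 2)%N by have := ltn_ord j; lia.
  by move: (wdvd _ h); rewrite e.
by rewrite -exprD; apply: wdvd; have := ltn_ord i; have := ltn_ord j; lia.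
Qed.

(** At w^j, [psi] is [psi_coef] times w^(jk) - w^(-jk). Each coefficient in T therefore gives a
    linear system over K whose matrix has the nonzero determinant of [weyl_den_roots_neq0]; then
    [psi_coef], with constant term 1 from m = 0, is cancelled. *)
Lemma psi_span_unique N Q (B : nat -> A) :
  (forall j, (j < t)%N -> eqm N (\sum_(k < t) B k.+1 * psi t Q k.+1 (w ^+ j.+1)) 0) ->
  (0 < Q)%N ->
  forall k, (k < t)%N -> eqm N (B k.+1) 0.
Proof.
move=> h Q0 k kt.
have w0 := root_neq0 hw.
have sc0 i : (psi_coef K t Q i.+1)`_0 = 1 \/ (i >= t)%N.
  have [it|] := ltnP i t; [left|by right].
  rewrite /psi_coef coef_sum (bigD1 (true, Ordinal Q0)) //= /boxv /= eexp_pos.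
  rewrite !muln0 addn0 coefXn eqxx big1 ?addr0 // => -[[] q] hq; rewrite /boxv /= coefXn.
    have q0 : (0 < q)%N by case: q hq => -[].
    by have := leq_eexp_pos t i.+1 q; case: eexp => //; lia.
  by have := leq_eexp_neg q it; case: eexp.
have key : eqm N (psi_coef K t Q k.+1 * B k.+1) 0.
  move=> m hm; rewrite coef0.
  pose v : 'rV[K]_t := \row_i (psi_coef K t Q (t - i) * B (t - i)%N)`_m.
  pose M := \matrix_(i < t, j < t) ((w ^+ j.+1) ^ ((t - i)%N%:Z) - (w ^+ j.+1) ^ (- (t - i)%N%:Z)).
  have MU : M \in unitmx by rewrite unitmxE unitfE weyl_den_roots_neq0.
  have vM : v *m M = 0.
    apply/rowP => j; have hj := h j (ltn_ord j) m hm; rewrite coef0 in hj.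
    rewrite mxE [RHS]mxE -[RHS]hj.
    rewrite coef_sum [RHS](reindex_inj rev_ord_inj) /=; apply: eq_bigr => i _.
    rewrite !mxE subnSK // psi_root ?expf_neq0 //; last by rewrite exprAC (prim_expr_order hw) expr1n.
    by rewrite mulrA [B _ * _]mulrC coefMC.
  have v0 : v = 0 by rewrite -[v](mulmxK MU) vM mul0mx.
  have hk : (t - k.+1 < t)%N by lia.
  have := congr1 (fun u : 'rV_t => u 0 (Ordinal hk)) v0; rewrite !mxE /=.
  by rewrite (_ : t - (t - k.+1) = k.+1)%N //; lia.
apply: (@eqm_cancel0 _ _ (psi_coef K t Q k.+1)) => //.
by have [->|] := sc0 k; [rewrite oner_neq0 | lia].
Qed.

Lemma theta_det_expand Q (x : 'I_t -> K) i0 : exists B : nat -> A, forall z,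
  theta_det Q (upd x i0 z) = \sum_(k < t) B k.+1 * psi t Q k.+1 z.
Proof.
pose M z := \matrix_(i < t, j < t) psi t Q (t - i) (upd x i0 z j).
(* The cofactors of column [i0] do not see z, so they are taken at z = 1; the sum selects the one
   row with t - i = k. *)
exists (fun k => \sum_(i < t | (t - i)%N == k) cofactor (M 1) i i0) => z.
rewrite /theta_det -/(M z) (expand_det_col _ i0) (reindex_inj rev_ord_inj) /=.
apply: eq_bigr => i _; rewrite !mxE /upd eqxx mulrC; congr (_ * _); last first.
  by rewrite subKn.
rewrite (big_pred1 (rev_ord i)) => [|j]; last first.
  rewrite /= -val_eqE /=; have := ltn_ord i; have := ltn_ord j; lia.
rewrite /cofactor; congr (_ * \det _); apply/matrixP => a b.
by rewrite !mxE /upd eq_sym (negPf (neq_lift _ _)).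
Qed.

(** Antisymmetry allows every pair containing [i0] to be oriented with z first, at the price of a
    sign independent of z. *)
Lemma prod_pairs_upd (R : comPzRingType) (I : Type) (P : I -> I -> R) (x : 'I_t -> I) (i0 : 'I_t) :
  (forall a b, P a b = - P b a) ->
  exists C, forall z, let y j := if j == i0 then z else x j in
  \prod_(i < t) \prod_(j < t | (i < j)%N) P (y i) (y j) =
  C * \prod_(j < t | j != i0) P z (x j).
Proof.
move=> aP; pose s j : R := if (i0 < j)%N then 1 else -1.
exists ((\prod_(j < t | j != i0) s j) *
  \prod_(i < t | i != i0) \prod_(j < t | (i < j)%N && (j != i0)) P (x i) (x j)) => z y.
rewrite (bigD1 i0) //= mulrAC -big_split /=.
have -> : \prod_(j < t | (i0 < j)%N) P (y i0) (y j) =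
    \prod_(j < t | j != i0) (if (i0 < j)%N then P z (x j) else 1).
  rewrite -big_mkcondr; apply: eq_big => [j|j ij]; rewrite /y ?eqxx.
    by rewrite -val_eqE /=; case: (ltngtP j i0).
  by rewrite -val_eqE gtn_eqF.
have -> : \prod_(i < t | i != i0) \prod_(j < t | (i < j)%N) P (y i) (y j) =
   \prod_(i < t | i != i0) ((if (i < i0)%N then P (x i) z else 1) *
     \prod_(j < t | (i < j)%N && (j != i0)) P (x i) (x j)).
  apply: eq_bigr => i ii0; rewrite (bigID (pred1 i0)) /=; congr (_ * _).
    rewrite -big_filter.
    case: ifP => ii.
      rewrite big_filter (big_pred1 i0) /y ?eqxx ?(negPf ii0) // => j /=.
      by case: (j =P i0) => [->|]; rewrite ?ii ?andbF.
    by rewrite big_filter big_pred0 // => j; case: (j =P i0) => [->|]; rewrite ?ii ?andbF.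
  by apply: eq_bigr => j /andP[_ ji0]; rewrite /y (negPf ii0) (negPf ji0).
rewrite big_split /= mulrA -big_split /=; congr (_ * _); apply: eq_bigr => j ji0.
rewrite /s; case: (ltngtP i0 j) => [_|_|/val_inj e]; rewrite ?mulr1 ?mul1r //.
  by rewrite mulN1r aP.
by rewrite e eqxx in ji0.
Qed.

Lemma rhs_upd N (x : 'I_t -> K) i0 : (forall i, x i != 0) ->
  exists C, forall z, z != 0 ->
  (weyl_den (upd x i0 z))%:P * rhs_prod N (upd x i0 z) =
  C * theta_val N [seq x j | j <- enum (predC1 i0)] z.
Proof.
move=> x0; have [s s0 hs] := weyl_den_prod K t.
pose P (a b : K) : A := (a + a^-1 - (b + b^-1))%:P * rhs_pair N a b.
have aP a b : P a b = - P b a.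
  by rewrite /P rhs_pairC -mulNr -polyCN opprB.
have [C hC] := prod_pairs_upd x i0 aP.
pose f (a : K) : A := (a - a^-1)%:P * (qpoch N (a ^+ 2) * qpoch N (a ^+ 2)^-1).
exists (s%:P * qpoch N 1 ^+ t * C * \prod_(i < t | i != i0) f (x i)) => z z0.
have u0 i : upd x i0 z i != 0 by rewrite /upd; case: ifP.
rewrite hs // /rhs_prod !polyCM !rmorph_prod /=.
set U := upd x i0 z.
have -> : \prod_(i < t) (\prod_(j < t | (i < j)%N) (U i + (U i)^-1 - (U j + (U j)^-1)))%:P
  = \prod_(i < t) \prod_(j < t | (i < j)%N) (U i + (U i)^-1 - (U j + (U j)^-1))%:P.
  by apply: eq_bigr => i _; rewrite rmorph_prod.
transitivity (s%:P * qpoch N 1 ^+ t * (\prod_(i < t) f (U i)) *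
   \prod_(i < t) \prod_(j < t | (i < j)%N) P (U i) (U j)).
  have -> : \prod_(i < t) f (U i) = \prod_(i < t) (U i - (U i)^-1)%:P *
      \prod_(i < t) (qpoch N (U i ^+ 2) * qpoch N (U i ^+ 2)^-1).
    by rewrite -big_split.
  have -> : \prod_(i < t) \prod_(j < t | (i < j)%N) P (U i) (U j) =
      \prod_(i < t) \prod_(j < t | (i < j)%N) (U i + (U i)^-1 - (U j + (U j)^-1))%:P *
      \prod_(i < t) \prod_(j < t | (i < j)%N) rhs_pair N (U i) (U j).
    by rewrite -big_split; apply: eq_bigr => i _; rewrite -big_split.
  by ring.
rewrite hC (bigD1 i0) //= {1}/U /upd eqxx.
have -> : \prod_(i < t | i != i0) f (U i) = \prod_(i < t | i != i0) f (x i).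
  by apply: eq_bigr => i /negPf ii0; rewrite /U /upd ii0.
rewrite /theta_val big_map big_enum /= -/(f z) -/(rhs_pair _ _ _).
by rewrite /P /rhs_pair; ring.
Qed.

Definition macdonald_diff N (x : 'I_t -> K) : A :=
  (weyl_den x)%:P * rhs_prod N.+1 x - theta_det N.+2 x.

Lemma macdonald_diff_expand N (x : 'I_t -> K) i0 : (forall i, x i != 0) ->
  exists B : nat -> A, forall z, z != 0 ->
  eqm N (macdonald_diff N (upd x i0 z)) (\sum_(k < t) B k.+1 * psi t N.+2 k.+1 z).
Proof.
move=> x0; have [B1 h1] := theta_det_expand N.+2 x i0.
have [C h2] := rhs_upd N.+1 i0 x0.
pose ys := [seq x j | j <- enum (predC1 i0)].
have ys0 : all (fun y => y != 0) ys by apply/allP => _ /mapP[j _ ->].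
have [B2 h3] := theta_expand charK N ys0.
have sz : (size ys).+1 = t.
  by rewrite size_map -cardE cardC1 card_ord prednK // (leq_ltn_trans (leq0n i0) (ltn_ord i0)).
rewrite sz in h3.
exists (fun k => C * B2 k - B1 k) => z z0.
rewrite /macdonald_diff h1 h2 //.
under [X in eqm _ _ X]eq_bigr do rewrite mulrBl -mulrA.
rewrite sumrB -mulr_sumr; apply: eqmB; last exact: eqm_refl.
exact/eqmMl/h3.
Qed.

(** Variables are specialized independently, so [k] may repeat a value; then two columns coincide
    and both determinants vanish. For injective [k] both sides are evaluated after multiplication by
    an invertible series. *)
Lemma macdonald_roots N (k : 'I_t -> 'I_t) :
  eqm N (macdonald_diff N (fun j => w ^+ (k j).+1)) 0.
Proof.
rewrite /macdonald_diff; set x := fun j => _.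
have x0 j : x j != 0 by rewrite expf_neq0 // (root_neq0 hw).
have xg j : x j ^+ (2 * t + 2) = 1 by rewrite exprAC (prim_expr_order hw) expr1n.
rewrite theta_det_roots //.
have [kinj|] := boolP (injectiveb k); last first.
  case/injectivePn => j1 [j2 j12 ek].
  rewrite /weyl_den /altdet (det_col_eq0 j12) => [|i]; last by rewrite !mxE /x ek.
  by rewrite mul0r mulr0 subrr; apply: eqm_refl.
rewrite mulrC -mulrBl -[X in eqm _ _ X](mul0r (weyl_den x)%:P); apply: eqmMr.
have hR := rhs_prod_roots charK hw N.+1 (injectiveP _ kinj); rewrite -/x in hR.
have hS := psi_coef_prod charK t (leqnSn N).
apply: (@eqm_cancel0 _ _ (qfact (T ^+ (2 * t + 2)) N.+1)).
  by rewrite qfact_coef0 ?addn2 ?oner_neq0.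
rewrite mulrBr mulrC hR -[X in eqm _ _ X](subrr (qfact (T ^+ (2 * t + 2)) N.+1 ^+ t * qpoch N.+1 (-1) *
        qfact (T ^+ t.+1) N.+1)).
by apply: eqmB; [apply: eqm_refl | rewrite mulrC].
Qed.

Lemma macdonald N (x : 'I_t -> K) : (forall i, x i != 0) ->
  eqm N ((weyl_den x)%:P * rhs_prod N.+1 x) (theta_det N.+2 x).
Proof.
move=> x0; suff h : eqm N (macdonald_diff N x) 0.
  by have := eqmD h (@eqm_refl _ N (theta_det N.+2 x)); rewrite subrK add0r.
have diff_ext y y' : y =1 y' -> macdonald_diff N y = macdonald_diff N y'.
  move=> e; rewrite /macdonald_diff (theta_det_ext _ e) (rhs_prod_ext _ e).
  by rewrite /weyl_den (altdet_ext _ e).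
(* Induction on the number m of leading variables still arbitrary. As a function of the last of
   these, the difference is a combination of the [psi]; it vanishes at w, ..., w^t by induction,
   hence identically. *)
suff H m : (m <= t)%N -> forall y : 'I_t -> K, (forall i, y i != 0) ->
    (forall j : 'I_t, (m <= j)%N -> exists k : 'I_t, y j = w ^+ k.+1) ->
    eqm N (macdonald_diff N y) 0.
  by apply: (H t) => // j; rewrite leqNgt ltn_ord.
elim: m => [|m IH] mt y y0 hy.
  have kP j : {k : 'I_t | y j == w ^+ k.+1}.
    by apply: sigW; have [k ->] := hy j (leq0n _); exists k.
  rewrite (diff_ext _ (fun j => w ^+ (sval (kP j)).+1)); first exact: macdonald_roots.
  by move=> j; case: (kP j) => k /= /eqP.
pose i0 := Ordinal mt; have [B hB] := macdonald_diff_expand N i0 y0.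
have w0 := root_neq0 hw.
have ex : y =1 upd y i0 (y i0) by move=> j; rewrite /upd; case: eqP => [->|].
rewrite (diff_ext _ _ ex); apply: eqm_trans (hB _ (y0 i0)) _.
have hBk : forall k, (k < t)%N -> eqm N (B k.+1) 0.
  apply: (@psi_span_unique _ N.+2) => // j jt.
  apply: eqm_trans (eqm_sym (hB _ _)) _; first by rewrite expf_neq0.
  apply: IH (ltnW mt) _ _ _ => [i|j' hj'].
    by rewrite /upd; case: ifP => // _; rewrite expf_neq0.
  rewrite /upd; case: eqP => [_|/eqP ne]; first by exists (Ordinal jt).
  by apply: hy; rewrite ltn_neqAle hj' andbT eq_sym.
have e0 : \sum_(k < t) (0 : A) = 0 by rewrite big1.
rewrite -[X in eqm _ _ X]e0.
apply: eqm_sum => k _.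
by rewrite -[X in eqm _ _ X](mul0r (psi t N.+2 k.+1 (y i0))); apply/eqmMr/hBk.
Qed.

End Macdonald.

(** * Change of field and extraction of coefficients *)

Section FractionMap.
Variables (R S : idomainType) (f : {rmorphism R -> S}).
Hypothesis f_inj : injective f.
Local Notation tofrac := (@tofrac _).

Lemma fraction_repr (x : {fraction R}) :
  exists p : R * R, (p.2 != 0) && (x == tofrac p.1 / tofrac p.2).
Proof.
elim/quotW: x => r; exists (\n_r, \d_r); rewrite /= denom_ratioP /=.
have d0 : tofrac \d_r != 0 by rewrite tofrac_eq0 denom_ratioP.
apply/eqP/(mulIf d0); rewrite divfK //.
rewrite !piE; apply/eqmodP; rewrite /= FracField.equivfE.
by rewrite !numden_Ratio ?oner_eq0 ?mulf_neq0 ?denom_ratioP ?oner_eq0 // !mulr1 mulrC.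
Qed.

(* The unused reference to [f_inj] makes the proof a parameter of the function,
   from which the morphism instances below recover it. *)
Definition fraction_map (x : {fraction R}) : {fraction S} :=
  let _ := f_inj in let p := xchoose (fraction_repr x) in tofrac (f p.1) / tofrac (f p.2).

Let tofracf_neq0 b : b != 0 -> tofrac (f b) != 0.
Proof. by move=> b0; rewrite tofrac_eq0 -(rmorph0 f) (inj_eq f_inj). Qed.

Lemma fraction_mapE a b : b != 0 ->
  fraction_map (tofrac a / tofrac b) = tofrac (f a) / tofrac (f b).
Proof.
move=> b0; rewrite /fraction_map; case/andP: (xchooseP (fraction_repr (tofrac a / tofrac b))).
move: (xchoose _) => [c d] /= d0; rewrite eqr_div ?tofrac_eq0 // -!tofracM tofrac_eq => /eqP e.
by apply/eqP; rewrite eqr_div ?tofracf_neq0 // -!tofracM tofrac_eq -!rmorphM e.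
Qed.

Lemma fraction_map_tofrac a : fraction_map (tofrac a) = tofrac (f a).
Proof.
by have := fraction_mapE a (oner_neq0 R); rewrite !rmorph1 !divr1.
Qed.

Lemma fraction_map_is_zmod_morphism : zmod_morphism fraction_map.
Proof.
move=> x y; have [[a b] /= /andP[b0 /eqP ->]] := fraction_repr x.
have [[c d] /= /andP[d0 /eqP ->]] := fraction_repr y.
rewrite -mulNr -tofracN addf_div ?tofrac_eq0 // -!tofracM -tofracD.
rewrite !fraction_mapE ?mulf_neq0 // -mulNr -tofracN addf_div ?tofracf_neq0 //.
by rewrite -!tofracM -tofracD rmorphD !rmorphM rmorphN.
Qed.

Lemma fraction_map_is_monoid_morphism : monoid_morphism fraction_map.
Proof.
split=> [|x y]; first by rewrite -(tofrac1 R) fraction_map_tofrac rmorph1 tofrac1.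
have [[a b] /= /andP[b0 /eqP ->]] := fraction_repr x.
have [[c d] /= /andP[d0 /eqP ->]] := fraction_repr y.
rewrite mulf_div -!tofracM !fraction_mapE ?mulf_neq0 //.
by rewrite mulf_div -!tofracM !rmorphM.
Qed.

HB.instance Definition _ := GRing.isZmodMorphism.Build {fraction R} {fraction S}
  fraction_map fraction_map_is_zmod_morphism.
HB.instance Definition _ := GRing.isMonoidMorphism.Build {fraction R} {fraction S}
  fraction_map fraction_map_is_monoid_morphism.

End FractionMap.

Section Coefficients.
Variable K : fieldType.

Lemma det_sum_rows (R : comNzRingType) n (J : finType) (F : 'I_n -> J -> 'I_n -> R) :
  \det (\matrix_(i < n, j < n) \sum_p F i p j) =
  \sum_(f : {ffun 'I_n -> J}) \det (\matrix_(i < n, j < n) F i (f i) j).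
Proof.
rewrite /determinant exchange_big /=; apply: eq_bigr => s _.
rewrite -mulr_sumr; congr (_ * _).
transitivity (\prod_(i < n) \sum_p F i p (s i)).
  by apply: eq_bigr => i _; rewrite mxE.
rewrite bigA_distr_bigA /=; apply: eq_bigr => f _.
by apply: eq_bigr => i _; rewrite mxE.
Qed.

Lemma theta_det_coef t Q (x : 'I_t -> K) n :
  (theta_det Q x)`_n =
  \sum_(f : {ffun 'I_t -> bool * 'I_Q} |
        \sum_(i < t) eexp t (t - i) (boxv (f i)) == n)
    altdet x (fun i => bexp t (t - i) (boxv (f i))).
Proof.
rewrite /theta_det /psi (det_sum_rows (fun (i : 'I_t) p (j : 'I_t) =>
  (x j ^ bexp t (t - i) (boxv p) - x j ^ (- bexp t (t - i) (boxv p))) *: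
     'X^(eexp t (t - i) (boxv p)))) coef_sum [RHS]big_mkcond /=.
apply: eq_bigr => f _.
have -> : \matrix_(i < t, j < t)
    ((x j ^ bexp t (t - i) (boxv (f i)) - x j ^ (- bexp t (t - i) (boxv (f i)))) *:
      'X^(eexp t (t - i) (boxv (f i)))) =
  diag_mx (\row_i 'X^(eexp t (t - i) (boxv (f i)))) *m
  map_mx polyC (\matrix_(i < t, j < t)
    (x j ^ bexp t (t - i) (boxv (f i)) - x j ^ (- bexp t (t - i) (boxv (f i))))).
  by apply/matrixP => i j; rewrite mul_diag_mx !mxE -mul_polyC mulrC.
rewrite det_mulmx det_diag det_map_mx /= -/(altdet _ _).
under eq_bigr do rewrite mxE.
by rewrite prodrXr coefMC coefXn eq_sym; case: eqP; rewrite ?mul1r ?mul0r.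
Qed.

End Coefficients.

Lemma macdonald_coef (K : fieldType) (t : nat) (w : K) n (x : 'I_t -> K) :
  [pchar K] =i pred0 -> (2 * t + 2).-primitive_root w -> (forall i, x i != 0) ->
  weyl_den x * (rhs_prod n x)`_n =
  \sum_(f : {ffun 'I_t -> bool * 'I_n.+3} |
        \sum_(i < t) eexp t (t - i) (boxv (f i)) == n)
    altdet x (fun i => bexp t (t - i) (boxv (f i))).
Proof.
(* Coefficient n needs precision n + 1, for which [macdonald] uses products up to n + 2 and theta
   sums of size n + 3; the products may then be shortened to n factors. *)
move=> ch hw x0; rewrite -theta_det_coef -(macdonald ch hw x0 (ltnSn n)) coefCM.
congr (_ * _); have q y : eqm n.+1 (qpoch n y) (qpoch n.+2 y).
  by apply/eqm_sym/qpoch_eqm; lia.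
suff h : eqm n.+1 (rhs_prod n x) (rhs_prod n.+2 x) by apply: h.
apply: eqmM; last by apply: eqm_prod => i _; apply: eqmM.
apply: eqmM; first exact: eqmX.
apply: eqm_prod => i _; apply: eqm_prod => j _.
by do 3?apply: eqmM.
Qed.

Section GenericPoint.
Variable t : nat.

Local Notation K := {fraction {mpoly algC[t]}}.

Let intC : {rmorphism int -> algC} := intr.

Let intC_inj : injective (map_mpoly intC : {mpoly int[t]} -> {mpoly algC[t]}).
Proof.
move=> p q /mpolyP h; apply/mpolyP => m; have := h m.
by rewrite !mcoeff_map_mpoly /= => /intr_inj.
Qed.

(** Its target contains roots of unity of every order; as field morphisms are injective, an identity
    proved there holds in the field of the statement. *)
Lemma frac_embedding : inhabited {rmorphism Frac t -> K}.
Proof. by split; exact: (@fraction_map _ _ (map_mpoly intC) intC_inj). Qed.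

Lemma xvar_neq0 (i : 'I_t) : xvar i != 0.
Proof.
rewrite tofrac_eq0; apply/eqP => /mpolyP /(_ U_(i)%MM) /eqP.
by rewrite mcoeffXU eqxx mcoeff0 oner_eq0.
Qed.

Lemma macdonald_generic n :
  weyl_den (@xvar t) * (RHS_trunc t n)`_n =
  \sum_(f : {ffun 'I_t -> bool * 'I_n.+3} |
        \sum_(i < t) eexp t (t - i) (boxv (f i)) == n)
    altdet (@xvar t) (fun i => bexp t (t - i) (boxv (f i))).
Proof.
have [phi] := frac_embedding.
have n0 : (0 < 2 * t + 2)%N by rewrite addn2.
have [z hz] := C_prim_root_exists n0.
pose c : {rmorphism algC -> K} := (@tofrac _ \o @mpolyC t algC).
have hw : (2 * t + 2).-primitive_root (c z) by rewrite fmorph_primitive_root.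
have ch : [pchar K] =i pred0.
  by move=> p; rewrite (fmorph_pchar c) Num.Theory.pchar_num.
pose x (i : 'I_t) := phi (xvar i).
have x0 i : x i != 0 by rewrite fmorph_eq0 xvar_neq0.
have altE e : altdet x e = phi (altdet (@xvar t) e).
  rewrite /altdet -det_map_mx; congr (\det _); apply/matrixP => i j.
  by rewrite !mxE rmorphB !fmorphXz.
apply: (fmorph_inj phi).
have h := macdonald_coef n ch hw x0.
rewrite [LHS]rmorphM [RHS]rmorph_sum.
under [RHS]eq_bigr do rewrite -altE.
rewrite -[RHS]h /weyl_den -altE; congr (_ * _).
rewrite -coef_map /=; congr (_`_ n).
have qE y : map_poly phi (qfac n y) = qpoch n (phi y).
  rewrite /qfac /qpoch rmorph_prod; apply: eq_bigr => k _.
  by rewrite rmorphB rmorph1 /= map_polyZ map_polyXn.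
rewrite /RHS_trunc /rhs_prod !rmorphM rmorphXn /= qE rmorph1.
have e1 i j : map_poly phi (qfac n (xvar i * xvar j) * qfac n (xvar i * xvar j)^-1 *
    qfac n (xvar i / xvar j) * qfac n (xvar j / xvar i)) = rhs_pair n (x i) (x j).
  by rewrite /rhs_pair !rmorphM /= !qE !(fmorphV, rmorphM).
have e2 i : map_poly phi (qfac n (xvar i ^+ 2) * qfac n (xvar i ^- 2)) =
    qpoch n (x i ^+ 2) * qpoch n (x i ^- 2).
  by rewrite rmorphM /= !qE fmorphV rmorphXn.
set U := map_poly phi (\prod_(i < t) \prod_(j < t | _) _).
set W := map_poly phi _.
have -> : U = \prod_(i < t) \prod_(j < t | (i < j)%N) rhs_pair n (x i) (x j).
  rewrite /U rmorph_prod; apply: eq_bigr => i _.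
  by rewrite rmorph_prod; apply: eq_bigr => j _; apply: e1.
have -> : W = \prod_(i < t) (qpoch n (x i ^+ 2) * qpoch n (x i ^- 2)).
  by rewrite /W rmorph_prod; apply: eq_bigr => i _; apply: e2.
by [].
Qed.

End GenericPoint.

Lemma xvar_mul_neq1 t (i j : 'I_t) : xvar i * xvar j != 1.
Proof.
rewrite /xvar -tofracM -[1](tofrac1 {mpoly int[t]}) tofrac_eq; apply/eqP => /mpolyP /(_ 0%MM) /eqP.
rewrite -mpolyXD mcoeffX mcoeff1 eqxx -mdeg_eq0 mdegD !mdeg1 /=.
by rewrite eq_sym oner_eq0.
Qed.

Lemma xvar_inj t : injective (@xvar t).
Proof.
move=> i j /eqP; rewrite /xvar tofrac_eq => /eqP /mpolyP /(_ U_(i)%MM) /eqP.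
by rewrite !mcoeffXU eqxx; case: (j =P i) => // _; rewrite oner_eq0.
Qed.

Lemma weyl_den_xvar_neq0 t : weyl_den (@xvar t) != 0.
Proof.
exact: weyl_den_neq0 (@xvar_neq0 t) (@xvar_inj t) (@xvar_mul_neq1 t).
Qed.

(** * Partitions and beads *)

Import Order.TTheory Num.Theory.

Lemma geq_trans : transitive geq.
Proof. by move=> a b c /= h1 h2; apply: leq_trans h2 h1. Qed.

Section Beads.
Variable la : seq nat.
Hypothesis la_part : is_partition la.

Lemma part_conjp i j : (0 < i)%N -> (0 < j)%N -> (j <= part la i)%N = (i <= conjp la j)%N.
Proof.
case: i => // i _ j0; case/andP: la_part => + _; rewrite /part /conjp /=.
elim: la i => [|p s IH] i /= hs; first by rewrite nth_nil; case: j j0.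
have hs' := path_sorted hs; have /allP hall := order_path_min geq_trans hs.
have [jp|pj] := leqP j p; first by case: i => [|i]; rewrite ?jp //= IH // add1n ltnS.
have -> : count (fun q => j <= q)%N s = 0%N.
  apply/eqP; rewrite -leqn0 leqNgt -has_count; apply/hasPn => q /hall /= qp.
  by rewrite -ltnNge (leq_ltn_trans qp).
case: i => [|i] /=; first by rewrite leqNgt pj.
rewrite addn0 ltn0; apply/negbTE; rewrite -ltnNge.
have [lt|ge] := ltnP i (size s); last by rewrite nth_default.
by rewrite (leq_ltn_trans _ pj) //; apply/hall/mem_nth.
Qed.

Lemma part_pos i : (0 < i)%N -> (0 < part la i)%N = (i <= size la)%N.
Proof.
case: i => // i _; case/andP: la_part => _ /allP hp; rewrite /part /=.
have [lt|ge] := ltnP i (size la); first by rewrite hp // mem_nth.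
by rewrite nth_default.
Qed.

Lemma part_mono i i' : (0 < i)%N -> (i <= i')%N -> (part la i' <= part la i)%N.
Proof.
move=> i0 ii'; case e: (part la i') => [//|p]; rewrite part_conjp //.
by rewrite (leq_trans ii') // -part_conjp ?e //; lia.
Qed.

Lemma conjp_mono j j' : (0 < j)%N -> (j <= j')%N -> (conjp la j' <= conjp la j)%N.
Proof.
move=> j0 jj'; case e: (conjp la j') => [//|p]; rewrite -part_conjp //.
by rewrite (leq_trans jj') // part_conjp ?e //; lia.
Qed.

(* The beads of the abacus are the part(i) - i; its gaps are the j - 1 - conjp(j).
   A box (i, j) has hook length [rbead i - cbead j]. *)
Definition rbead (i : nat) : int := (part la i)%:Z - i%:Z.
Definition cbead (j : nat) : int := j%:Z - 1 - (conjp la j)%:Z.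
Definition bead (x : int) : bool :=
  (x \in [seq rbead i | i <- iota 1 (size la)]) || (x < - (size la)%:Z).

Lemma beadP x : reflect (exists2 i, (0 < i)%N & x = rbead i) (bead x).
Proof.
apply: (iffP orP) => [[/mapP[i]|xs]|[i i0 ->]].
- by rewrite mem_iota => /andP[i0 _] ->; exists i.
- exists `|x|%N; first by lia.
  have := part_pos (i := `|x|%N); rewrite /rbead; lia.
have [le|lt] := leqP i (size la).
  by left; apply/mapP; exists i => //; rewrite mem_iota i0 add1n ltnS.
right; have := part_pos i0; rewrite /rbead; lia.
Qed.

Lemma bead_rbead i : (0 < i)%N -> bead (rbead i).
Proof. by move=> i0; apply/beadP; exists i. Qed.

Lemma rbead_lt i i' : (0 < i)%N -> (0 < i')%N -> (rbead i' < rbead i) = (i < i')%N.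
Proof.
move=> i0 i'0; have [ii'|] := ltnP i i'.
  have := part_mono i0 (ltnW ii'); rewrite /rbead; lia.
move=> h; have := part_mono i'0 h; rewrite /rbead; lia.
Qed.

Lemma cbead_lt j j' : (0 < j)%N -> (0 < j')%N -> (cbead j < cbead j') = (j < j')%N.
Proof.
move=> i0 i'0; have [ii'|] := ltnP j j'.
  have := conjp_mono i0 (ltnW ii'); rewrite /cbead; lia.
move=> h; have := conjp_mono i'0 h; rewrite /cbead; lia.
Qed.

Lemma cbead_lt_rbead i j : (0 < i)%N -> (0 < j)%N ->
  (cbead j < rbead i) = (j <= part la i)%N.
Proof.
by move=> i0 j0; have := part_conjp i0 j0; rewrite /cbead /rbead; lia.
Qed.

Lemma cbead_neq_rbead i j : (0 < i)%N -> (0 < j)%N -> cbead j != rbead i.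
Proof.
by move=> i0 j0; have := part_conjp i0 j0; rewrite /cbead /rbead; lia.
Qed.

Lemma hook_beads i j : (0 < i)%N -> (0 < j)%N -> (j <= part la i)%N ->
  (hook la (i, j))%:Z = rbead i - cbead j.
Proof.
by move=> i0 j0 h; have := part_conjp i0 j0; rewrite h /hook /cbead /rbead /=; lia.
Qed.

Lemma nbeadP x : reflect (exists2 j, (0 < j)%N & x = cbead j) (~~ bead x).
Proof.
apply: (iffP idP) => [nb|[j j0 ->]]; last first.
  apply/beadP => -[i i0 /eqP]; apply/negP.
  by rewrite eq_sym -eqbF_neg eq_sym; move: (cbead_neq_rbead i0 j0); rewrite eq_sym; case: eqP.
have ex : exists i, (0 < i)%N && (rbead i <= x).
  exists (`|x| + (size la).+1)%N; rewrite addnS /=.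
  have := part_pos (i := (`|x| + size la).+1) isT; rewrite /rbead; lia.
case: (ex_minnP ex) => i /andP[i0 ix] imin.
have ix' : rbead i < x.
  by rewrite lt_neqAle ix andbT; apply: contra nb => /eqP <-; apply: bead_rbead.
have e : (part la i)%:Z < x + i%:Z by rewrite /rbead in ix'; lia.
(* Row [i] is the first whose bead lies below x, so column x + i has exactly i - 1 boxes and its gap
   is at x. *)
pose j := absz (x + i%:Z); have jE : j%:Z = x + i%:Z by rewrite /j; lia.
have j0 : (0 < j)%N by lia.
exists j => //; rewrite /cbead jE.
suff -> : conjp la j = i.-1 by lia.
apply/eqP; rewrite eqn_leq; apply/andP; split.
  by rewrite -ltnS prednK // ltnNge -part_conjp //; lia.
case: (i) i0 imin jE {ix ix' e} => // -[|i'] // _ imin jE; rewrite -part_conjp //=.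
have : ~~ (rbead i'.+1 <= x) by apply/negP => h; have := imin i'.+1; rewrite h ltnn => /(_ isT).
rewrite /rbead; lia.
Qed.

End Beads.

Section BeadConditions.
Variable la : seq nat.
Hypothesis la_part : is_partition la.
Local Notation bead := (bead la).
Local Notation rbead := (rbead la).
Local Notation cbead := (cbead la).

Lemma durfeeE s : (0 < s)%N -> (s <= durfee la)%N = (s <= part la s)%N.
Proof.
move=> s0; apply/idP/idP => [sd|ss]; last first.
  rewrite /durfee; have hs : (s <= size la)%N by rewrite -part_pos //; apply: leq_trans ss.
  by apply: (@leq_bigmax_seq _ _ _ (fun s : nat => s)) => //; rewrite mem_index_iota s0.
set d := durfee la in sd; have d0 : (0 < d)%N by apply: leq_trans sd.
suff dd : (d <= part la d)%N.
  by rewrite (leq_trans sd) // (leq_trans dd) // part_mono.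
rewrite leqNgt; apply/negP => nd.
suff : (d <= d.-1)%N by lia.
apply/bigmax_leqP_seq => i; rewrite mem_index_iota => /andP[i0 il] hi.
have id : (i <= d)%N.
  by apply: (@leq_bigmax_seq _ _ _ (fun s : nat => s)) => //; rewrite mem_index_iota i0.
have : i != d by apply: contraTneq hi => ->; rewrite -ltnNge.
by lia.
Qed.

Lemma rbead_ge0 s : (0 < s)%N -> (0 <= rbead s) = (s <= durfee la)%N.
Proof. by move=> s0; rewrite durfeeE // /rbead subr_ge0. Qed.

Lemma cbead_lt0 s : (0 < s)%N -> (cbead s < 0) = (s <= durfee la)%N.
Proof.
by move=> s0; rewrite durfeeE // part_conjp // /cbead; lia.
Qed.

Lemma is_DDP : reflect (forall s, (0 < s)%N -> (s <= durfee la)%N -> rbead s = - cbead s)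
  (is_DD la).
Proof.
apply: (iffP forallP) => [h [//|s] _ sd|h [s sd]].
  by have /eqP := h (Ordinal sd); rewrite /rbead /cbead /=; lia.
by have := h s.+1 isT sd; rewrite /rbead /cbead /=; lia.
Qed.

Definition bead_antisym := ~~ bead 0 /\ forall x, 0 < x -> bead x = ~~ bead (- x).

(** The rows up to the Durfee size carry the nonnegative beads, the columns up to it the negative
    gaps. Both lists are strictly monotone, so when negation matches the two sets it must match the
    s-th bead with the s-th gap; this is the induction in the converse. *)
Lemma DD_bead_antisym : is_DD la <-> bead_antisym.
Proof.
split=> [/is_DDP DD|[b0 anti]].
  split; first apply/negP => /(beadP la_part)[i i0 e].
    have id : (i <= durfee la)%N by rewrite -rbead_ge0 // -e.
    have := cbead_neq_rbead la_part i0 i0; rewrite -e.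
    by have := DD i i0 id; rewrite -e; lia.
  move=> x x0; apply/(beadP la_part)/(nbeadP la_part) => [[i i0 e]|[i i0 e]]; exists i => //.
    have id : (i <= durfee la)%N by rewrite -rbead_ge0 // -e ltW.
    by rewrite e (DD i i0 id) opprK.
  have id : (i <= durfee la)%N by rewrite -cbead_lt0 // -e oppr_lt0.
  by rewrite (DD i i0 id) -e opprK.
apply/is_DDP => s; elim/ltn_ind: s => s IH s0 sd.
have rs0 : 0 < rbead s.
  have := rbead_ge0 s0; rewrite sd le_eqVlt => /orP[/eqP e|//].
  by move: b0; rewrite e bead_rbead.
have : bead (rbead s) by apply: bead_rbead.
rewrite anti // => /(nbeadP la_part)[j j0 ej].
have [js|sj|e] := ltngtP j s; last by rewrite e in ej; rewrite -ej opprK.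
  have := IH j js j0; rewrite -ej opprK => /(_ _) e.
  have := rbead_lt la_part j0 s0; rewrite js e ?ltxx //; lia.
have cs0 : cbead s < 0 by rewrite cbead_lt0.
have : bead (- cbead s).
  by rewrite anti ?oppr_gt0 // opprK; apply/(nbeadP la_part); exists s.
move=> /(beadP la_part)[i i0 ei].
have lt1 : cbead s < cbead j by rewrite cbead_lt.
have is_ : (i < s)%N by rewrite -(rbead_lt la_part) // -ei; lia.
have := IH i is_ i0; rewrite -ei => /(_ _) e.
have := cbead_lt la_part i0 s0; rewrite is_; have -> : cbead i = cbead s; last by rewrite ltxx.
suff : - cbead s = - cbead i by move/oppr_inj.
by apply: e; rewrite (leq_trans (ltnW is_)).
Qed.

Lemma mem_boxes i j :
  ((i, j) \in boxes la) = (0 < i)%N && (0 < j <= part la i)%N.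
Proof.
apply/allpairsPdep/andP => [[a [b []]]|[i0 /andP[j0 hj]]].
  by rewrite !mem_iota => /andP[a0 _] /andP[b0 hb] [-> ->]; split=> //; rewrite b0 /=; lia.
exists i, j; rewrite !mem_iota !add1n !ltnS i0 j0 hj /= -part_pos //.
by split=> //; lia.
Qed.

(** A hook of length k n is a bead x with a gap at x - k n. A hook of length k excludes such a gap
    for n = 1, and iterating the shift by k excludes it for all n. *)
Lemma core_bead k : (0 < k)%N -> is_core k la <-> (forall x, bead x -> bead (x - k%:Z)).
Proof.
move=> k0; split=> [/allP core x /(beadP la_part)[i i0 ->]|P1].
  apply/contraT => /(nbeadP la_part)[j j0 e].
  have ji : (j <= part la i)%N by rewrite -cbead_lt_rbead // -e; lia.
  have := core (i, j); rewrite mem_boxes i0 j0 ji => /(_ isT).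
  have := hook_beads la_part i0 j0 ji; rewrite -e opprB addrCA subrr addr0.
  by case=> ->; rewrite dvdnn.
have P1' n x : bead x -> bead (x - (k * n)%N%:Z).
  elim: n x => [|n IH] x hx; first by rewrite muln0 subr0.
  by rewrite mulnS PoszD opprD addrA; apply/IH/P1.
apply/allP => -[i j]; rewrite mem_boxes => /and3P[i0 j0 ji].
apply/negP => /dvdnP[n e]; have := hook_beads la_part i0 j0 ji; rewrite e mulnC => e'.
have : ~~ bead (cbead j) by apply/(nbeadP la_part); exists j.
have -> : cbead j = rbead i - (k * n)%N%:Z by lia.
by rewrite P1' // bead_rbead.
Qed.

Lemma sum_pos_beads (W : nat) (F : nat -> nat) : ~~ bead 0 ->
  (forall i, (0 < i)%N -> rbead i < W%:Z) ->
  (\sum_(1 <= i < (durfee la).+1) F (absz (rbead i)) = \sum_(x < W | bead x%:Z) F x)%N.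
Proof.
move=> b0 hW; rewrite -(big_mkord (fun x => bead x%:Z)) -[RHS]big_filter.
rewrite -(big_map (fun i => absz (rbead i)) predT) /=; apply: perm_big; apply: uniq_perm.
- rewrite map_inj_in_uniq ?iota_uniq // => i j; rewrite !mem_index_iota !ltnS.
  move=> /andP[i0 id] /andP[j0 jd]; rewrite -rbead_ge0 // in id; rewrite -rbead_ge0 // in jd.
  have := rbead_lt la_part i0 j0; have := rbead_lt la_part j0 i0; lia.
- by rewrite filter_uniq ?iota_uniq.
move=> x; rewrite mem_filter mem_index_iota /=; apply/mapP/andP.
  move=> [i]; rewrite mem_index_iota ltnS => /andP[i0 id] ->.
  rewrite -rbead_ge0 // in id; rewrite gez0_abs // bead_rbead //; split=> //.
  by have := hW i i0; lia.
move=> [/(beadP la_part)[i i0 e] xW]; exists i; last by rewrite -e.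
by rewrite mem_index_iota i0 ltnS -rbead_ge0 // -e.
Qed.

End BeadConditions.

Lemma sum_interval a b N : (0 < a)%N ->
  (\sum_(1 <= j < N.+1) ((a <= j) && (j <= b)))%N = ((minn b N).+1 - a)%N.
Proof.
move=> a0; elim: N => [|N IH]; first by rewrite big_geq // minn0; lia.
by rewrite big_nat_recr //= IH; lia.
Qed.

Lemma sum_bool (I : Type) (r : seq I) (P : pred I) :
  (\sum_(i <- r) (P i : nat) = \sum_(i <- r | P i) 1)%N.
Proof. by rewrite [RHS]big_mkcond; apply: eq_bigr => i _; case: (P i). Qed.

Section BeadSums.
Variable la : seq nat.
Hypothesis la_part : is_partition la.
Local Notation bead := (bead la).
Local Notation rbead := (rbead la).
Local Notation cbead := (cbead la).
Hypothesis DD : is_DD la.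

Let rc s : (0 < s)%N -> (s <= durfee la)%N -> rbead s = - cbead s.
Proof. by move: s; apply/is_DDP. Qed.

Lemma durfee_leq_size : (durfee la <= size la)%N.
Proof.
have [->//|d0] := posnP (durfee la); rewrite -part_pos //.
have := durfeeE la_part d0; rewrite leqnn => /esym h.
exact: leq_trans d0 h.
Qed.

(** The diagram is cut along the diagonal. With x = [rbead i] and i up to the Durfee size, row i has
    x + 1 boxes from the diagonal on, and by the doubled distinct condition column i has x - 1 boxes
    strictly below it. *)
Lemma psize_DD : psize la = (2 * \sum_(1 <= i < (durfee la).+1) absz (rbead i))%N.
Proof.
pose N := (size la + part la 1)%N.
have dN : ((durfee la).+1 <= N.+1)%N by rewrite ltnS (leq_trans durfee_leq_size) ?leq_addr.
have partN i : (0 < i)%N -> (part la i <= N)%N.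
  by move=> i0; rewrite (leq_trans (part_mono la_part (isT : 0 < 1)%N i0)) ?leq_addl.
have conjN i : (conjp la i <= N)%N by rewrite (leq_trans (count_size _ _)) ?leq_addr.
have e1 : psize la = (\sum_(1 <= i < N.+1) \sum_(1 <= j < N.+1) (j <= part la i))%N.
  transitivity (\sum_(1 <= i < N.+1) part la i)%N.
    rewrite /psize sumnE (big_nth 0%N) big_add1 /=.
    rewrite [RHS](big_cat_nat (n := size la)) //= ?leq_addr //.
    rewrite [X in (_ + X)%N]big1_seq ?addn0 // => i /andP[_].
    by rewrite mem_index_iota => /andP[hi _]; rewrite /part /= nth_default.
  apply: eq_big_nat => i /andP[i0 _].
  rewrite -[LHS]subn0 -[LHS]subSS -{1}(minn_idPl (partN i i0)) -(sum_interval _ _ (isT : 0 < 1)%N).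
  by apply: eq_big_nat => j /andP[j0 _]; rewrite j0.
have e2 : psize la = (\sum_(1 <= i < N.+1) (((part la i).+1 - i) + (conjp la i - i)))%N.
  rewrite e1; transitivity (\sum_(1 <= i < N.+1) \sum_(1 <= j < N.+1)
     (((i <= j) && (j <= part la i)) + ((j.+1 <= i) && (i <= conjp la j))))%N.
    apply: eq_big_nat => i /andP[i0 _]; apply: eq_big_nat => j /andP[j0 _].
    by rewrite -part_conjp //; case: (leqP i j) => _; rewrite ?addn0 ?add0n.
  under eq_bigr => i _ do rewrite big_split.
  rewrite big_split /= [X in (_ + X)%N]exchange_big_nat /= big_split /=; congr (_ + _)%N.
    apply: eq_big_nat => i /andP[i0 _].
    by rewrite sum_interval // (minn_idPl (partN i i0)).
  apply: eq_big_nat => j /andP[j0 _].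
  by rewrite sum_interval // (minn_idPl (conjN j)) subSS.
rewrite e2 [in RHS](big_nat_widen _ _ N.+1) // big_distrr /= [RHS]big_mkcond /=.
apply: eq_big_nat => i /andP[i0 _]; rewrite ltnS.
have := part_conjp la_part i0 i0; have := rc i0; rewrite durfeeE //.
by rewrite /rbead /cbead; case: leqP => h /(_ _); lia.
Qed.

(** Hook lengths in the row of x are the differences from x to the gaps below it. Since e < g <= 2x,
    the gap x - e lies above - x, which is the gap of column i, so the box is automatically to the
    right of the diagonal. *)
Lemma iota_filter_size (g : nat) x : g%:Z <= 2 * x ->
  forall i, (0 < i)%N -> x = rbead i -> (i <= durfee la)%N ->
  (\sum_(j <- iota 1 (part la i)) ((hook la (i, j) < g) && (i <= j)))%N =
  (\sum_(1 <= e < g) ~~ bead (x - e%:Z))%N.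
Proof.
move=> gx i i0 ex id.
have hk j : (0 < j)%N -> (j <= part la i)%N -> (hook la (i, j))%:Z = x - cbead j.
  by move=> j0 hj; rewrite ex; apply: hook_beads.
rewrite !sum_bool -[LHS]big_filter -[RHS]big_filter.
rewrite -[LHS](big_map (fun j => hook la (i, j)) predT (fun _ => 1%N)).
apply: perm_big; apply: uniq_perm.
- rewrite map_inj_in_uniq ?filter_uniq ?iota_uniq // => j k.
  rewrite !mem_filter !mem_iota => /andP[_ /andP[j0 hj]] /andP[_ /andP[k0 hkk]] e.
  have := hk j j0; have := hk k k0; have := cbead_lt la_part j0 k0; have := cbead_lt la_part k0 j0.
  lia.
- by rewrite filter_uniq ?iota_uniq.
move=> e; rewrite mem_filter mem_index_iota; apply/mapP/andP.
  move=> [j]; rewrite mem_filter mem_iota => /andP[/andP[hg ij] /andP[j0 hj]] ->.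
  have hj' : (j <= part la i)%N by lia.
  rewrite hk // opprB addrCA subrr addr0; split.
    by apply/(nbeadP la_part); exists j.
  by rewrite hg andbT -ltz_nat hk // subr_gt0 ex cbead_lt_rbead.
move=> [/(nbeadP la_part)[j j0 ej] /andP[e0 eg]].
have hj : (j <= part la i)%N by rewrite -cbead_lt_rbead // -ej -ex; lia.
have ehk : e = hook la (i, j) by have := hk j j0 hj; rewrite -ej; lia.
exists j => //; rewrite mem_filter mem_iota -ehk eg j0 add1n ltnS hj !andbT /=.
rewrite leqNgt -(cbead_lt la_part) // -leNgt -ej -[cbead i]opprK -rc // -ex; lia.
Qed.

(* Counts the boxes of H_+ in the row of the positive bead [x]. If [2 * x < g], every
   box of the row on or above the diagonal has hook length at most [2 * x]. *)
Definition row_weight (g : nat) (x : nat) : nat :=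
  (if 2 * x < g then x.+1 else \sum_(1 <= e < g) ~~ bead (x%:Z - e%:Z)%R)%N.

(** Only rows up to the Durfee size have boxes with i <= j; the successor in each summand accounts
    for the Durfee size itself. *)
Lemma durfee_Hplus (g : nat) :
  (durfee la + Hplus_card g la =
   \sum_(1 <= i < (durfee la).+1) (row_weight g (absz (rbead i))).+1)%N.
Proof.
rewrite /Hplus_card -sum1_count big_mkcond /= /boxes big_allpairs_dep /=.
pose rowH i := (\sum_(j <- iota 1 (part la i)) ((hook la (i, j) < g) && (i <= j)))%N.
have -> : (\sum_(i <- iota 1 (size la)) \sum_(j <- iota 1 (part la i))
    (if (hook la (i, j) < g) && (i <= j) then 1 else 0) = \sum_(1 <= i < (durfee la).+1) rowH i)%N.
  rewrite (big_nat_widen _ _ (size la).+1) ?ltnS ?durfee_leq_size // [RHS]big_mkcond /=.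
  rewrite /index_iota subSS subn0; apply: eq_big_seq => i; rewrite mem_iota => /andP[i0 _].
  rewrite ltnS durfeeE //; case: leqP => hi.
    by apply: eq_bigr => j _; case: (_ && _).
  rewrite big1_seq // => j /andP[_]; rewrite mem_iota => /andP[j0 hj].
  have -> : (i <= j)%N = false by lia.
  by rewrite andbF.
transitivity (\sum_(1 <= i < (durfee la).+1) (1 + rowH i))%N.
  by rewrite big_split sum_nat_const_nat muln1 subSS subn0.
apply: eq_big_nat => i /andP[i0]; rewrite ltnS => id; rewrite add1n; congr _.+1.
have x0 : 0 <= rbead i by rewrite rbead_ge0.
rewrite /row_weight /rowH; case: ltnP => hx; last first.
  have gx : g%:Z <= 2 * rbead i by rewrite -(gez0_abs x0) -PoszM lez_nat.
  by rewrite (iota_filter_size gx i0 erefl id) gez0_abs.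
transitivity (\sum_(1 <= j < (part la i).+1) ((i <= j) && (j <= part la i)))%N.
  rewrite /index_iota subSS subn0; apply: eq_big_seq => j; rewrite mem_iota => /andP[j0 hj].
  have hj' : (j <= part la i)%N by lia.
  rewrite hj' andbT; case: (leqP i j) => ij; last by rewrite andbF.
  have -> : (hook la (i, j) < g)%N; last by [].
  have := hook_beads la_part i0 j0 hj'.
  have : cbead i <= cbead j by rewrite leNgt cbead_lt // -leqNgt.
  have := rc i0 id; move: x0 hx; move: (hook la (i, j)) (rbead i) (cbead i) (cbead j) => a b c d; lia.
rewrite sum_interval // minnn; have := durfeeE la_part i0; rewrite id => /esym h.
by rewrite /rbead; lia.
Qed.

End BeadSums.

(** * Reconstruction of a partition from its beads *)

Lemma nth_filter_pos (l : seq nat) i : sorted geq l ->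
  nth 0%N [seq k <- l | (0 < k)%N] i = nth 0%N l i.
Proof.
elim: l i => [|p l IH] i //= hl; have hl' := path_sorted hl.
have [p0|] := posnP p; last by case: i => //= i; rewrite IH.
have /allP hall := order_path_min geq_trans hl.
have l0 j : nth 0%N (p :: l) j = 0%N.
  case: j => //= j; have [lt|ge] := ltnP j (size l); last by rewrite nth_default.
  by apply/eqP; rewrite -leqn0 -p0; apply/hall/mem_nth.
by rewrite l0 IH // -[RHS](l0 i.+1).
Qed.

Lemma filter_pos_partition (l : seq nat) : sorted geq l ->
  is_partition [seq k <- l | (0 < k)%N].
Proof.
by move=> hl; rewrite /is_partition filter_all andbT; apply: sorted_filter hl; apply: geq_trans.
Qed.

Lemma mem_rbeads la L x : is_partition la -> (size la <= L)%N ->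
  (x \in [seq rbead la i | i <- iota 1 L]) = bead la x && (- L%:Z <= x).
Proof.
move=> hla hL; apply/mapP/andP => [[i]|[/(beadP hla)[i i0 ->] ge]].
  rewrite mem_iota => /andP[i0 iL] ->; rewrite bead_rbead //; split=> //.
  by rewrite /rbead; lia.
exists i => //; rewrite mem_iota i0 add1n ltnS leqNgt; apply/negP => lt.
have := part_pos hla i0; have : (i <= size la)%N = false by lia.
by move=> ->; rewrite /rbead in ge; lia.
Qed.

Lemma rbeads_sorted la L : is_partition la -> sorted (fun x y : int => y < x) [seq rbead la i | i <- iota 1 L].
Proof.
move=> hla; rewrite sorted_map.
apply: (@sub_in_sorted _ [pred i | 0 < i]%N ltn) (iota_ltn_sorted 1 L).
  by move=> i j i0 j0 ij /=; rewrite rbead_lt.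
by apply/allP => i; rewrite mem_iota => /andP[].
Qed.

Lemma bead_inj la1 la2 : is_partition la1 -> is_partition la2 ->
  bead la1 =1 bead la2 -> la1 = la2.
Proof.
move=> h1 h2 hb; pose L := maxn (size la1) (size la2).
have gtr : transitive (fun x y : int => y < x) by move=> a b c /= ab bc; apply: lt_trans bc ab.
have girr : irreflexive (fun x y : int => y < x) by move=> a; apply: ltxx.
have e : [seq rbead la1 i | i <- iota 1 L] = [seq rbead la2 i | i <- iota 1 L].
  apply: (irr_sorted_eq gtr girr); rewrite ?rbeads_sorted // => x.
  by rewrite !mem_rbeads ?hb // ?leq_maxl ?leq_maxr.
have ep i : (0 < i)%N -> part la1 i = part la2 i.
  move=> i0; have [iL|Li] := leqP i L; last first.
    rewrite /part !nth_default // /L; lia.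
  have := congr1 (fun s => nth 0 s i.-1) e.
  rewrite !(nth_map 0%N) ?size_iota ?nth_iota; try lia.
  by rewrite add1n prednK // /rbead; lia.
have es : size la1 = size la2.
  apply/eqP; rewrite eqn_leq; apply/andP; split.
    by case s: (size la1) => [//|n]; rewrite -part_pos // -ep // part_pos // s.
  by case s: (size la2) => [//|n]; rewrite -part_pos // ep // part_pos // s.
apply: (@eq_from_nth _ 0%N) => // i _.
by have := ep i.+1 isT; rewrite /part.
Qed.

Section FromBeads.
Variables (X : int -> bool) (L : nat).
Hypothesis X_low : forall x, x < - L%:Z -> X x.
Hypothesis X_high : forall x, L%:Z <= x -> ~~ X x.

Definition window : seq int := [seq L%:Z - 1 - k%:Z | k <- iota 0 (2 * L)].

(** Charge zero: there are as many nonnegative beads as negative gaps, as for the bead set of any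
    partition. *)
Hypothesis X_charge : count X window = L.

Let s := [seq x <- window | X x].

Let s_size : size s = L. Proof. by rewrite size_filter. Qed.

Let s_sorted : sorted (fun x y : int => y < x) s.
Proof.
apply: sorted_filter; first by move=> a b c /= ab bc; apply: lt_trans bc ab.
rewrite sorted_map; apply: (@sub_sorted _ ltn); last exact: iota_ltn_sorted.
by move=> i j /= ij; lia.
Qed.

Let mem_s x : (x \in s) = X x && (- L%:Z <= x).
Proof.
rewrite mem_filter; case Xx: (X x) => //=.
have xL : x < L%:Z by rewrite ltNge; apply/negP => /X_high; rewrite Xx.
apply/mapP/idP => [[k]|ge]; first by rewrite mem_iota => ? ->; lia.
by exists (absz (L%:Z - 1 - x)%R); rewrite ?mem_iota; lia.
Qed.

Let s_step k : (k.+1 < L)%N -> nth 0 s k.+1 < nth 0 s k.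
Proof.
move=> hk; have gtr : transitive (fun x y : int => y < x) by move=> a b c /= ab bc; apply: lt_trans bc ab.
by apply: (sorted_ltn_nth gtr 0 s_sorted); rewrite ?inE ?s_size //; lia.
Qed.

(** Ensures that the parts read off below are nonnegative before [absz] is applied. The induction
    runs downwards from the last bead of the window, which is at least - L. *)
Let s_ge k : (k < L)%N -> - (k.+1)%:Z <= nth 0 s k.
Proof.
move=> kL; have [n hn] : exists n, (L = k + n.+1)%N by exists (L - k.+1)%N; lia.
elim: n k kL hn => [|n IH] k kL hn.
  have : nth 0 s k \in s by apply: mem_nth; rewrite s_size.
  by rewrite mem_s => /andP[_]; lia.
by have := IH k.+1; have := @s_step k; lia.
Qed.

Let la0 := [seq absz (nth 0 s k + (k.+1)%:Z) | k <- iota 0 L].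

Let nth_la0 k : nth 0%N la0 k = if (k < L)%N then absz (nth 0 s k + (k.+1)%:Z) else 0%N.
Proof.
case: ltnP => hk; last by rewrite nth_default // size_map size_iota.
by rewrite (nth_map 0%N) ?size_iota // nth_iota.
Qed.

Let la0_sorted : sorted geq la0.
Proof.
apply/(sortedP 0%N) => k; rewrite size_map size_iota => hk /=.
rewrite !nth_la0 hk (ltnW hk).
by have := s_step hk; have := s_ge hk; have := s_ge (ltnW hk); lia.
Qed.

Lemma partition_from_beads : exists2 la, is_partition la & bead la =1 X.
Proof.
exists [seq k <- la0 | (0 < k)%N]; first exact: filter_pos_partition.
set la := filter _ _; have hla : is_partition la by apply: filter_pos_partition.
have hp i : part la i.+1 = nth 0%N la0 i by rewrite /part /= nth_filter_pos.
have hr k : (k < L)%N -> rbead la k.+1 = nth 0 s k.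
  by move=> kL; rewrite /rbead hp nth_la0 kL; have := s_ge kL; lia.
have hr' k : (L <= k)%N -> rbead la k.+1 = - (k.+1)%:Z.
  by move=> Lk; rewrite /rbead hp nth_la0 ltnNge Lk /= sub0r.
move=> x; apply/(beadP hla)/idP => [[[//|k] _ ->]|Xx].
  have [kL|Lk] := ltnP k L; last by rewrite hr' // X_low //; lia.
  have : nth 0 s k \in s by apply: mem_nth; rewrite s_size.
  by rewrite hr // mem_s => /andP[].
have [ge|lt] := lerP (- L%:Z) x; last first.
  by exists `|x|%N; [lia|]; rewrite (_ : `|x|%N = `|x|.-1.+1) ?hr'; lia.
have xs : x \in s by rewrite mem_s Xx.
exists (index x s).+1 => //; rewrite hr ?nth_index //.
by rewrite -s_size index_mem.
Qed.

End FromBeads.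

(** Each pair x, - x with 0 < x < L contains one bead, 0 contains none, and the unpaired position -
    L is a bead because L is a gap. *)
Lemma antisym_charge (X : int -> bool) L : ~~ X 0 -> (0 < L)%N ->
  (forall x, 0 < x -> X x = ~~ X (- x)) -> ~~ X L%:Z ->
  count X (window L) = L.
Proof.
move=> X0 L0 anti XL.
have cE n : count X (window n) = (\sum_(k < 2 * n) X (n%:Z - 1 - k%:Z)%R)%N.
  by rewrite /window count_map -sum1_count -sum_bool -[in LHS](subn0 (2 * n)%N) -/(index_iota _ _) big_mkord.
have key n : count X (window n.+1) = (n + X (- n.+1%:Z)%R)%N.
  elim: n => [|n IH].
    rewrite cE 2!big_ord_recl big_ord0 addn0.
    rewrite (_ : 1%:Z - 1 - (@ord0 1)%:Z = 0) // (_ : 1%:Z - 1 - _ = - 1%:Z) //.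
    by rewrite (negPf X0).
  rewrite cE (_ : 2 * n.+2 = (2 * n.+1).+2)%N; last by lia.
  rewrite big_ord_recl big_ord_recr /=.
  have -> : (\sum_(i < 2 * n.+1) X (n.+2%:Z - 1 - (bump 0 i)%:Z)%R)%N = count X (window n.+1).
    rewrite cE; apply: eq_bigr => k _; rewrite /bump /= ; congr (nat_of_bool (X _)); lia.
  rewrite IH (_ : n.+2%:Z - 1 - 0 = n.+1%:Z); last by lia.
  rewrite (_ : n.+2%:Z - 1 - _ = - n.+2%:Z); last by rewrite /bump /=; lia.
  by rewrite anti //; case: (X (- n.+1%:Z)) => /=; lia.
by case: L L0 XL => // n _ XL; rewrite key; move: XL; rewrite anti // negbK => ->; rewrite addn1.
Qed.

(** * Doubled distinct cores *)

Section Thresholds.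
Variables (t : nat) (m : nat -> int).
Local Notation g := (2 * t + 2)%N.

(* In the residue class [c] modulo [g], the beads are the integers
   [g * q + c - (t + 1)] with [q <= thr c]. *)
Definition thr (c : nat) : int :=
  if c == 0%N then 0 else if c == t.+1 then -1
  else if (c <= t)%N then m c else - m (g - c)%N - 1.

Definition core_beads (x : int) : bool :=
  ((x + t.+1%:Z) %/ g%:Z)%Z <= thr (absz ((x + t.+1%:Z) %% g%:Z)%Z).

Lemma thr0 : thr 0 = 0. Proof. by []. Qed.
Lemma thr_half : thr t.+1 = -1. Proof. by rewrite /thr eqxx. Qed.
Lemma thr_low k : (0 < k <= t)%N -> thr k = m k.
Proof. by move=> /andP[k0 kt]; rewrite /thr kt gtn_eqF // ltn_eqF. Qed.
Lemma thr_high k : (0 < k <= t)%N -> thr (g - k) = - m k - 1.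
Proof.
move=> kt; rewrite /thr !ifF; try lia.
by rewrite subKn //; lia.
Qed.

Lemma core_beadsE (q : int) c : (c < g)%N ->
  core_beads (g%:Z * q + c%:Z - t.+1%:Z) = (q <= thr c).
Proof.
move=> hc; rewrite /core_beads subrK mulrC divzMDl; last by lia.
by rewrite modzMDl divz_small ?modz_small ?addr0 // lez_nat ltz_nat.
Qed.

Lemma residue_decomp (x : int) : exists q c, (c < g)%N /\ x = g%:Z * q + c%:Z - t.+1%:Z.
Proof.
exists ((x + t.+1%:Z) %/ g%:Z)%Z, (absz ((x + t.+1%:Z) %% g%:Z)%Z); split.
  by have := @ltz_mod (x + t.+1%:Z) g%:Z; have := @modz_ge0 (x + t.+1%:Z) g%:Z; lia.
rewrite gez0_abs; last by apply: modz_ge0; lia.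
by rewrite mulrC -divz_eq addrK.
Qed.

Lemma residue_cases c : (c < g)%N ->
  [\/ c = 0%N, c = t.+1, (0 < c <= t)%N | exists2 k, (0 < k <= t)%N & c = (g - k)%N].
Proof.
move=> hc; have [->|c0] := posnP c; first by constructor 1.
have [ct|ct|->] := ltngtP c t.+1; [constructor 3; lia| constructor 4 | by constructor 2].
by exists (g - c)%N; lia.
Qed.

Lemma core_beads_shift x : core_beads x -> core_beads (x - g%:Z).
Proof.
have [q [c [hc ->]]] := residue_decomp x; rewrite core_beadsE //.
rewrite (_ : _ - g%:Z = g%:Z * (q - 1) + c%:Z - t.+1%:Z); last by ring.
by rewrite core_beadsE //; lia.
Qed.

(** As 2(t + 1) = g, negation exchanges runners c and g - c and sends q to - q, so their thresholds
    must add up to -1. Runner t + 1 contains the gap 0; runner 0 is mapped to itself by q -> 1 -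
    q. *)
Lemma core_beads_antisym : ~~ core_beads 0 /\
  forall x, 0 < x -> core_beads x = ~~ core_beads (- x).
Proof.
split.
  rewrite (_ : 0 = g%:Z * 0 + t.+1%:Z - t.+1%:Z); last by rewrite mulr0 add0r subrr.
  by rewrite core_beadsE ?thr_half //; lia.
move=> x; have [q [c [hc ->]]] := residue_decomp x => x0; rewrite core_beadsE //.
have [ec|ec|kt|[k kt ec]] := residue_cases hc.
- rewrite (_ : - (_ - t.+1%:Z) = g%:Z * (1 - q) + 0%N%:Z - t.+1%:Z); last by rewrite ec; lia.
  by rewrite core_beadsE ?ec ?thr0; lia.
- rewrite (_ : - (_ - t.+1%:Z) = g%:Z * (- q) + t.+1%:Z - t.+1%:Z); last by rewrite ec; lia.
  rewrite core_beadsE ?ec ?thr_half; last by lia.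
  have : q != 0 by apply: contraTneq x0 => ->; rewrite ec; lia.
  by lia.
- rewrite (_ : - (_ - t.+1%:Z) = g%:Z * (- q) + (g - c)%N%:Z - t.+1%:Z); last by lia.
  by rewrite core_beadsE ?thr_high ?thr_low //; lia.
rewrite (_ : - (_ - t.+1%:Z) = g%:Z * (- q) + k%:Z - t.+1%:Z); last by rewrite ec; lia.
by rewrite core_beadsE ?ec ?thr_high ?thr_low //; lia.
Qed.

(** Closure under the shift makes each runner a half-line. The thresholds of runners 1, ..., t are
    given, antisymmetry transports them to g - k, and it forces those of runners 0 and t + 1. *)
Lemma core_beads_unique (X : int -> bool) :
  (forall x, X x -> X (x - g%:Z)) ->
  ~~ X 0 -> (forall x, 0 < x -> X x = ~~ X (- x)) ->
  (forall k q, (0 < k <= t)%N -> X (g%:Z * q + k%:Z - t.+1%:Z) = (q <= m k)) ->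
  X =1 core_beads.
Proof.
move=> sh X0 anti hk.
have anti' x : x != 0 -> X x = ~~ X (- x).
  by case: (ltgtP x 0) => // [x0|/anti//] _; rewrite (anti (- x)) ?opprK ?negbK // oppr_gt0.
have up x n : ~~ X x -> ~~ X (x + g%:Z * n%:Z).
  move=> hx; elim: n => [|n IH]; first by rewrite mulr0 addr0.
  apply: contra IH => /sh; congr (X _); lia.
move=> x; have [q [c [hc ->]]] := residue_decomp x; rewrite core_beadsE //.
have [->|->|kt|[k kt ->]] := residue_cases hc.
- rewrite thr0; have Xh : ~~ X t.+1%:Z.
    apply/negP => h; have := sh _ h; rewrite (_ : _ - g%:Z = - t.+1%:Z); last by lia.
    by move: h; rewrite anti // => /negP.
  rewrite addr0; case: lerP => hq.
    rewrite anti'; last by lia.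
    rewrite (_ : - (_ - t.+1%:Z) = t.+1%:Z + g%:Z * (absz q)%:Z); last by lia.
    by rewrite up.
  apply/negbTE; rewrite (_ : _ - _ = t.+1%:Z + g%:Z * (absz (q - 1))%:Z); last by lia.
  by rewrite up.
- rewrite thr_half addrK; case: lerP => hq.
    rewrite anti'; last by lia.
    rewrite (_ : - (g%:Z * q) = 0 + g%:Z * (absz q)%:Z); last by lia.
    by rewrite up.
  by apply/negbTE; rewrite (_ : _ * q = 0 + g%:Z * (absz q)%:Z); [rewrite up | lia].
- by rewrite thr_low // hk.
rewrite thr_high // anti'; last first.
  by apply/eqP => e; have [q0|q0] := lerP 0 q; nia.
rewrite (_ : - (_ - t.+1%:Z) = g%:Z * (- q) + k%:Z - t.+1%:Z); last by lia.
by rewrite hk //; lia.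
Qed.

End Thresholds.

Section Betas.
Variables (t : nat) (la : seq nat).
Hypothesis la_part : is_partition la.
Local Notation g := (2 * t + 2)%N.
Local Notation bead := (bead la).
Hypothesis bead_shift : forall x, bead x -> bead (x - g%:Z).

Lemma bead_shift_iter x (n : nat) : bead x -> bead (x - g%:Z * n%:Z).
Proof.
move=> hx; elim: n => [|n IH]; first by rewrite mulr0 subr0.
by have := bead_shift IH; congr (bead _); lia.
Qed.

Lemma betaE r (M : int) : (r < g)%N -> (g%:Z %| M - r%:Z)%Z -> bead M ->
  ~~ bead (M + g%:Z) -> beta g la r = g%:Z + M.
Proof.
move=> rg hM bM nM; congr (_ + _).
(* Otherwise M + g would lie below every gap and be a bead. Hence the initial value of the maximum
   in [beta] cannot exceed M, and the row of M is within its range. *)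
have Mlow : - (size la + g)%N%:Z <= M.
  rewrite leNgt; apply: contra nM => lt.
  by rewrite /bead (_ : M + g%:Z < _) ?orbT //; lia.
apply/le_anti/andP; split.
  rewrite big_seq_cond; apply: (big_ind (fun x => x <= M)) => [//|x y hx hy|j]; first by rewrite ge_max hx.
  rewrite mem_index_iota => /andP[/andP[j0 _] /eqP hj].
  rewrite leNgt; apply: contra nM => lt.
  have /dvdzP[n hn] : (g%:Z %| rbead la j - M)%Z.
    rewrite (_ : _ - M = (rbead la j - r%:Z) - (M - r%:Z)); last by ring.
    by apply: rpredB => //; apply/dvdz_mod0P.
  have n0 : 0 < n.
    have gn : 0 < n * g%:Z by rewrite -hn subr_gt0.
    by rewrite -(pmulr_lgt0 _ (_ : 0 < g%:Z)) //; lia.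
  have := bead_shift_iter (absz (n - 1)) (bead_rbead la_part j0).
  rewrite gez0_abs; last by lia.
  by congr (bead _); rewrite mulrBr mulr1 [_ * n]mulrC -hn; ring.
have [j j0 ej] := beadP la_part _ bM.
rewrite {1}ej; apply: (@le_bigmax_seq _ _ _ _ _ j (fun j => intdiv.modz ((part la j)%:Z - j%:Z - r%:Z) g%:Z == 0) (rbead la)).
  rewrite mem_index_iota j0 ltnS leqNgt; apply/negP => lt.
  have := part_pos la_part j0; have : (j <= size la)%N = false by lia.
  by move=> ->; move: Mlow; rewrite ej /rbead; lia.
by rewrite -/(rbead la j) -ej; apply/eqP/dvdz_mod0P.
Qed.

Lemma int_transition (P : int -> bool) (a b : int) :
  P a -> ~~ P b -> a <= b -> exists2 q, P q & ~~ P (q + 1).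
Proof.
move=> Pa Pb ab; have ex : exists n : nat, ~~ P (a + n%:Z).
  by exists (absz (b - a)); rewrite (_ : _ + _ = b) //; lia.
case: (ex_minnP ex) => -[|n] Pn nmin; first by rewrite addr0 Pa in Pn.
exists (a + n%:Z); last by rewrite -addrA (_ : n%:Z + 1 = n.+1%:Z) //; lia.
by apply/negPn/negP => /nmin; rewrite ltnn.
Qed.

(* The largest q such that [g * q + k - (t + 1)] is a bead, for [0 < k <= t]. *)
Definition mvec (k : nat) : int :=
  ((beta g la (k + t.+1) - t.+1%:Z - k%:Z) %/ g%:Z)%Z.

(** The positions of runner k are congruent to k + t + 1 modulo g, a residue below g for k <= t; the
    summand g of [beta] cancels the two copies of t + 1. *)
Lemma mvec_unique (k : nat) (q : int) : (0 < k <= t)%N ->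
  bead (g%:Z * q + k%:Z - t.+1%:Z) -> ~~ bead (g%:Z * (q + 1) + k%:Z - t.+1%:Z) ->
  mvec k = q.
Proof.
move=> kt h1 h2; rewrite /mvec (@betaE _ (g%:Z * q + k%:Z - t.+1%:Z)) //; first 1 last.
- lia.
- rewrite (_ : _ - _ = (q - 1) * g%:Z) ?dvdz_mull //; lia.
- by move: h2; congr (~~ bead _); ring.
rewrite (_ : _ - _ = q * g%:Z) ?mulzK //; lia.
Qed.

Lemma bead_mvec k q : (0 < k <= t)%N ->
  bead (g%:Z * q + k%:Z - t.+1%:Z) = (q <= mvec k).
Proof.
move=> kt; pose P q := bead (g%:Z * q + k%:Z - t.+1%:Z).
have low : P (- (size la)%:Z - 1).
  have := leq_pmull (size la) (_ : 0 < g)%N; rewrite addn2 => /(_ isT) h.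
  by rewrite /P /bead (_ : _ - t.+1%:Z < _) ?orbT //; lia.
have high : ~~ P (part la 1).+1%:Z.
  apply/negP => /(beadP la_part)[i i0].
  have := leq_pmull (part la 1) (_ : 0 < g)%N; rewrite addn2 => /(_ isT) h.
  by have := part_mono la_part (isT : 0 < 1)%N i0; rewrite /rbead; lia.
have ab : - (size la)%:Z - 1 <= (part la 1).+1%:Z by lia.
have [q0 h1 h2] := int_transition low high ab.
rewrite (mvec_unique kt h1 h2); case: lerP => hq.
  have := bead_shift_iter (absz (q0 - q)%R) h1; congr (bead _).
  by rewrite gez0_abs; [ring|lia].
apply/negbTE; apply: contra h2 => /(bead_shift_iter (absz (q - q0 - 1)%R)).
by congr (bead _); rewrite gez0_abs; [ring|lia].
Qed.

End Betas.

(** * Size and sign of a core *)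

Section CoreStatistics.
Variables (t : nat) (m : nat -> int).
Local Notation g := (2 * t + 2)%N.

(* Sum of [F] over the positive beads on runner k (if a > 0) or on the opposite
   runner g - k (if a < 0), when the height of runner k is [a]. *)
Definition chain (F : nat -> nat) (k : nat) (a : int) : nat :=
  match a with
  | Posz n => \sum_(q < n) F (g * q.+1 + k - t.+1)
  | Negz p => \sum_(q < p.+1) F (g * q + t.+1 - k)
  end.

(** In the coordinate u = x + t + 1 the runners are residue classes and x >= 0 becomes u >= t + 1.
    Runners 0 and t + 1 carry no bead in this range; on each pair k, g - k only one runner does,
    according to the sign of m_k. *)
Lemma sum_core_beads (F : nat -> nat) (R : nat) :
  (forall k, (0 < k <= t)%N -> absz (m k) < R)%N ->
  (\sum_(x < g * R - t.+1 | core_beads t m x%:Z) F x =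
   \sum_(k < t) chain F k.+1 (m k.+1))%N.
Proof.
move=> hR; have [R0|R0] := posnP R.
  rewrite R0 muln0 sub0n big_ord0 big1 // => k _.
  have kt : (0 < k.+1 <= t)%N by have := ltn_ord k; lia.
  by have := hR _ kt; rewrite R0 ltn0.
pose G u := (if (t.+1 <= u) && core_beads t m (u%:Z - t.+1%:Z)%R then F (u - t.+1) else 0)%N.
transitivity (\sum_(u < g * R) G u)%N.
  have hle : (t.+1 <= g * R)%N by nia.
  transitivity (\sum_(u < t.+1 + (g * R - t.+1)) G u)%N; last by rewrite subnKC.
  rewrite big_split_ord /= [X in _ = (X + _)%N]big1 ?add0n => [|i _]; last first.
    by rewrite /G leqNgt ltn_ord.
  rewrite big_mkcond /=; apply: eq_bigr => x _; rewrite /G leq_addr addKn /=.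
  by rewrite (_ : _ - _ = x%:Z) //; lia.
rewrite big_ord_mul; under eq_bigr => q _ do rewrite (big_residues t (fun c => G (g * q + c)%N)).
rewrite big_split /= [X in (X + _)%N = _]big1 ?add0n => [|q _]; last first.
  have e0 : G (g * q + 0)%N = 0%N.
    rewrite /G; case: ifP => // /andP[h1 h2]; move: h2.
    rewrite (_ : _ - _ = g%:Z * q%:Z + 0%N%:Z - t.+1%:Z); last by lia.
    by rewrite core_beadsE ?thr0; [case: (val q) h1; lia | lia].
  have e1 : G (g * q + t.+1)%N = 0%N.
    rewrite /G; case: ifP => // /andP[h1 h2]; move: h2.
    rewrite (_ : _ - _ = g%:Z * q%:Z + t.+1%:Z - t.+1%:Z); last by lia.
    by rewrite core_beadsE ?thr_half //; lia.
  by rewrite e0 e1.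
rewrite exchange_big /=; apply: eq_bigr => k _.
have kt : (0 < k.+1 <= t)%N by have := ltn_ord k; lia.
have gA q : G (g * q + k.+1)%N = if (0 < q)%N && (q%:Z <= m k.+1) then F (g * q + k.+1 - t.+1)%N else 0%N.
  rewrite /G (_ : _ - _ = g%:Z * q%:Z + k.+1%:Z - t.+1%:Z); last by lia.
  rewrite core_beadsE ?thr_low //; last by lia.
  by congr (if _ && _ then _ else _); case: q => [|q]; nia.
have gB q : G (g * q + (g - k.+1))%N = if (q%:Z <= - m k.+1 - 1) then F (g * q + t.+1 - k.+1)%N else 0%N.
  rewrite /G (_ : _ - _ = g%:Z * q%:Z + (g - k.+1)%N%:Z - t.+1%:Z); last by lia.
  rewrite core_beadsE ?thr_high //; last by lia.
  rewrite (_ : t.+1 <= _)%N /=; last by lia.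
  by congr (if _ then F _ else _); lia.
under eq_bigr => q _ do rewrite gA gB.
rewrite big_split /=; have := hR _ kt; case: (m k.+1) => [n|p] /= hn.
  rewrite [X in (_ + X)%N = _]big1 ?addn0 => [|q _]; last by rewrite ifF //; lia.
  rewrite -(big_mkord predT (fun q => if (0 < q)%N && (q%:Z <= n%:Z) then F (g * q + k.+1 - t.+1)%N else 0%N)).
  rewrite big_ltn // /= add0n big_add1 /= (@big_cat_nat _ _ _ n) //=; last by lia.
  rewrite [X in (_ + X)%N = _]big_nat [X in (_ + X)%N = _]big1 ?addn0 => [|q hq]; last by rewrite ifF //; lia.
  rewrite big_mkord; apply: eq_bigr => q _.
  by rewrite ifT //; have := ltn_ord q; lia.
rewrite [X in (X + _)%N = _]big1 ?add0n => [|q _]; last by rewrite ifF //; lia.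
rewrite -(big_mkord predT (fun q => if (q%:Z <= - Negz p - 1) then F (g * q + t.+1 - k.+1)%N else 0%N)).
rewrite (@big_cat_nat _ _ _ p.+1) //=; last exact: ltnW.
rewrite [X in (_ + X)%N = _]big_nat [X in (_ + X)%N = _]big1 ?addn0 => [|q hq]; last by rewrite ifF //; lia.
rewrite big_mkord; apply: eq_bigr => q _.
by rewrite ifT //; have := ltn_ord q; lia.
Qed.

(** The positive beads of a runner form an arithmetic progression, whose sum is the quadratic
    exponent of T in theta_k. *)
Lemma chain_id k a : (k <= t)%N -> chain id k a = eexp t k a.
Proof.
move=> kt; case: a => [n|p].
  rewrite eexp_pos /=; elim: n => [|n IH]; first by rewrite big_ord0 !muln0.
  rewrite big_ord_recr /= IH; nia.
rewrite eexp_neg // /=; elim: p => [|p IH]; first by rewrite big_ord1 muln0; nia.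
by rewrite big_ord_recr /= IH; nia.
Qed.

Lemma sum_shifted_residues (G : nat -> nat) (r a : nat) : (r < g)%N ->
  (\sum_(j < g) G (g * a + r + j) = \sum_(c < g) G (g * (a + (c < r)) + c))%N.
Proof.
move=> rg; rewrite -(big_mkord predT (fun j => G (g * a + r + j)%N)).
rewrite -(big_mkord predT (fun c => G (g * (a + (c < r)) + c)%N)) /=.
rewrite (@big_cat_nat _ _ _ (g - r)) ?leq_subr //= [RHS](@big_cat_nat _ _ _ r) ?(ltnW rg) //= addnC.
congr (_ + _)%N.
  rewrite -{1}[(g - r)%N]add0n big_addn subKn ?(ltnW rg) //.
  apply: eq_big_nat => c /andP[_ hc]; congr G; rewrite hc; lia.
rewrite -[in RHS](add0n r) big_addn !add0n; apply: eq_big_nat => c _; congr G.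
by rewrite ltnNge leq_addl; lia.
Qed.

End CoreStatistics.

Section RowWeights.
Variables (t : nat) (m : nat -> int).
Local Notation g := (2 * t + 2)%N.
Local Notation cb := (core_beads t m).

Definition absexp (k : nat) : nat := absz (bexp t k (m k)).

(** Together with e = 0, a bead, the positions form one complete residue system, and class c shows a
    gap exactly when g [thr c] + c <= v. Classes 0 and t + 1 always do. For the pair of runner l,
    with b = g m_l + l, the conditions are b <= v and - b <= v: one always holds, both when |b| <=
    v. *)
Lemma row_sum (v : nat) : cb (v%:Z + t.+1%:Z) ->
  (\sum_(1 <= e < g) ~~ cb (v%:Z + t.+1%:Z - e%:Z)%R =
   t + 2 + \sum_(l < t) (absexp l.+1 <= v))%N.
Proof.
move=> hv; have g0 : (0 < g)%N by lia.
pose G z := ~~ cb (z%:Z - t.+1%:Z).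
transitivity (\sum_(j < g) G (v.+1 + j)%N)%N.
  rewrite (reindex_inj rev_ord_inj) /=.
  rewrite -(big_mkord predT (fun j => G (v.+1 + (g - j.+1))%N : nat)) [RHS]big_ltn //.
  have -> : G (v.+1 + (g - 1))%N = false.
    by apply/negbTE; rewrite negbK -[X in is_true X]/(cb _); move: hv; congr (is_true (cb _)); lia.
  rewrite add0n; apply: eq_big_nat => e /andP[e0 eg]; rewrite /G.
  by congr (nat_of_bool (~~ cb _)); lia.
pose a := (v.+1 %/ g)%N; pose r := (v.+1 %% g)%N.
have vE : v.+1 = (g * a + r)%N by rewrite mulnC; apply: divn_eq.
have rg : (r < g)%N by rewrite ltn_mod.
rewrite vE (sum_shifted_residues (fun z => G z : nat) a rg).
have GE c : (c < g)%N -> G (g * (a + (c < r)) + c)%N = (g%:Z * thr t m c + c%:Z <= v%:Z).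
  move=> cg; rewrite /G (_ : _ - _ = g%:Z * (a + (c < r))%N%:Z + c%:Z - t.+1%:Z); last by lia.
  rewrite core_beadsE // -ltNge; move: (thr t m c) => th.
  have vE' : v%:Z = g%:Z * a%:Z + r%:Z - 1 by lia.
  rewrite vE'; apply/idP/idP => h.
    have [ta|ta] : th <= a%:Z - 1 \/ th = a%:Z /\ (c < r)%N by case: ltnP h => /= _ h; lia.
      by nia.
    by case: ta => -> cr; lia.
  rewrite ltNge; apply/negP => h2.
  by case: ltnP h2 => cr /= h2; nia.
transitivity (\sum_(c < g) (g%:Z * thr t m c + c%:Z <= v%:Z)%R)%N.
  by apply: eq_bigr => c _; rewrite GE.
rewrite (big_residues t (fun c => (g%:Z * thr t m c + c%:Z <= v%:Z)%R : nat)).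
rewrite thr0 thr_half (_ : (_ <= _) = true); last by lia.
rewrite (_ : (g%:Z * -1 + _ <= _) = true); last by lia.
transitivity (1 + 1 + \sum_(l < t) (1 + (absexp l.+1 <= v)))%N.
  congr (_ + _)%N; apply: eq_bigr => l _.
  have lt : (0 < l.+1 <= t)%N by have := ltn_ord l; lia.
  rewrite thr_low // thr_high // /absexp /bexp.
  rewrite (_ : g%:Z * (- m l.+1 - 1) + (g - l.+1)%N%:Z = - (g%:Z * m l.+1 + l.+1%:Z)); last by lia.
  move: (_ + l.+1%:Z) => b; rewrite /=; lia.
by rewrite big_split /= sum_nat_const card_ord muln1; lia.
Qed.

End RowWeights.

Lemma count_floor (g n r a : nat) : (r < g)%N ->
  (\sum_(q < n) (a <= g * q + r) = (g * n + r - a) %/ g)%N.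
Proof.
move=> rg; elim: n => [|n IH].
  by rewrite big_ord0 muln0 add0n divn_small //; apply: leq_ltn_trans (leq_subr _ _) rg.
rewrite big_ord_recr /= IH; case: leqP => h /=; last first.
  rewrite addn0 (_ : g * n + r - a = 0)%N ?div0n ?divn_small //; lia.
have -> : (g * n.+1 + r - a = g + (g * n + r - a))%N by lia.
by rewrite divnDl ?dvdnn // divnn (leq_ltn_trans _ rg) // addnC.
Qed.

Lemma diff_floor (g n r n' r' : nat) : (r < g)%N -> (r' < g)%N -> r != r' ->
  ((g * n + r - (g * n' + r')) %/ g =
   if (g * n' + r' < g * n + r) then n - n' - (r < r') else 0)%N.
Proof.
move=> rg rg' rr; case: ltnP => h; last first.
  by rewrite (_ : _ - _ = 0)%N ?div0n //; apply/eqP.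
have g0 : (0 < g)%N by lia.
case: (ltnP r r') => hr /=.
  have nn : (n' < n)%N by nia.
  have -> : (g * n + r - (g * n' + r') = (n - n' - 1) * g + (g + r - r'))%N by nia.
  by rewrite divnMDl // divn_small ?addn0 //; lia.
have nn : (n' <= n)%N by nia.
have -> : (g * n + r - (g * n' + r') = (n - n') * g + (r - r'))%N by nia.
by rewrite divnMDl // divn_small ?addn0 ?subn0 //; lia.
Qed.

Lemma diff_floor_parity (g n r n' r' : nat) : (r < g)%N -> (r' < g)%N -> r != r' ->
  odd ((g * n + r - (g * n' + r')) %/ g + (g * n' + r' - (g * n + r)) %/ g) =
  odd (n + n' + (r' < r) + (g * n' + r' < g * n + r)).
Proof.
move=> rg rg' rr; rewrite !diff_floor // 1?eq_sym //.
have nE : (g * n' + r' != g * n + r)%N.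
  apply/eqP => e; have : (n = n')%N by nia.
  by move=> en; move: e; rewrite en; lia.
case: ltngtP nE => // h _; rewrite ?add0n ?addn0.
  have [d hd] : exists d, (n = n' + (r < r') + d)%N.
    by exists (n - n' - (r < r'))%N; case: ltnP; nia.
  rewrite {1 2}hd; rewrite (_ : _ - _ - _ = d)%N; last by lia.
  have : ((r < r') + (r' < r) = 1)%N by lia.
  by rewrite !oddD; case: (r < r')%N; case: (r' < r)%N => //= _; case: (odd n'); case: (odd d).
have [d hd] : exists d, (n' = n + (r' < r) + d)%N.
  by exists (n' - n - (r' < r))%N; case: ltnP; nia.
rewrite {1 2}hd; rewrite (_ : _ - _ - _ = d)%N; last by lia.
by rewrite !oddD; case: (r' < r)%N; case: (odd n); case: (odd d).
Qed.

Section AbsExp.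
Variables (t : nat) (m : nat -> int).
Local Notation g := (2 * t + 2)%N.
Local Notation E := (absexp t m).

Lemma absexp_pos k n : m k = Posz n -> E k = (g * n + k)%N.
Proof. by rewrite /absexp /bexp => ->; lia. Qed.

Lemma absexp_neg k p : (k <= t)%N -> m k = Negz p -> E k = (g * p + (g - k))%N.
Proof. by rewrite /absexp /bexp => kt ->; rewrite NegzE; nia. Qed.

End AbsExp.

Section Sign.
Variables (t : nat) (m : nat -> int) (la : seq nat).
Local Notation g := (2 * t + 2)%N.
Local Notation cb := (core_beads t m).
Local Notation E := (absexp t m).
Hypothesis la_part : is_partition la.
Hypothesis DD : is_DD la.
Hypothesis la_cb : bead la =1 cb.

Lemma sum_beads_core (F : nat -> nat) :
  (\sum_(1 <= i < (durfee la).+1) F (absz (rbead la i)) =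
   \sum_(k < t) chain t F k.+1 (m k.+1))%N.
Proof.
pose R := (part la 1 + t.+2 + \sum_(k < t) absz (m k.+1))%N.
have hR k : (0 < k <= t)%N -> (absz (m k) < R)%N.
  move=> /andP[k0 kt]; have kt' : (k.-1 < t)%N by lia.
  rewrite /R (bigD1 (Ordinal kt')) //= prednK //; lia.
rewrite -(sum_core_beads F hR) (@sum_pos_beads la la_part (g * R - t.+1)%N F).
- by apply: eq_bigl => x; rewrite la_cb.
- by rewrite la_cb; have [] := core_beads_antisym t m.
move=> i i0; have := part_mono la_part (isT : 0 < 1)%N i0.
have : (part la 1 + t.+1 < R)%N by rewrite /R; lia.
have : (R <= g * R)%N by rewrite leq_pmull //; lia.
by rewrite /rbead; lia.
Qed.

Lemma psize_core : (psize la = 2 * \sum_(k < t) eexp t k.+1 (m k.+1))%N.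
Proof.
rewrite psize_DD // (sum_beads_core id); congr (_ * _)%N.
by apply: eq_bigr => k _; rewrite chain_id.
Qed.

Definition floor_diff k l : nat := ((E k - E l) %/ g)%N.

(** Every bead x = v + t + 1 has weight t + 3 plus a count, and the counts along a runner add up to
    a floor. For m_k < 0 the lowest bead t + 1 - k falls under the other case of [row_weight] and
    has weight t + 3 - k, hence the correction k. *)
Lemma chain_weight k : (0 < k <= t)%N ->
  (chain t (fun x => (row_weight la g x).+1) k (m k) + (if (m k < 0)%R then k else 0) =
   absz (m k) * (t + 3) + \sum_(l < t) floor_diff k l.+1)%N.
Proof.
move=> kt; have /andP[k0 kt'] := kt.
have rw v : cb (v%:Z + t.+1%:Z) -> ((row_weight la g (v + t.+1)).+1 = t + 3 + \sum_(l < t) (E l.+1 <= v))%N.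
  move=> hv; rewrite /row_weight ifF; last by lia.
  transitivity (\sum_(1 <= e < g) ~~ cb (v%:Z + t.+1%:Z - e%:Z)%R).+1.
    by congr _.+1; apply: eq_bigr => e _; rewrite la_cb PoszD.
  by rewrite row_sum //; lia.
case mk: (m k) => [n|p] /=.
  rewrite addn0; transitivity (\sum_(q < n) (t + 3 + \sum_(l < t) (E l.+1 <= g * q + k)))%N.
    apply: eq_bigr => q _; have -> : (g * q.+1 + k - t.+1 = g * q + k + t.+1)%N by lia.
    apply: rw; rewrite (_ : _ + _ = g%:Z * (q.+1)%:Z + k%:Z - t.+1%:Z); last by lia.
    by rewrite core_beadsE ?thr_low // ?mk; have := ltn_ord q; lia.
  rewrite big_split sum_nat_const card_ord /= exchange_big /=; congr (_ + _)%N.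
  by apply: eq_bigr => l _; rewrite count_floor /floor_diff ?(absexp_pos t mk) //; lia.
rewrite big_ord_recl /= muln0 add0n.
have -> : (row_weight la g (t.+1 - k)).+1 = (t + 3 - k)%N.
  by rewrite /row_weight ifT; lia.
transitivity (t + 3 - k + \sum_(q < p) (t + 3 + \sum_(l < t) (E l.+1 <= g * q + (g - k))) + k)%N.
  congr (_ + _ + _)%N; apply: eq_bigr => q _; rewrite /bump /= add1n.
  have -> : (g * q.+1 + t.+1 - k = g * q + (g - k) + t.+1)%N by lia.
  apply: rw; rewrite (_ : _ + _ = g%:Z * (q.+1)%:Z + (g - k)%N%:Z - t.+1%:Z); last by lia.
  rewrite core_beadsE ?thr_high // ?mk; last by lia.
  by rewrite NegzE; have := ltn_ord q; lia.
rewrite big_split sum_nat_const card_ord /= exchange_big /=.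
have -> : (\sum_(l < t) \sum_(q < p) (E l.+1 <= g * q + (g - k)) = \sum_(l < t) floor_diff k l.+1)%N.
  by apply: eq_bigr => l _; rewrite count_floor /floor_diff ?(absexp_neg kt' mk) //; lia.
rewrite mulSn; move: (\sum_(l < t) _)%N (p * (t + 3))%N => S P; lia.
Qed.

(** Write E = g n + r. Because k < l < g - l < g - k, the residue of l is the smaller one exactly
    when m_k < 0. As n is |m|, or |m| - 1 for negative m, the sign of m_k cancels and that of m_l
    remains. *)
Lemma floor_diff_parity k l : (0 < k)%N -> (k < l)%N -> (l <= t)%N ->
  odd (floor_diff k l + floor_diff l k) =
  odd (absz (m k) + absz (m l) + (m l < 0)%R + (E l < E k)%N).
Proof.
move=> k0 kl lt; rewrite /floor_diff.
have kt : (k <= t)%N by lia.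
case mk: (m k) => [n|p]; case ml: (m l) => [n'|p'];
  rewrite ?(absexp_pos t mk) ?(absexp_neg kt mk) ?(absexp_pos t ml) ?(absexp_neg lt ml);
  (rewrite diff_floor_parity; [|lia|lia|lia]); rewrite !oddD.
- by have -> : (l < k)%N = false by lia.
- have -> : (g - l < k)%N = false by lia.
  by rewrite /=; do 3!case: (odd _).
- have -> : (l < g - k)%N by lia.
  by rewrite /=; do 3!case: (odd _).
have -> : (g - l < g - k)%N by lia.
by rewrite /=; do 3!case: (odd _).
Qed.

(** Up to even powers, [s i] occurs t + 3 times from the rows and t - 1 times from the pairs, so it
    disappears. [b i] occurs i + 1 times from the rows and i times from the pairs with a smaller
    index, so it survives once. *)
Lemma sign_core (R : comNzRingType) :
  (-1) ^+ (durfee la + Hplus_card g la) =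
  \prod_(i < t) (-1) ^+ (m i.+1 < 0)%R *
  \prod_(i < t) \prod_(j < t | (i < j)%N) (-1) ^+ (E j.+1 < E i.+1)%N :> R.
Proof.
pose s (i : 'I_t) : R := (-1) ^+ absz (m i.+1).
pose b (i : 'I_t) : R := (-1) ^+ (m i.+1 < 0)%R.
pose e (i j : 'I_t) : R := (-1) ^+ (E j.+1 < E i.+1)%N.
have sgn2 n : ((-1) ^+ n * (-1) ^+ n : R) = 1 by rewrite -exprMn mulrNN mulr1 expr1n.
rewrite durfee_Hplus // (sum_beads_core (fun x => (row_weight la g x).+1)) expr_sum.
transitivity (\prod_(i < t) (s i ^+ (t + 3) * b i ^+ i.+1) *
   \prod_(i < t) \prod_(j < t) (-1) ^+ floor_diff i.+1 j.+1 : R).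
  rewrite -big_split; apply: eq_bigr => k _ /=.
  have kt : (0 < k.+1 <= t)%N by have := ltn_ord k; lia.
  have h := congr1 (fun n => (-1) ^+ n * b k ^+ k.+1 : R) (chain_weight kt).
  rewrite exprD [in RHS]exprD expr_sum exprM -/(s k) in h.
  transitivity ((-1) ^+ chain t (fun x => (row_weight la g x).+1) k.+1 (m k.+1) *
     (-1) ^+ (if (m k.+1 < 0)%R then k.+1 else 0%N) * b k ^+ k.+1 : R).
    rewrite -mulrA /b; case: (m k.+1 < 0)%R; rewrite ?expr0 ?expr1n ?mulr1 // expr1.
    by rewrite sgn2 mulr1.
  by rewrite h mulrAC.
rewrite big_all_pairs /= [X in _ * (_ * X)]big1 ?mulr1 => [|i _]; last first.
  by rewrite /floor_diff subnn div0n.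
have -> : \prod_(i < t) \prod_(j < t | (i < j)%N)
     ((-1) ^+ floor_diff i.+1 j.+1 * (-1) ^+ floor_diff j.+1 i.+1) =
  \prod_(i < t) \prod_(j < t | (i < j)%N) (s i * s j) *
  (\prod_(i < t) \prod_(j < t | (i < j)%N) b j) *
  \prod_(i < t) \prod_(j < t | (i < j)%N) e i j :> R.
  rewrite -!big_split; apply: eq_bigr => i _ /=; rewrite -!big_split; apply: eq_bigr => j ij /=.
  rewrite -exprD -signr_odd (@floor_diff_parity i.+1 j.+1 isT ij (ltn_ord j)).
  by rewrite signr_odd !exprD.
have -> : \prod_(i < t) \prod_(j < t | (i < j)%N) (s i * s j) = \prod_(i < t) s i ^+ t.+1.
  under eq_bigr do rewrite big_split.
  rewrite big_split /= [X in _ * X](exchange_big_dep predT) //= -big_split /=.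
  apply: eq_bigr => i _; rewrite exprS.
  have -> : s i ^+ t = \prod_(j < t) s i by rewrite prodr_const card_ord.
  rewrite [\prod_(j < t) s i](bigID (fun j : 'I_t => (i < j)%N)) /= mulrCA; congr (_ * _).
  rewrite [in RHS](bigID (fun j : 'I_t => (j < i)%N)) /= mulrCA.
  rewrite [X in _ = _ * (_ * X)](big_pred1 i) => [|j /=]; last first.
    by rewrite -val_eqE /=; case: ltngtP.
  by rewrite sgn2 mulr1; apply: eq_bigl => j; case: ltngtP.
have -> : \prod_(i < t) \prod_(j < t | (i < j)%N) b j = \prod_(j < t) b j ^+ j.
  rewrite (exchange_big_dep predT) //=; apply: eq_bigr => j _.
  rewrite -(big_ord_widen t (fun _ => b j)) ?prodr_const ?card_ord //; exact/ltnW/ltn_ord.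
rewrite !mulrA; congr (_ * _); rewrite -!big_split /=; apply: eq_bigr => i _.
have s2 : s i ^+ 2 = 1 by rewrite expr2 sgn2.
have b2 : b i ^+ 2 = 1 by rewrite expr2 sgn2.
rewrite -/(b i).
move: (s i) (b i) s2 b2 => S B s2 b2.
transitivity ((S ^+ 2) ^+ t.+2 * ((B ^+ 2) ^+ i * B)).
  rewrite -!exprM -exprSr.
  transitivity (S ^+ (t + 3 + t.+1) * B ^+ (i.+1 + i)); last by congr (_ ^+ _ * _ ^+ _); lia.
  by rewrite [S ^+ (t + 3 + _)]exprD [B ^+ (_ + _)]exprD; ring.
by rewrite s2 b2 !expr1n !mul1r.
Qed.

End Sign.

Lemma altdet_perm (K : fieldType) t (x : 'I_t -> K) (e : 'I_t -> int) (s : 'S_t) :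
  altdet x (fun i => e (s i)) = (-1) ^+ s * altdet x e.
Proof.
rewrite /altdet -det_perm -det_mulmx -row_permE; congr (\det _).
by apply/matrixP => i j; rewrite !mxE.
Qed.

Lemma altdet_abs (K : fieldType) t (x : 'I_t -> K) (b : 'I_t -> int) :
  altdet x b = \prod_(i < t) (-1) ^+ (b i < 0)%R * altdet x (fun i => (absz (b i))%:Z).
Proof.
have -> : \prod_(i < t) (-1) ^+ (b i < 0)%R = \det (diag_mx (\row_(i < t) (-1) ^+ (b i < 0)%R)) :> K.
  by rewrite det_diag; apply: eq_bigr => i _; rewrite mxE.
rewrite /altdet -det_mulmx; congr (\det _); apply/matrixP => i j.
rewrite mul_diag_mx !mxE; case: (b i) => n /=; first by rewrite expr0 mul1r.
by rewrite NegzE expr1 opprK mulN1r opprB.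
Qed.

(** Permuting columns multiplies the Vandermonde determinant of [a] by the sign of [s], and the
    sorted one is positive; comparison of signs over the integers gives the product over
    inversions. *)
Lemma prod_inversions (R : comNzRingType) n (a : 'I_n -> int) (s : 'S_n) :
  (forall i j : 'I_n, (i < j)%N -> a (s i) < a (s j)) ->
  \prod_(i < n) \prod_(j < n | (i < j)%N) (-1) ^+ (a j < a i)%R = (-1) ^+ s :> R.
Proof.
move=> hs.
have ainj i j : a i = a j -> i = j.
  move=> aij; apply/eqP; rewrite -(inj_eq (@perm_inj _ s^-1)); apply/eqP/val_inj.
  have hi := permKV s i; have hj := permKV s j.
  case: (ltngtP ((s^-1)%g i) ((s^-1)%g j)) => // h; have := hs _ _ h;
    by rewrite hi hj aij ltxx.
suff e : \prod_(i < n) \prod_(j < n | (i < j)%N) (-1) ^+ (a j < a i)%R = (-1) ^+ s :> int.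
  have := congr1 (fun z : int => z%:~R : R) e; rewrite rmorph_sign => <-.
  rewrite rmorph_prod; apply: eq_bigr => i _; rewrite rmorph_prod; apply: eq_bigr => j _.
  by rewrite rmorph_sign.
pose V := Vandermonde n (\row_(j < n) a j).
have dV : \det (col_perm s V) = (-1) ^+ s * \det V.
  by rewrite col_permE det_mulmx det_perm mulrC odd_permV.
have eV : col_perm s V = Vandermonde n (\row_(j < n) a (s j)).
  by apply/matrixP => i j; rewrite !mxE.
rewrite eV !det_Vandermonde in dV.
have sgz_prod := big_morph (fun z : int => sgz z) (@sgzM _) (@sgz1 _).
have := congr1 (fun z : int => sgz z) dV; rewrite sgzM !sgz_prod.
have -> : \prod_(i < n) sgz (\prod_(j < n | (i < j)%N)
    ((\row_(j0 < n) a (s j0)) 0 j - (\row_(j0 < n) a (s j0)) 0 i)) = 1.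
  rewrite big1 // => i _; rewrite sgz_prod big1 // => j ij /=.
  by rewrite !mxE gtr0_sgz // subr_gt0 hs.
have -> : \prod_(i < n) sgz (\prod_(j < n | (i < j)%N) ((\row_(j0 < n) a j0) 0 j - (\row_(j0 < n) a j0) 0 i)) =
  \prod_(i < n) \prod_(j < n | (i < j)%N) (-1) ^+ (a j < a i)%R.
  apply: eq_bigr => i _; rewrite sgz_prod; apply: eq_bigr => j ij /=.
  rewrite !mxE; case: ltgtP => h.
  - by rewrite ltr0_sgz // subr_lt0.
  - by rewrite gtr0_sgz // subr_gt0.
  by move/ainj: h ij => ->; rewrite ltnn.
have -> : sgz ((-1) ^+ s : int) = (-1) ^+ s by case: (odd_perm s).
move/(congr1 (fun z => (-1) ^+ s * z)); rewrite mulr1 mulrA -expr2 -exprM mulnC exprM sqrrN !expr1n mul1r.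
by move=> <-.
Qed.

(** * The coding of a core *)

Section Coding.
Variables (t : nat) (m : nat -> int) (la : seq nat).
Local Notation g := (2 * t + 2)%N.
Local Notation E := (absexp t m).
Hypothesis la_part : is_partition la.
Hypothesis la_cb : bead la =1 core_beads t m.

(** The highest bead of runner c, plus g. *)
Let fb (c : nat) : int := g%:Z * thr t m c + c%:Z + t.+1%:Z.

Lemma beta_core r c (q : int) : (r < g)%N -> (c < g)%N -> r%:Z + t.+1%:Z = c%:Z + g%:Z * q ->
  beta g la r = fb c.
Proof.
move=> rg cg e; rewrite (@betaE t la la_part _ r (g%:Z * thr t m c + c%:Z - t.+1%:Z)) //.
- by rewrite /fb; lia.
- by move=> x; rewrite !la_cb; apply: core_beads_shift.
- rewrite (_ : _ - r%:Z = (thr t m c - q) * g%:Z) ?dvdz_mull //; lia.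
- by rewrite la_cb core_beadsE.
rewrite la_cb (_ : _ + g%:Z = g%:Z * (thr t m c + 1) + c%:Z - t.+1%:Z); last by ring.
by rewrite core_beadsE //; lia.
Qed.

Definition big_betas : seq int := [seq (E k)%:Z + t.+1%:Z | k <- iota 1 t].
Definition small_betas : seq int :=
  t.+1%:Z :: 0 :: [seq t.+1%:Z - (E k)%:Z | k <- iota 1 t].

(** With b = g m_k + k, runners k and g - k have the values t + 1 + b and t + 1 - b, one in each
    list; runners 0 and t + 1 have t + 1 and 0. *)
Lemma betas_perm : perm_eq (betas g la) (big_betas ++ small_betas).
Proof.
have e1 : betas g la = [seq fb c | c <- iota t.+1 t.+1 ++ iota 0 t.+1].
  rewrite /betas (_ : g = t.+1 + t.+1)%N; last by lia.
  have eI : iota t.+1 t.+1 = map (addn t.+1) (iota 0 t.+1) by rewrite -iotaDl addn0.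
  rewrite iotaD !map_cat add0n eI -!map_comp; congr (_ ++ _).
    apply/eq_in_map => r.
    rewrite mem_iota => hr /=.
    by rewrite -(@beta_core r (t.+1 + r) 0); [congr beta; lia|lia|lia|lia].
  apply/eq_in_map => r.
  rewrite mem_iota => hr /=.
  by rewrite -(@beta_core (t.+1 + r) r 1); [congr beta; lia|lia|lia|lia].
apply: (@perm_trans _ [seq fb c | c <- iota 0 g]).
  rewrite e1 (_ : g = t.+1 + t.+1)%N; last by lia.
  by rewrite iotaD !map_cat add0n perm_catC.
apply/seq.permP => p; rewrite count_cat /= !count_map.
have cE n (q : pred nat) : count q (iota 0 n) = (\sum_(c < n) q c)%N.
  by rewrite -sum1_count -sum_bool -[in LHS](subn0 n) -/(index_iota 0 n) big_mkord.
have cE1 n (q : pred nat) : count q (iota 1 n) = (\sum_(c < n) q c.+1)%N.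
  by rewrite -[1%N]addn0 iotaDl count_map cE.
rewrite cE !cE1 (big_residues t (fun c => p (fb c) : nat)) /=.
have -> : fb 0 = t.+1%:Z by rewrite /fb thr0; lia.
have -> : fb t.+1 = 0 by rewrite /fb thr_half; lia.
have -> : (\sum_(k < t) (p (fb k.+1) + p (fb (g - k.+1))) =
   \sum_(c < t) p ((E c.+1)%:Z + t.+1%:Z)%R + \sum_(c < t) p (t.+1%:Z - (E c.+1)%:Z)%R)%N.
  rewrite -big_split; apply: eq_bigr => k _ /=.
  have kt : (0 < k.+1 <= t)%N by have := ltn_ord k; lia.
  rewrite /fb thr_low // thr_high // /absexp /bexp.
  have -> : g%:Z * (- m k.+1 - 1) + (g - k.+1)%N%:Z = - (g%:Z * m k.+1 + k.+1%:Z) by lia.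
  move: (_ + k.+1%:Z) => b; case: b => n /=; first by rewrite addrC [- _ + _]addrC.
  by rewrite NegzE opprK [- _ + _]addrC addnC.
by rewrite addnC -!addnA; congr (_ + _)%N; rewrite addnC -addnA.
Qed.

Let geT := (fun a b : int => (b <= a)%R).
Let geT_trans : transitive geT. Proof. by move=> a b c h1 h2; apply: le_trans h2 h1. Qed.
Let geT_total : total geT. Proof. by move=> a b; apply: le_total. Qed.
Let geT_anti : antisymmetric geT. Proof. by move=> a b /andP[h1 h2]; apply/le_anti/andP. Qed.

Lemma Vcoding_core : Vcoding g t la = sort geT big_betas.
Proof.
have -> : sort geT big_betas = take t (sort geT big_betas ++ sort geT small_betas).
  by rewrite take_size_cat // size_sort size_map size_iota.
congr (take t _); apply: (sorted_eq geT_trans geT_anti).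
- exact: sort_sorted.
- rewrite sorted_pairwise // pairwise_cat -!sorted_pairwise // !sort_sorted // !andbT.
  apply/allrelP => x y; rewrite !mem_sort => /mapP[k hk ->] hy; rewrite /geT.
  have : y <= t.+1%:Z.
    by move: hy; rewrite !inE => /or3P[/eqP->|/eqP->|/mapP[l _ ->]]; lia.
  by lia.
by rewrite perm_sort (permPl betas_perm) perm_cat // perm_sym perm_sort.
Qed.

End Coding.

Section CoreTerm.
Variables (t : nat) (m : nat -> int) (la : seq nat).
Local Notation g := (2 * t + 2)%N.
Local Notation E := (absexp t m).
Hypothesis la_part : is_partition la.
Hypothesis DD : is_DD la.
Hypothesis la_cb : bead la =1 core_beads t m.

Lemma absexp_residue k : (0 < k <= t)%N ->
  exists n r, [/\ E k = (g * n + r)%N, (r < g)%N & r = k \/ r = (g - k)%N].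
Proof.
move=> /andP[k0 kt]; case mk: (m k) => [n|p].
  by exists n, k; rewrite (absexp_pos t mk); split; [|lia|left].
by exists p, (g - k)%N; rewrite (absexp_neg kt mk); split; [|lia|right].
Qed.

Lemma absexp_inj k l : (0 < k <= t)%N -> (0 < l <= t)%N -> E k = E l -> k = l.
Proof.
move=> kt lt; have [n [r [-> rg hr]]] := absexp_residue kt.
have [n' [r' [-> rg' hr']]] := absexp_residue lt.
move=> /(congr1 (modn^~ g)); rewrite ![(g * _)%N]mulnC !modnMDl !modn_small //.
by case: hr hr' => -> [] ->; lia.
Qed.

(** The shifted parts of mu are the [E k] in decreasing order. Both determinants are thus signed
    copies of the one with rows |g m_k + k|, and [sign_core] matches the signs. *)
Lemma core_term (K : fieldType) (x : 'I_t -> K) :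
  (-1) ^+ (durfee la + Hplus_card g la) *
    altdet x (fun i => mu_of la i + (t - i)%N%:Z) =
  altdet x (fun i => bexp t (t - i) (m (t - i)%N)).
Proof.
pose a (i : 'I_t) := (E i.+1)%:Z.
pose A := [tuple a i + t.+1%:Z | i < t].
have AE : tval A = big_betas t m.
  rewrite /A /= /big_betas -[1%N]addn0 iotaDl -map_comp -val_enum_ord -map_comp.
  by apply: eq_map => i; rewrite /a /=.
have pA : perm_eq (Vcoding g t la) A.
  by rewrite (Vcoding_core la_part la_cb) AE perm_sort.
have [s hs] := tuple_permP pA.
have nthV (i : 'I_t) : nth 0 (Vcoding g t la) i = a (s i) + t.+1%:Z.
  by rewrite hs -tnth_nth !tnth_mktuple.
have muE (i : 'I_t) : mu_of la i + (t - i)%N%:Z = a (s i).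
  by rewrite /mu_of nthV; have := ltn_ord i; lia.
have sdec (i j : 'I_t) : (i < j)%N -> a (s j) < a (s i).
  move=> ij; rewrite lt_neqAle; apply/andP; split.
    apply/eqP => /eqP; rewrite eqz_nat => /eqP e.
    have := absexp_inj _ _ e; rewrite !ltn_ord => /(_ isT isT) [] /val_inj /perm_inj e'.
    by rewrite e' ltnn in ij.
  have gtr : transitive (fun a b : int => (b <= a)%R) by move=> x1 y1 z1 h1 h2; apply: le_trans h2 h1.
  have sV : sorted (fun a b : int => (b <= a)%R) (Vcoding g t la).
    by rewrite (Vcoding_core la_part la_cb); apply: sort_sorted => x1 y1; apply: le_total.
  have szV : size (Vcoding g t la) = t by rewrite (perm_size pA) size_tuple.
  have := sorted_ltn_nth gtr 0 sV; move/(_ i j); rewrite !inE szV !ltn_ord => /(_ isT isT ij).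
  by rewrite !nthV lerD2r.
(* [s] sorts decreasingly whereas [prod_inversions] needs increasing order; the same reversal occurs
   in the index t - i on the right-hand side. *)
pose rp := perm (@rev_ord_inj t).
have inc (i j : 'I_t) : (i < j)%N -> a ((rp * s)%g i) < a ((rp * s)%g j).
  by move=> ij; rewrite !permM !permE; apply: sdec => /=; have := ltn_ord j; lia.
have -> : altdet x (fun i => mu_of la i + (t - i)%N%:Z) = altdet x (fun i => a (s i)).
  by congr (\det _); apply/matrixP => i j; rewrite !mxE muE.
have -> : altdet x (fun i => bexp t (t - i) (m (t - i)%N)) =
    altdet x (fun i => bexp t (rp i).+1 (m (rp i).+1)).
  by congr (\det _); apply/matrixP => i j; rewrite !mxE permE /= subnSK.
rewrite (altdet_perm x a) (altdet_perm x (fun i : 'I_t => bexp t i.+1 (m i.+1))).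
rewrite (altdet_abs x (fun i : 'I_t => bexp t i.+1 (m i.+1))) -/a.
rewrite (sign_core la_part DD la_cb).
have -> : \prod_(i < t) \prod_(j < t | (i < j)%N) (-1) ^+ (E j.+1 < E i.+1)%N =
   (-1) ^+ (rp * s)%g :> K.
  rewrite -(prod_inversions K inc); apply: eq_bigr => i _; apply: eq_bigr => j _.
  by rewrite /a ltz_nat.
have -> : \prod_(i < t) (-1) ^+ (bexp t i.+1 (m i.+1) < 0)%R =
   \prod_(i < t) (-1) ^+ (m i.+1 < 0)%R :> K.
  apply: eq_bigr => i _; congr (_ ^+ nat_of_bool _); rewrite /bexp.
  have := ltn_ord i; case: (m i.+1) => p; [lia | rewrite NegzE; nia].
rewrite odd_permM signr_addb.
have : (-1) ^+ s * (-1) ^+ s = 1 :> K by rewrite -signr_addb addbb.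
move: (altdet x _) (\prod_(i < t) _) ((-1) ^+ s : K) ((-1) ^+ rp : K) => D P S R s2.
by rewrite -mulrA -[R * S * _]mulrA [S * (S * D)]mulrA s2 mul1r mulrCA.
Qed.

End CoreTerm.

Lemma core_exists t (m : nat -> int) :
  exists la, [/\ is_partition la, is_DD la, is_core (2 * t + 2) la &
    bead la =1 core_beads t m].
Proof.
set g := (2 * t + 2)%N; pose B := (\sum_(k < t) absz (m k.+1))%N.
have mB k : (0 < k <= t)%N -> (absz (m k) <= B)%N.
  move=> /andP[k0 kt]; have kt' : (k.-1 < t)%N by lia.
  by rewrite /B (bigD1 (Ordinal kt')) //= prednK //; lia.
have thrB c : (c < g)%N -> - B%:Z - 1 <= thr t m c <= B%:Z.
  move=> cg; have [->|->|kt|[k kt ->]] := residue_cases cg.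
  - by rewrite thr0; lia.
  - by rewrite thr_half; lia.
  - by rewrite thr_low //; have := mB _ kt; lia.
  by rewrite thr_high //; have := mB _ kt; lia.
pose L := (g * (B + 2))%N.
have low x : x < - L%:Z -> core_beads t m x.
  have [q [c [cg ->]]] := residue_decomp t x => h; rewrite core_beadsE //.
  by have := thrB c cg; rewrite /L in h; nia.
have high x : L%:Z <= x -> ~~ core_beads t m x.
  have [q [c [cg ->]]] := residue_decomp t x => h; rewrite core_beadsE // -ltNge.
  by have := thrB c cg; rewrite /L in h; nia.
have [cb0 anti] := core_beads_antisym t m.
have L0 : (0 < L)%N by rewrite /L /g; lia.
have [la hla hb] := partition_from_beads low high (antisym_charge cb0 L0 anti (high _ (lexx _))).
exists la; split => //.
  by apply/(DD_bead_antisym hla); split=> [|x x0]; rewrite ?hb // anti.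
have g0 : (0 < g)%N by rewrite /g addn2.
by apply/(core_bead hla g0) => x; rewrite !hb; apply: core_beads_shift.
Qed.

(** * Comparison of coefficients *)

Section Encoding.
Variable M : nat.
Implicit Types (f : {ffun 'I_M -> 'I_M.+1}) (la : seq nat).

Lemma nth_ffun_part f (i : 'I_M) : enc_ok f -> nth 0%N (ffun_part f) i = f i.
Proof.
move=> hf; rewrite /ffun_part nth_filter_pos //.
by rewrite (nth_map i) ?size_enum_ord // nth_ord_enum.
Qed.

Lemma ffun_part_inj f1 f2 : enc_ok f1 -> enc_ok f2 ->
  ffun_part f1 = ffun_part f2 -> f1 = f2.
Proof.
move=> h1 h2 e; apply/ffunP => i; apply: val_inj.
by rewrite /= -!nth_ffun_part // e.
Qed.

Lemma encode_partition la : is_partition la -> (psize la <= M)%N ->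
  exists2 f : {ffun 'I_M -> 'I_M.+1}, enc_ok f & ffun_part f = la.
Proof.
move=> hla hM; have /andP[la_sorted /allP la_pos] := hla.
have szM : (size la <= M)%N.
  apply: leq_trans hM; rewrite /psize; elim: la la_pos {hla la_sorted} => //= p l IH h.
  have p0 := h p (mem_head _ _); have := IH (fun q hq => h q (@mem_behead _ (p :: l) q hq)); lia.
have nthM i : (nth 0%N la i < M.+1)%N.
  rewrite ltnS; have [lt|ge] := ltnP i (size la); last by rewrite nth_default.
  apply: leq_trans hM; rewrite /psize sumnE (big_nth 0%N) big_mkord.
  by rewrite (bigD1 (Ordinal lt)) //= leq_addr.
pose f : {ffun 'I_M -> 'I_M.+1} := [ffun i : 'I_M => inord (nth 0%N la i)].
have fE : [seq val (f i) | i <- enum 'I_M] = la ++ nseq (M - size la) 0%N.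
  apply: (@eq_from_nth _ 0%N).
    by rewrite size_map size_enum_ord size_cat size_nseq subnKC.
  move=> i; rewrite size_map size_enum_ord => iM.
  rewrite (nth_map (Ordinal iM)) ?size_enum_ord // ffunE /= inordK //.
  rewrite (nth_enum_ord _ iM) nth_cat; case: ltnP => // ge.
  by rewrite nth_nseq nth_default //; case: ifP.
exists f; rewrite /enc_ok /ffun_part fE; last first.
  rewrite filter_cat (all_filterP _); last by case/andP: hla.
  by rewrite filter_nseq cats0.
rewrite (sorted_pairwise geq_trans) pairwise_cat -!(sorted_pairwise geq_trans) la_sorted /=.
apply/andP; split; last by elim: (M - _)%N => // -[|n] //= ->.
by apply/allrelP => x y _ /nseqP[-> _].
Qed.

End Encoding.

Definition boxinv Q (z : int) : bool * 'I_Q.+1 :=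
  match z with Posz q => (true, inord q) | Negz q => (false, inord q) end.

(** An index m is bounded by its exponent [eexp], so a coefficient of degree n involves only
    integers inside the box. *)
Lemma boxinvK t k n (z : int) : (k <= t)%N -> (eexp t k z <= n)%N ->
  boxv (boxinv n z) = z.
Proof.
move=> kt; case: z => q h; rewrite /boxv /= inordK // ltnS; apply: leq_trans h.
  exact: leq_eexp_pos.
exact/ltnW/leq_eexp_neg.
Qed.

Lemma boxv_inj Q : injective (@boxv Q).
Proof. by move=> [[] a] [[] b] //= [] /val_inj ->. Qed.

Lemma core_beads_ext t (m m' : nat -> int) :
  (forall k, (0 < k <= t)%N -> m k = m' k) -> core_beads t m =1 core_beads t m'.
Proof.
move=> h x; rewrite /core_beads; congr (_ <= _); rewrite /thr.
set c := absz _; case: eqP => // c0; case: eqP => // c1.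
have cg : (c < 2 * t + 2)%N.
  rewrite /c; have := @ltz_pmod (x + t.+1%:Z) (2 * t + 2)%N%:Z.
  by have := @modz_ge0 (x + t.+1%:Z) (2 * t + 2)%N%:Z; lia.
by case: leqP => ct; rewrite h //; lia.
Qed.

Section DDCore.
Variables (t : nat) (la : seq nat).
Hypothesis la_part : is_partition la.

Lemma core_beads_mvec : is_DD la -> is_core (2 * t + 2) la ->
  bead la =1 core_beads t (mvec t la).
Proof.
move=> DD core; have g0 : (0 < 2 * t + 2)%N by rewrite addn2.
have sh := (core_bead la_part g0).1 core.
have [b0 anti] := (DD_bead_antisym la_part).1 DD.
by apply: core_beads_unique => // k q; apply: bead_mvec.
Qed.

Lemma mvec_core_beads m k : bead la =1 core_beads t m -> (0 < k <= t)%N ->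
  mvec t la k = m k.
Proof.
move=> hb kt; have kg : (k < 2 * t + 2)%N by lia.
apply: mvec_unique => //.
- by move=> x; rewrite !hb; apply: core_beads_shift.
- by rewrite hb core_beadsE // thr_low.
by rewrite hb core_beadsE // thr_low //; lia.
Qed.

End DDCore.

Lemma sum_eexp_rev t (m : nat -> int) :
  (\sum_(k < t) eexp t k.+1 (m k.+1) = \sum_(i < t) eexp t (t - i) (m (t - i)%N))%N.
Proof.
by rewrite (reindex_inj rev_ord_inj); apply: eq_bigr => i _; rewrite /= subnSK.
Qed.

(* Identity of power series in T: equality of every coefficient of T^n.
   Factors 1 - y T^k with k > n do not affect the coefficient of T^n. *)
Theorem theorem1p1 (t : nat) (ht : (1 <= t)%N) :
  forall n : nat, LHS_coef t n = (RHS_trunc t n)`_n.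
Proof.
(* The Weyl denominator is the common denominator of all the [sp]; multiplying by it leaves
   alternating determinants on both sides, matched by the bijection [Phi]. *)
move=> n; apply: (mulfI (weyl_den_xvar_neq0 t)); rewrite macdonald_generic.
pose M := (2 * n + 1)%N.
pose A : {set {ffun 'I_M -> 'I_M.+1}} := [set f | enc_ok f && ((psize (ffun_part f)) %/ 2 == n)%N
          && is_DD (ffun_part f) && is_core (2 * t + 2)%N (ffun_part f)].
pose Phi (f : {ffun 'I_M -> 'I_M.+1}) : {ffun 'I_t -> bool * 'I_n.+3} :=
  [ffun i : 'I_t => boxinv n.+2 (mvec t (ffun_part f) (t - i))].
have AE f : f \in A -> [/\ enc_ok f, is_partition (ffun_part f), is_DD (ffun_part f),
    bead (ffun_part f) =1 core_beads t (mvec t (ffun_part f)) &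
    (\sum_(i < t) eexp t (t - i) (mvec t (ffun_part f) (t - i)) = n)%N].
  rewrite inE => /andP[/andP[/andP[ef /eqP en] DD] core].
  have hla := filter_pos_partition ef; have hb := core_beads_mvec hla DD core.
  (* By [psize_core] the size is even, so the rounded quotient by 2 is exact. *)
  split=> //; rewrite -en (psize_core hla DD hb) mulKn //.
  by rewrite sum_eexp_rev.
have PhiE f (i : 'I_t) : f \in A -> boxv (Phi f i) = mvec t (ffun_part f) (t - i).
  move=> /AE[_ _ _ _ hn]; rewrite ffunE (@boxinvK t (t - i)) ?leq_subr //.
  by rewrite -[X in (_ <= X.+2)%N]hn (bigD1 i) //= -addnS -addnS leq_addr.
have Phi_inj : {in A &, injective Phi}.
  move=> f1 f2 h1 h2 e; have [e1 p1 _ b1 _] := AE _ h1; have [e2 p2 _ b2 _] := AE _ h2.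
  apply: ffun_part_inj => //; apply: bead_inj => // x; rewrite b1 b2.
  apply: core_beads_ext => k kt; have kt' : (t - k < t)%N by lia.
  have /= := PhiE f1 (Ordinal kt') h1; rewrite e PhiE //= subKn //; lia.
have image : Phi @: A = [set p : {ffun 'I_t -> bool * 'I_n.+3} | (\sum_(i < t) eexp t (t - i) (boxv (p i)) == n)%N].
  apply/setP => p; rewrite inE; apply/imsetP/eqP => [[f hf ->]|hp].
    have [_ _ _ _ hn] := AE _ hf; rewrite -[RHS]hn.
    by apply: eq_bigr => i _; rewrite PhiE.
  (* Row i of the determinant belongs to runner t - i, so the vector is read in reverse. *)
  pose m k : int := if insub (t - k)%N is Some i then boxv (p i) else 0.
  have mE (i : 'I_t) : m (t - i)%N = boxv (p i).
    by rewrite /m subKn ?(ltnW (ltn_ord i)) // valK.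
  have [la [hla DD core hb]] := core_exists t m.
  have sz : psize la = (2 * n)%N.
    rewrite (psize_core hla DD hb) sum_eexp_rev -hp; congr (_ * _)%N.
    by apply: eq_bigr => i _; rewrite mE.
  have szM : (psize la <= M)%N by rewrite sz /M; lia.
  have [f hf fE] := encode_partition hla szM.
  have fA : f \in A by rewrite inE hf fE sz mulKn // eqxx DD core.
  exists f => //; apply/ffunP => i; apply: boxv_inj; rewrite PhiE // fE.
  rewrite (mvec_core_beads hla hb) ?mE //; have := ltn_ord i; lia.
transitivity (\sum_(f in A) altdet (@xvar t) (fun i => bexp t (t - i) (boxv (Phi f i)))).
  rewrite /LHS_coef mulr_sumr; apply: eq_big => [f|f hf]; first by rewrite inE.
  have fA : f \in A by rewrite inE.
  have [_ hla DD hb _] := AE _ fA.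
  rewrite mulrCA [weyl_den _ * _]mulrC /sp -/(weyl_den _) divfK ?weyl_den_xvar_neq0 //.
  rewrite (core_term hla DD hb); congr (\det _).
  by apply/matrixP => i j; rewrite !mxE PhiE.
rewrite -(big_imset (fun p : {ffun 'I_t -> bool * 'I_n.+3} =>
  altdet (@xvar t) (fun i => bexp t (t - i) (boxv (p i)))) Phi_inj) image.
by apply: eq_bigl => p; rewrite inE.
Qed.
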